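(* Let $\mathbf{C}$ be an Abelian semisimple category, let $\Gamma$ be a maximal set of pairwise non-isomorphic simple objects of $\mathbf{C}$, and for $\gamma\in\Gamma$ let $\mathbf{C}_\gamma$ be the full subcategory of $\mathbf{C}$ spanned by the objects isomorphic to $\bigoplus_{i=1}^n\gamma$ for $n\in\mathbb{N}$. Let $\mathcal{C}:\mathbf{C}\to\prod_{\gamma\in\Gamma}\mathbf{C}_\gamma$ be the coloring of $(\mathbf{C},\mathrm{length})$ induced by the canonical decomposition of objects of $\mathbf{C}$ as direct sums of components in the various $\mathbf{C}_\gamma$. Then $\mathcal{C}$ is a tight coloring on $(\mathbf{C},\mathrm{length})$, i.e. for all tame $(\mathbb{R},\le)$-indexed diagrams $F,G$ in $\mathbf{C}$, $$d_{\mathbf{C}}(F,G)=d_{\mathcal{C}}(\mathcal{D}F,\mathcal{D}G),$$ where $d_{\mathbf{C}}$ is the interleaving distance and $d_{\mathcal{C}}$ is the multicolored bottleneck distance.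
   Context: An Abelian category is semisimple if each object is a finite direct sum of simple objects. The length of an object $X$ is $n$ if there is a chain $0\simeq X_0\hookrightarrow X_1\hookrightarrow\dots\hookrightarrow X_n\simeq X$ with all quotients $X_i/X_{i-1}$ simple. The component $\mathcal{C}_\gamma:\mathbf{C}\to\mathbf{C}_\gamma$ sends an object to its $\gamma$-isotypic component, and $\mathbf{C}_\gamma$ is equipped with $\mathrm{length}$. Ranked category: a regular category $\mathbf{R}$ with a rank function, i.e. a lower-bounded $r:\mathrm{Obj}(\mathbf{R})\to\mathbb{Z}$ such that: (1) $r(A)\le r(B)$ for any monomorphism $A\hookrightarrow B$; (2) $r(B)\ge r(D)$ for any regular epimorphism $B\twoheadrightarrow D$; (3) for any pullback square with monomorphisms $A\hookrightarrow B$, $C\hookrightarrow D$ and regular epimorphisms $A\twoheadrightarrow C$, $B\twoheadrightarrow D$, $r(B)-r(A)\ge r(D)-r(C)$. Coloring: a $\Gamma$-coloring of a ranked category $(\mathbf{R},r)$ consists of ranked categories $(\mathbf{Q}_\gamma,r_\gamma)$ and functors $\mathcal{C}_\gamma:\mathbf{R}\to\mathbf{Q}_\gamma$ ($\gamma\in\Gamma$) preserving images (that is, preserving monomorphisms and regular epimorphisms) such that the induced functor $\mathcal{C}:\mathbf{R}\to\prod_{\gamma}\mathbf{Q}_\gamma$ is fully faithful and, for each object $X$, $r_\gamma(\mathcal{C}_\gamma(X))=0$ for all but finitely many $\gamma$ and $r(X)=\sum_\gamma r_\gamma(\mathcal{C}_\gamma(X))$. For a functor $F:(\mathbb{R},\le)\to\mathbf{A}$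 (an $(\mathbb{R},\le)$-indexed diagram), with $\mathbf{A}=\mathbf{C}$ or $\mathbf{A}=\mathbf{C}_\gamma$, put $p_F(u,v)=\mathrm{length}(\mathrm{im}(F(u\le v)))$ for real $u\le v$. $F$ is constant on an interval $I$ if $p_F(a,a)=p_F(a,b)=p_F(b,b)$ for all $a\le b$ in $I$; $a\in\mathbb{R}$ is a regular value if $F$ is constant on some connected neighborhood of $a$, critical otherwise; $F$ is tame if it has finitely many critical values. Multiplicity: for $u<v$ in $\mathbb{R}\cup\{-\infty,+\infty\}$, $\mu(u,v)$ is the minimum, over disjoint connected neighborhoods $I_u,I_v$ of $u$ and $v$, of $$p_F(\sup I_u,\inf I_v)-p_F(\inf I_u,\inf I_v)-p_F(\sup I_u,\sup I_v)+p_F(\inf I_u,\sup I_v),$$ with the convention that $p_F(u,v)=\min_{x,y}p_F(x,y)$ (the minimum of $p_F$ over real $x\le y$) whenever $u$ or $v$ is not finite. If $\mu(u,v)>0$, $(u,v)$ is a cornerpoint. The persistence diagram $\mathcal{D}F$ is the multiset of cornerpoints (with multiplicity $\mu$), along with all diagonal points $(u,u)$, $u\in\mathbb{R}$, each with countably infinite multiplicity. The bottleneck distance is $\inf_{\beta}\sup_{q}\|q-\beta(q)\|_\infty$ over all bijections $\beta$ between the two diagrams, $q$ ranging over the first diagram (equal infinite coordinates are at distance $0$, a finite and an infinite coordinate, or two different infinite ones, at distance $\infty$). Multicolored diagrams: the multicolored persistence diagram of a tame $F$ in $\mathbf{C}$ is the superposition of the diagrams $\mathcal{D}(\mathcal{C}_\gamma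 F)$, the points of $\mathcal{D}(\mathcal{C}_\gamma F)$ having color $\gamma$. The multicolored bottleneck distance $d_{\mathcal{C}}(\mathcal{D}F,\mathcal{D}G)$ is defined like the bottleneck distance, but only allowing bijections that preserve the color of points. Interleaving distance: let $T_b(a)=a+b$ on $(\mathbb{R},\le)$ and, for $b\ge0$, $\eta_b:\mathrm{Id}\to T_b$ the natural transformation $a\le a+b$. For $\epsilon\ge0$, $F,G$ are $\epsilon$-interleaved if there are natural transformations $\phi^F:F\to GT_\epsilon$, $\phi^G:G\to FT_\epsilon$ with $(\phi^GT_\epsilon)\phi^F=F\eta_{2\epsilon}$ and $(\phi^FT_\epsilon)\phi^G=G\eta_{2\epsilon}$. The interleaving distance $d_{\mathbf{C}}(F,G)$ is the infimum of such $\epsilon$ ($\infty$ if there are none).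
   Formalization: The multiplicity at (-∞,+∞) is taken to be min p_F; the stated convention makes it 0 there, so a nonzero constant diagram would have the same persistence diagram as 0 although their interleaving distance is infinite. All other multiplicities are as stated. *)

(* Defs.v *)
From HB Require Import structures.
From mathcomp Require Import all_boot all_order all_algebra.
From mathcomp Require Import all_classical all_reals all_analysis.
Import Order.TTheory GRing.Theory Num.Theory.
Import numFieldNormedType.Exports.

Set Implicit Arguments.
Unset Strict Implicit.
Unset Printing Implicit Defensive.

Local Open Scope classical_set_scope.
Local Open Scope ring_scope.

Record category := Category {
  obj :> Type;
  mor : obj -> obj -> Type;
  idm : forall X, mor X X;
  mcomp : forall X Y Z, mor Y Z -> mor X Y -> mor X Z;
  mcompA : forall W X Y Z (h : mor Y Z) (g : mor X Y) (f : mor W X),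
    mcomp h (mcomp g f) = mcomp (mcomp h g) f;
  mcomp1m : forall X Y (f : mor X Y), mcomp (idm Y) f = f;
  mcompm1 : forall X Y (f : mor X Y), mcomp f (idm X) = f }.

Arguments mor {c} _ _.
Arguments idm {c} X.
Arguments mcomp {c X Y Z} _ _.
Notation "g '\oc' f" := (mcomp g f) (at level 40, left associativity).

Record functor (C D : category) := Functor {
  fob :> obj C -> obj D;
  fmor : forall X Y : C, mor X Y -> mor (fob X) (fob Y);
  fmor1 : forall X, fmor (idm X) = idm (fob X);
  fmorM : forall X Y Z (g : mor Y Z) (f : mor X Y),
    fmor (g \oc f) = fmor g \oc fmor f }.

Arguments fmor {C D} F {X Y} f : rename.

Definition functor_comp (C D E : category) (G : functor D E) (F : functor C D) :
  functor C E.
Proof.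
apply: (@Functor C E (fun X => G (F X)) (fun X Y f => fmor G (fmor F f))).
- by move=> X; rewrite !fmor1.
- by move=> X Y Z g f; rewrite !fmorM.
Defined.

Record nattrans (C D : category) (F G : functor C D) := Nattrans {
  ntr :> forall X : C, mor (F X) (G X);
  ntr_natural : forall (X Y : C) (f : mor X Y),
    ntr Y \oc fmor F f = fmor G f \oc ntr X }.

Definition full_subcategory (C : category) (P : C -> Prop) : category.
Proof.
apply: (@Category {X : C | P X} (fun X Y => mor (sval X) (sval Y))
  (fun X => idm (sval X)) (fun X Y Z g f => g \oc f)).
- by move=> *; exact: mcompA.
- by move=> *; exact: mcomp1m.
- by move=> *; exact: mcompm1.
Defined.

Definition product_category (I : Type) (Q : I -> category) : category.
Proof.
apply: (@Category (forall i, Q i) (fun X Y => forall i, mor (X i) (Y i))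
  (fun X i => idm (X i)) (fun X Y Z g f i => g i \oc f i)).
- by move=> W X Y Z h g f; apply: functional_extensionality_dep => i; exact: mcompA.
- by move=> X Y f; apply: functional_extensionality_dep => i; exact: mcomp1m.
- by move=> X Y f; apply: functional_extensionality_dep => i; exact: mcompm1.
Defined.

Definition induced_functor (C : category) (I : Type) (Q : I -> category)
  (K : forall i, functor C (Q i)) : functor C (product_category Q).
Proof.
apply: (@Functor C (product_category Q) (fun X i => K i X)
  (fun X Y f i => fmor (K i) f)).
- by move=> X; apply: functional_extensionality_dep => i; exact: fmor1.
- by move=> X Y Z g f; apply: functional_extensionality_dep => i; exact: fmorM.
Defined.

Definition fully_faithful (C D : category) (F : functor C D) : Prop :=
  forall X Y : C, bijective (fun f : mor X Y => fmor F f).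

Section Morphisms.
Variable C : category.
Implicit Types X Y Z : C.

Definition is_mono X Y (f : mor X Y) : Prop :=
  forall Z (g h : mor Z X), f \oc g = f \oc h -> g = h.

Definition is_epi X Y (f : mor X Y) : Prop :=
  forall Z (g h : mor Y Z), g \oc f = h \oc f -> g = h.

Definition is_iso X Y (f : mor X Y) : Prop :=
  exists g : mor Y X, g \oc f = idm X /\ f \oc g = idm Y.

Definition isomorphic X Y : Prop := exists f : mor X Y, is_iso f.

Definition is_terminal X : Prop := forall Y, exists! f : mor Y X, True.

Definition is_initial X : Prop := forall Y, exists! f : mor X Y, True.

Definition is_zero_obj X : Prop := is_initial X /\ is_terminal X.

Definition is_zero_mor X Y (f : mor X Y) : Prop :=
  exists (Z : C) (g : mor Z Y) (h : mor X Z), is_zero_obj Z /\ f = g \oc h.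

Definition is_coequalizer X Y Z (f g : mor X Y) (q : mor Y Z) : Prop :=
  q \oc f = q \oc g /\
  forall T (t : mor Y T), t \oc f = t \oc g -> exists! s : mor Z T, s \oc q = t.

Definition is_regular_epi Y Z (q : mor Y Z) : Prop :=
  exists X (f g : mor X Y), is_coequalizer f g q.

Definition is_pullback P X Y Z (p : mor P X) (q : mor P Y)
    (f : mor X Z) (g : mor Y Z) : Prop :=
  f \oc p = g \oc q /\
  forall T (a : mor T X) (b : mor T Y), f \oc a = g \oc b ->
    exists! t : mor T P, p \oc t = a /\ q \oc t = b.

Definition is_kernel K X Y (f : mor X Y) (k : mor K X) : Prop :=
  is_zero_mor (f \oc k) /\
  forall T (t : mor T X), is_zero_mor (f \oc t) ->
    exists! s : mor T K, k \oc s = t.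

Definition is_cokernel X Y Q (f : mor X Y) (q : mor Y Q) : Prop :=
  is_zero_mor (q \oc f) /\
  forall T (t : mor Y T), is_zero_mor (t \oc f) ->
    exists! s : mor Q T, s \oc q = t.

Definition is_direct_sum (I : Type) (A : I -> C) X (inj : forall i, mor (A i) X) :
  Prop :=
  forall Y (g : forall i, mor (A i) Y),
    exists! h : mor X Y, forall i, h \oc inj i = g i.

Definition is_image X Y (f : mor X Y) (Z : C) : Prop :=
  exists (m : mor Z Y) (e : mor X Z),
    [/\ is_mono m, is_regular_epi e & f = m \oc e].

Definition is_simple X : Prop :=
  ~ is_zero_obj X /\
  forall Y (i : mor Y X), is_mono i -> is_zero_obj Y \/ is_iso i.

Inductive has_length : C -> nat -> Prop :=
| has_length0 X : is_zero_obj X -> has_length X 0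
| has_lengthS n X Y Q (i : mor X Y) (q : mor Y Q) :
    has_length X n -> is_mono i -> is_cokernel i q -> is_simple Q ->
    has_length Y n.+1.

(* Objects of infinite length get the value 0. *)
Definition length X : int := (xget 0%N [set n | has_length X n])%:Z.

End Morphisms.

Record preadditive (C : category) := Preadditive {
  hadd : forall X Y : C, mor X Y -> mor X Y -> mor X Y;
  hzero : forall X Y : C, mor X Y;
  hopp : forall X Y : C, mor X Y -> mor X Y;
  haddA : forall X Y, associative (@hadd X Y);
  haddC : forall X Y, commutative (@hadd X Y);
  hadd0 : forall X Y, left_id (@hzero X Y) (@hadd X Y);
  haddN : forall X Y, left_inverse (@hzero X Y) (@hopp X Y) (@hadd X Y);
  comp_haddl : forall X Y Z (g g' : mor Y Z) (f : mor X Y),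
    hadd g g' \oc f = hadd (g \oc f) (g' \oc f);
  comp_haddr : forall X Y Z (g : mor Y Z) (f f' : mor X Y),
    g \oc hadd f f' = hadd (g \oc f) (g \oc f') }.

Record abelian (C : category) := Abelian {
  ab_preadditive :> preadditive C;
  ab_zero : exists X : C, is_zero_obj X;
  ab_biproduct : forall X Y : C,
    exists (Z : C) (i : mor X Z) (j : mor Y Z) (p : mor Z X) (q : mor Z Y),
      [/\ p \oc i = idm X, q \oc j = idm Y
        & hadd ab_preadditive (i \oc p) (j \oc q) = idm Z];
  ab_kernel : forall (X Y : C) (f : mor X Y),
    exists (K : C) (k : mor K X), is_kernel f k;
  ab_cokernel : forall (X Y : C) (f : mor X Y),
    exists (Q : C) (q : mor Y Q), is_cokernel f q;
  ab_mono : forall (X Y : C) (f : mor X Y), is_mono f ->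
    exists (Z : C) (g : mor Y Z), is_kernel g f;
  ab_epi : forall (X Y : C) (f : mor X Y), is_epi f ->
    exists (Z : C) (g : mor Z X), is_cokernel g f }.

Definition semisimple (C : category) : Prop :=
  forall X : C, exists (n : nat) (A : 'I_n -> C) (inj : forall i, mor (A i) X),
    (forall i, is_simple (A i)) /\ is_direct_sum inj.

Record regular_category (C : category) : Prop := RegularCategory {
  reg_terminal : exists X : C, is_terminal X;
  reg_pullback : forall (X Y Z : C) (f : mor X Z) (g : mor Y Z),
    exists (P : C) (p : mor P X) (q : mor P Y), is_pullback p q f g;
  reg_kernel_pair : forall (X Y P : C) (f : mor X Y) (p q : mor P X),
    is_pullback p q f f -> exists (Q : C) (c : mor X Q), is_coequalizer p q c;
  reg_stable : forall (P X Y Z : C) (p : mor P X) (q : mor P Y)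
      (f : mor X Z) (g : mor Y Z),
    is_pullback p q f g -> is_regular_epi g -> is_regular_epi p }.

Record ranked_category (C : category) (r : C -> int) : Prop := RankedCategory {
  rk_regular : regular_category C;
  rk_bounded : exists m : int, forall X, m <= r X;
  rk_mono : forall (A B : C) (f : mor A B), is_mono f -> r A <= r B;
  rk_regular_epi : forall (B D : C) (f : mor B D), is_regular_epi f -> r D <= r B;
  rk_pullback : forall (A B E D : C) (i : mor A B) (e : mor A E)
      (q : mor B D) (j : mor E D),
    is_pullback i e q j -> is_mono i -> is_mono j ->
    is_regular_epi e -> is_regular_epi q ->
    r D - r E <= r B - r A }.

Record is_coloring (C : category) (r : C -> int) (I : Type)
    (Q : I -> category) (rQ : forall i, Q i -> int)
    (K : forall i, functor C (Q i)) : Prop := IsColoring {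
  col_ranked : ranked_category r;
  col_component_ranked : forall i, ranked_category (rQ i);
  col_mono : forall i (X Y : C) (f : mor X Y), is_mono f -> is_mono (fmor (K i) f);
  col_regular_epi : forall i (X Y : C) (f : mor X Y),
    is_regular_epi f -> is_regular_epi (fmor (K i) f);
  col_fully_faithful : fully_faithful (induced_functor K);
  col_finite : forall X : C, finite_set [set i | rQ i (K i X) != 0];
  col_sum : forall X : C,
    r X = \sum_(i \in [set: {classic I}]) rQ i (K i X) }.

Definition real_line (R : realType) : category.
Proof.
apply: (@Category R (fun a b => a <= b) (fun a => lexx a)
  (fun a b c bc ab => le_trans ab bc)).
- by move=> *; exact: bool_irrelevance.
- by move=> *; exact: bool_irrelevance.
- by move=> *; exact: bool_irrelevance.
Defined.

Definition shift_functor (R : realType) (b : R) : functor (real_line R) (real_line R).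
Proof.
apply: (@Functor (real_line R) (real_line R) (fun a : R => a + b)
  (fun (u v : R) (uv : u <= v) => lerD uv (lexx b))).
- by move=> *; exact: bool_irrelevance.
- by move=> *; exact: bool_irrelevance.
Defined.

(* [T_e T_e] plays the role of [T_(2e)]: the component at [a] of [F eta_(2e)]
   is [F] applied to the unique arrow from [a] to [a + e + e]. *)
Definition interleaved (R : realType) (C : category) (e : R)
    (F G : functor (real_line R) C) : Prop :=
  exists (phi : nattrans F (functor_comp G (shift_functor e)))
         (psi : nattrans G (functor_comp F (shift_functor e))),
    forall (a : R) (h : a <= a + e + e),
      psi (a + e) \oc phi a = fmor F (h : @mor (real_line R) a (a + e + e)) /\
      phi (a + e) \oc psi a = fmor G (h : @mor (real_line R) a (a + e + e)).

Definition interleaving_distance (R : realType) (C : category)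
    (F G : functor (real_line R) C) : \bar R :=
  ereal_inf [set e%:E | e in [set e : R | 0 <= e /\ interleaved e F G]].

(* The least element of [A], and 0 when there is none. *)
Definition minimum (A : set int) : int := xget 0 (A `&` lbound A).

Section Persistence.
Variables (R : realType) (C : category) (r : C -> int) (F : functor (real_line R) C).

(* Only meaningful for [u <= v]; the choice of the image does not matter as [r]
   is invariant under isomorphism. *)
Definition pers (u v : R) : int :=
  xget 0 [set n | exists (h : u <= v) (Z : C),
    is_image (fmor F (h : @mor (real_line R) u v)) Z /\ n = r Z].

Definition constant_on (I : set R) : Prop :=
  forall a b, I a -> I b -> a <= b ->
    pers a a = pers a b /\ pers a b = pers b b.

Definition regular_value (a : R) : Prop :=
  exists I : set R, [/\ nbhs a I, connected I & constant_on I].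

Definition tame : Prop := finite_set [set a : R | ~ regular_value a].

Definition min_pers : int :=
  minimum [set n | exists x y : R, x <= y /\ n = pers x y].

Definition epers (u v : \bar R) : int :=
  match u, v with
  | u'%:E, v'%:E => pers u' v'
  | _, _ => min_pers
  end.

Definition box_count (Iu Iv : set (\bar R)) : int :=
  epers (ereal_sup Iu) (ereal_inf Iv) - epers (ereal_inf Iu) (ereal_inf Iv)
  - epers (ereal_sup Iu) (ereal_sup Iv) + epers (ereal_inf Iu) (ereal_sup Iv).

Definition box_minimum (u v : \bar R) : int :=
  minimum [set n | exists Iu Iv : set (\bar R),
    [/\ nbhs u Iu, connected Iu, nbhs v Iv, connected Iv
      & Iu `&` Iv = set0 /\ n = box_count Iu Iv]].

(* At (-oo, +oo) the convention [epers = min_pers] for infinite arguments makes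
   [box_minimum] vanish: the [min_pers] intervals unbounded on both sides would
   not be counted, and a nonzero constant diagram, which is at infinite
   interleaving distance from 0, would have the same cornerpoints as 0.  Those
   intervals are therefore counted separately; at every other point the
   multiplicity is [box_minimum]. *)
Definition multiplicity (u v : \bar R) : int :=
  if (u == -oo%E) && (v == +oo%E) then min_pers else box_minimum u v.

End Persistence.

(* The multiset with multiplicity function [mu], as a type: the copies of a
   cornerpoint (u, v) are the [(u, v, k)] with [k < mu u v], and [inr (u, k)] is
   the copy number [k] of the diagonal point (u, u). *)
Definition diagram (R : realType) (mu : \bar R -> \bar R -> int) : Type :=
  ({c : \bar R * \bar R * nat |
      (c.1.1 < c.1.2)%E && (c.2%:Z < mu c.1.1 c.1.2)} + R * nat)%type.

Definition dgm_point (R : realType) (mu : \bar R -> \bar R -> int)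
    (q : diagram mu) : \bar R * \bar R :=
  match q with
  | inl c => (sval c).1
  | inr d => (d.1%:E, d.1%:E)
  end.

Definition coord_dist (R : realType) (x y : \bar R) : \bar R :=
  if x == y then 0%E else `|x - y|%E.

Definition dgm_point_dist (R : realType) (p q : \bar R * \bar R) : \bar R :=
  maxe (coord_dist p.1 q.1) (coord_dist p.2 q.2).

(* The supremum is taken in [0, +oo], so that it is 0 (and not -oo) when there
   are no colors, hence no points. *)
Definition bottleneck_distance (R : realType) (I : Type)
    (mu nu : I -> \bar R -> \bar R -> int) : \bar R :=
  let D (rho : I -> \bar R -> \bar R -> int) := {i : I & diagram (rho i)} in
  ereal_inf
    [set ereal_sup (0%E |`
       [set dgm_point_dist (dgm_point (projT2 q)) (dgm_point (projT2 (beta q)))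
          | q in [set: D mu]])
    | beta in [set beta : D mu -> D nu |
                bijective beta /\ forall q, projT1 (beta q) = projT1 q]].

Definition multicolored_bottleneck_distance (R : realType) (C : category)
    (I : Type) (Q : I -> category) (rQ : forall i, Q i -> int)
    (K : forall i, functor C (Q i)) (F G : functor (real_line R) C) : \bar R :=
  bottleneck_distance
    (fun i => multiplicity (rQ i) (functor_comp (K i) F))
    (fun i => multiplicity (rQ i) (functor_comp (K i) G)).

Definition tight_coloring (R : realType) (C : category) (r : C -> int) (I : Type)
    (Q : I -> category) (rQ : forall i, Q i -> int)
    (K : forall i, functor C (Q i)) : Prop :=
  is_coloring r rQ K /\
  forall F G : functor (real_line R) C, tame r F -> tame r G ->
    interleaving_distance F G = multicolored_bottleneck_distance rQ K F G.

Definition nonisomorphic_simples (C : category) (Gamma : set C) : Prop :=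
  (forall S, Gamma S -> is_simple S) /\
  (forall S T, Gamma S -> Gamma T -> isomorphic S T -> S = T).

Definition maximal_simples (C : category) (Gamma : set C) : Prop :=
  nonisomorphic_simples Gamma /\
  forall Gamma' : set C, nonisomorphic_simples Gamma' ->
    Gamma `<=` Gamma' -> Gamma' `<=` Gamma.

Definition isotypic (C : category) (S : C) : category :=
  full_subcategory (fun X : C =>
    exists (n : nat) (inj : 'I_n -> mor S X), is_direct_sum inj).

(* The component functors [X |-> X_S], for [S] in [Gamma], together with the
   inclusions of the components that exhibit [X] as their direct sum, naturally
   in [X].  These data are unique up to a unique isomorphism. *)
Record isotypic_decomposition (C : category) (Gamma : set C) :=
  IsotypicDecomposition {
    component :> forall S : Gamma, functor C (isotypic (set_val S));
    component_incl : forall (S : Gamma) (X : C), mor (sval (component S X)) X;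
    component_incl_natural : forall (S : Gamma) (X Y : C) (f : mor X Y),
      f \oc component_incl S X = component_incl S Y \oc fmor (component S) f;
    component_direct_sum : forall X : C,
      is_direct_sum (fun S : Gamma => component_incl S X) }.

(* Main.v *)
(* All monomorphisms and epimorphisms of a semisimple Abelian category split, so
   a tame diagram is a finite direct sum of bars, each of them a simple object
   alive on an interval of times.  A bar decomposition is built along a chain of
   times, one for each cell cut out by the critical values: at a new time,
   Gaussian elimination of the images of the living bars in order of birth lets
   the youngest dependent bar die and corrects the earlier bases.  The
   multiplicity of (u, v) in the component of color S counts the bars of color S
   with endpoints u and v, so everything takes place on bars.

   A bijection of diagrams moving points by less than e defines an interleaving
   bar by bar, since matched bars carry isomorphic objects and unmatched ones
   have length less than 2e.  Conversely, an interleaving phi, psi is turned into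
   a matching through the image I of phi, as for the induced matchings of Bauer
   and Lesnick.  The Frobenius rank inequality shows that for each birth u, the
   quotient I of F has at most as many bars born at u and alive after z as F, and
   at least as many as F has alive after z + 2e (because F -> F T_2e factors
   through I).  Hence the bars of F and I with common birth can be paired in order
   of death.  Dually, the subobject I of G T_e shares deaths with G T_e; the two
   pairings compose to a matching of F with G that respects colors. *)

Require Import Defs.
From HB Require Import structures.
From mathcomp Require Import all_boot all_order all_algebra.
From mathcomp Require Import all_classical all_reals all_analysis.
From mathcomp Require Import lra.

Set Implicit Arguments.
Unset Strict Implicit.
Unset Printing Implicit Defensive.

Import Order.TTheory GRing.Theory Num.Theory.
Import numFieldNormedType.Exports.

Local Open Scope classical_set_scope.
Local Open Scope ring_scope.

(** The argument is linear algebra in which simple objects play the part of lines, and Schur's lemma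
    that of inverting a nonzero scalar. Ranks carry a color predicate [c] and count only the
    summands of that color. The colored rank of a morphism of [C] is the rank of its component
    ([rk_component]), so a single barcode of F in [C] serves all colors.

    A diagram does not record whether a bar contains its endpoints. A bijection that moves points by
    at most c therefore yields an e-interleaving only for e > c, and the infimum absorbs the gap;
    the opposite passage loses nothing.

    A bijection of diagrams must also place the points left over by a matching, among infinitely
    many copies of diagonal points. The leftovers of F and of G with a given color and a given
    midpoint form countably infinite sets, which are put in bijection. Such points have the form (m
    - h, m + h) with 0 <= h <= e, so two of them with the same m are at distance at most e. *)

Lemma dep_choice (I : Type) (T : I -> Type) (P : forall i, T i -> Prop) :
  (forall i, exists y, P i y) -> exists f : forall i, T i, forall i, P i (f i).
Proof.
by move=> exP; exists (fun i => sval (cid (exP i))) => i; case: cid.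
Qed.

(** An alias of [mor] that carries [pC] in its type, so that the additive group structure, and with
    it the big sums, can be inferred. *)
Definition hmor (C : category) (pC : preadditive C) (X Y : C) : Type := mor X Y.

HB.instance Definition _ C pC X Y := gen_eqMixin (@hmor C pC X Y).
HB.instance Definition _ C pC X Y := gen_choiceMixin (@hmor C pC X Y).
HB.instance Definition _ C pC X Y :=
  GRing.isZmodule.Build (@hmor C pC X Y) (@haddA C pC X Y) (@haddC C pC X Y)
    (@hadd0 C pC X Y) (@haddN C pC X Y).

Definition hcomp (C : category) (pC : preadditive C) (X Y Z : C)
  (g : hmor pC Y Z) (f : hmor pC X Y) : hmor pC X Z := g \oc f.
Definition hid (C : category) (pC : preadditive C) (X : C) : hmor pC X X := idm X.

Notation "g '\oh' f" := (hcomp g f) (at level 40, left associativity).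

(** * Bases and ranks in preadditive categories *)

Section Preadditive.
Variables (C : category) (pC : preadditive C).
Local Notation Hom := (hmor pC).
Local Notation Id := (hid pC).

Lemma hcompA W X Y Z (h : Hom Y Z) (g : Hom X Y) (f : Hom W X) :
  h \oh (g \oh f) = h \oh g \oh f.
Proof. exact: mcompA. Qed.

Lemma hcomp1m X Y (f : Hom X Y) : Id Y \oh f = f.
Proof. exact: mcomp1m. Qed.

Lemma hcompm1 X Y (f : Hom X Y) : f \oh Id X = f.
Proof. exact: mcompm1. Qed.

Lemma hcompDl X Y Z (g g' : Hom Y Z) (f : Hom X Y) :
  (g + g') \oh f = g \oh f + g' \oh f.
Proof. exact: comp_haddl. Qed.

Lemma hcompDr X Y Z (g : Hom Y Z) (f f' : Hom X Y) :
  g \oh (f + f') = g \oh f + g \oh f'.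
Proof. exact: comp_haddr. Qed.

Lemma hcomp0m X Y Z (f : Hom X Y) : (0 : Hom Y Z) \oh f = 0.
Proof. by apply: (addrI (0 \oh f)); rewrite -hcompDl !addr0. Qed.

Lemma hcompm0 X Y Z (g : Hom Y Z) : g \oh (0 : Hom X Y) = 0.
Proof. by apply: (addrI (g \oh 0)); rewrite -hcompDr !addr0. Qed.

Lemma hcompNl X Y Z (g : Hom Y Z) (f : Hom X Y) : (- g) \oh f = - (g \oh f).
Proof. by apply: (addIr (g \oh f)); rewrite -hcompDl !addNr hcomp0m. Qed.

Lemma hcompNr X Y Z (g : Hom Y Z) (f : Hom X Y) : g \oh (- f) = - (g \oh f).
Proof. by apply: (addIr (g \oh f)); rewrite -hcompDr !addNr hcompm0. Qed.

Lemma hcompBl X Y Z (g g' : Hom Y Z) (f : Hom X Y) :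
  (g - g') \oh f = g \oh f - g' \oh f.
Proof. by rewrite hcompDl hcompNl. Qed.

Lemma hcompBr X Y Z (g : Hom Y Z) (f f' : Hom X Y) :
  g \oh (f - f') = g \oh f - g \oh f'.
Proof. by rewrite hcompDr hcompNr. Qed.

Lemma hcomp_suml X Y Z (J : Type) (s : seq J) (P : pred J)
    (g : J -> Hom Y Z) (f : Hom X Y) :
  (\sum_(j <- s | P j) g j) \oh f = \sum_(j <- s | P j) g j \oh f.
Proof.
by apply: (big_morph (fun g => g \oh f)) => [x y|]; rewrite ?hcompDl ?hcomp0m.
Qed.

Lemma hcomp_sumr X Y Z (J : Type) (s : seq J) (P : pred J)
    (g : Hom Y Z) (f : J -> Hom X Y) :
  g \oh (\sum_(j <- s | P j) f j) = \sum_(j <- s | P j) g \oh f j.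
Proof.
by apply: (big_morph (fun f => g \oh f)) => [x y|]; rewrite ?hcompDr ?hcompm0.
Qed.

(** The Kronecker symbol. The identity of [A i] has type [Hom (A i) (A j)] only after transport
    along [i = j]. *)
Definition delta (J : eqType) (A : J -> C) (i j : J) : Hom (A i) (A j) :=
  match @eqP J i j with
  | ReflectT h => eq_rect i (fun k => Hom (A i) (A k)) (Id (A i)) j h
  | ReflectF _ => 0
  end.

Lemma delta_id (J : eqType) (A : J -> C) i : delta A i i = Id (A i).
Proof.
rewrite /delta; case: eqP => // h.
by rewrite (eq_irrelevance h (erefl i)).
Qed.

Lemma delta_neq (J : eqType) (A : J -> C) i j : i != j -> delta A i j = 0.
Proof. by rewrite /delta; case: eqP. Qed.

Lemma sum_deltar (J : finType) (P : pred J) (A : J -> C) X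
    (v : forall j, Hom (A j) X) i :
  P i -> \sum_(j | P j) v j \oh delta A i j = v i.
Proof.
move=> Pi; rewrite (bigD1 i) //= delta_id hcompm1 big1 ?addr0 // => j /andP[_ ji].
by rewrite delta_neq ?hcompm0 // eq_sym.
Qed.

Lemma sum_deltal (J : finType) (P : pred J) (A : J -> C) X
    (v : forall j, Hom X (A j)) i :
  P i -> \sum_(j | P j) delta A j i \oh v j = v i.
Proof.
move=> Pi; rewrite (bigD1 i) //= delta_id hcomp1m big1 ?addr0 // => j /andP[_ ji].
by rewrite delta_neq ?hcomp0m.
Qed.

Definition dual_on (J : finType) (P : pred J) (A : J -> C) X
    (v : forall j, Hom (A j) X) (g : forall j, Hom X (A j)) : Prop :=
  forall i j, P i -> P j -> g i \oh v j = delta A j i.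

(** A direct sum decomposition written with injections and projections. The predicate [P] selects a
    subfamily without changing the index type, so that dependent families need no reindexing. *)
Definition basis_on (J : finType) (P : pred J) (A : J -> C) X
    (v : forall j, Hom (A j) X) (g : forall j, Hom X (A j)) : Prop :=
  dual_on P v g /\ \sum_(j | P j) v j \oh g j = Id X.

Lemma basis_eq (J : finType) (P : pred J) (A : J -> C) X Y
    (v : forall j, Hom (A j) X) (g : forall j, Hom X (A j)) (f f' : Hom X Y) :
  \sum_(j | P j) v j \oh g j = Id X ->
  (forall j, P j -> f \oh v j = f' \oh v j) -> f = f'.
Proof.
move=> vg ff'; rewrite -(hcompm1 f) -(hcompm1 f') -vg !hcomp_sumr.
by apply: eq_bigr => j Pj; rewrite !hcompA ff'.
Qed.

Lemma basis_direct_sum (J : finType) (A : J -> C) X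
    (v : forall j, Hom (A j) X) (g : forall j, Hom X (A j)) :
  basis_on predT v g -> is_direct_sum v.
Proof.
move=> [dvg sumvg] Y w; pose h : Hom X Y := \sum_j w j \oh g j.
exists h; split=> [i|h' h'v].
  rewrite -[LHS]/(h \oh v i) hcomp_suml.
  under eq_bigr do rewrite -hcompA dvg //.
  exact: (sum_deltar (P := predT) w).
rewrite -[h']/(h' : Hom X Y) -[RHS](hcompm1 (h' : Hom X Y)) -sumvg hcomp_sumr.
by apply: eq_bigr => j _; rewrite hcompA -[h' \oh _]/(h' \oc v j) h'v.
Qed.

Lemma direct_sum_basis (J : finType) (A : J -> C) X (v : forall j, Hom (A j) X) :
  is_direct_sum v -> exists g : forall j, Hom X (A j), basis_on predT v g.
Proof.
move=> sumv.
have [g gP] := dep_choice (fun i : J => sumv (A i) (fun j => delta A j i)).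
exists g; split=> [i j _ _|]; first exact: (gP i).1.
have [h [_ hu]] := sumv X v.
rewrite -(hu (Id X)); last by move=> i; exact: mcomp1m.
apply/esym/hu => i.
rewrite -[LHS]/((\sum_j v j \oh g j) \oh v i) hcomp_suml.
under eq_bigr => j _ do rewrite -hcompA -[g j \oh v i]/(g j \oc v i) (gP j).1.
exact: (sum_deltar (P := predT) v).
Qed.

End Preadditive.

(* The isotypic components are also instances, so that nothing below requires
   proving that they are Abelian. *)
Record simple_system (C : category) (pC : preadditive C) (Simp : C -> Prop) :
  Prop := SimpleSystem {
  simp_neq0 : forall S, Simp S -> hid pC S <> 0;
  simp_schur : forall S T (f : hmor pC S T), Simp S -> Simp T -> f <> 0 ->
    exists g : hmor pC T S, g \oh f = hid pC S /\ f \oh g = hid pC T;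
  simp_basis : forall X, exists (J : finType) (A : J -> C)
      (v : forall j, hmor pC (A j) X) (g : forall j, hmor pC X (A j)),
    (forall j, Simp (A j)) /\ basis_on predT v g;
  simp_sum : forall (J : finType) (P : pred J) (A : J -> C),
    (forall j, P j -> Simp (A j)) ->
    exists X (v : forall j, hmor pC (A j) X) (g : forall j, hmor pC X (A j)),
    basis_on P v g }.

(** * Gaussian elimination, splittings and exchange *)

Section SimpleSystem.
Variables (C : category) (pC : preadditive C) (Simp : C -> Prop).
Hypothesis sys : simple_system pC Simp.
Local Notation Hom := (hmor pC).
Local Notation Id := (hid pC).

(* The last clause says that [v i] is spanned by pivots [l] with [b l <= b i]: a
   class is only ever corrected by older ones. *)
Lemma elimination (J : finType) (A : J -> C) Y (v : forall j, Hom (A j) Y)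
    (b : J -> nat) (s : seq J) :
  (forall j, j \in s -> Simp (A j)) -> uniq s -> pairwise (relpre b leq) s ->
  exists (P : pred J) (g : forall j, Hom Y (A j)),
  [/\ {subset P <= s}, dual_on P v g,
      forall i, i \in s -> v i = \sum_(l | P l) v l \oh (g l \oh v i)
    & forall i l, i \in s -> P l -> (b i < b l)%N -> g l \oh v i = 0].
Proof.
elim/last_ind: s => [|s i IHs].
  move=> _ _ _; exists pred0, (fun _ => 0).
  by split=> //; move=> ? [].
move=> sSimp; rewrite rcons_uniq pairwise_rcons => /andP[iNs us] /andP[/allP/= bi srt].
have Ai : Simp (A i) by apply: sSimp; rewrite mem_rcons mem_head.
have [|P [g [Ps dvg vE bP]]] := IHs _ us srt.
  by move=> j js; apply: sSimp; rewrite mem_rcons in_cons js orbT.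
have PNi : P i = false by apply/negP => /Ps; rewrite (negbTE iNs).
(* [p] projects onto the span of the pivots found so far, and [w] is what remains of [v i]; the
   index [i] becomes a pivot exactly when [w] is nonzero. *)
pose p : Hom Y Y := \sum_(l | P l) v l \oh g l.
have pE Z (f : Hom Z Y) : p \oh f = \sum_(l | P l) v l \oh (g l \oh f).
  by rewrite hcomp_suml; under eq_bigr do rewrite -hcompA.
pose w := (Id Y - p) \oh v i.
have [w0|w0] := EM (w = 0).
  exists P, g; split=> //.
  - by move=> j Pj; rewrite mem_rcons in_cons Ps ?orbT.
  - move=> j; rewrite mem_rcons in_cons => /predU1P[->|]; last exact: vE.
    by move: w0; rewrite /w hcompBl hcomp1m pE => /subr0_eq.
  - move=> j l; rewrite mem_rcons in_cons => /predU1P[->|]; last exact: bP.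
    by move=> /Ps/bi; rewrite leqNgt => /negbTE ->.
(* A nonzero [w] has a nonzero coordinate in some simple summand of [Y], which Schur's lemma
   inverts. *)
have [K [B [e [e' [SB [_ ee']]]]]] := simp_basis sys Y.
have [k ek] : exists k, e' k \oh w <> 0.
  apply/not_existsP => e'w; apply: w0.
  rewrite -(hcomp1m w) -ee' hcomp_suml big1 // => k _.
  by rewrite -hcompA (contrapT (e'w k)) hcompm0.
have [h [hw _]] := simp_schur sys Ai (SB k) ek.
(* The form dual to the new pivot. The factor [Id Y - p] makes it vanish on all earlier vectors,
   since these lie in the span of the old pivots. *)
pose r := h \oh e' k \oh (Id Y - p).
have rvi : r \oh v i = Id (A i) by rewrite /r -hcompA -/w -hcompA.
have rvj j : j \in s -> r \oh v j = 0.
  by move=> js; rewrite /r -hcompA hcompBl hcomp1m pE -vE // subrr hcompm0.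
(* The old forms are corrected by a multiple of [r] so as to vanish on [v i]; the term with [delta]
   makes one dependently typed formula cover [l = i] too. *)
pose g' l : Hom Y (A l) :=
  delta pC A i l \oh r + (if l == i then 0 else g l - g l \oh v i \oh r).
have g'i : g' i = r by rewrite /g' eqxx addr0 delta_id hcomp1m.
have g'l l : P l -> g' l = g l - g l \oh v i \oh r.
  move=> Pl; have li : l != i by apply: contraTneq Pl => ->; rewrite PNi.
  by rewrite /g' (negbTE li) delta_neq ?hcomp0m ?add0r // eq_sym.
have g'lvi l : P l -> g' l \oh v i = 0.
  by move=> Pl; rewrite g'l // hcompBl -[_ \oh r \oh _]hcompA rvi hcompm1 subrr.
have g'lvj l j : P l -> j \in s -> g' l \oh v j = g l \oh v j.
  by move=> Pl js; rewrite g'l // hcompBl -[_ \oh r \oh _]hcompA rvj // hcompm0 subr0.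
have iPl l : P l -> l != i by apply: contraTneq => ->; rewrite PNi.
exists [pred l | (l == i) || P l], g'; split.
- by move=> j /predU1P[->|/Ps js]; rewrite mem_rcons in_cons ?eqxx ?js ?orbT.
- move=> j l /predU1P[->|Pj] /predU1P[->|Pl].
  + by rewrite g'i rvi delta_id.
  + by rewrite g'i rvj ?Ps // delta_neq // iPl.
  + by rewrite g'lvi // delta_neq // eq_sym iPl.
  + by rewrite g'lvj ?Ps // dvg.
- move=> j jsi; rewrite (bigD1 i) /= ?eqxx //.
  under eq_bigl => l.
    have -> : ((l == i) || P l) && (l != i) = P l.
      by case: (eqVneq l i) => [->|_] /=; rewrite ?PNi ?andbT.
    over.
  move: jsi; rewrite mem_rcons in_cons => /predU1P[->|js].
    by rewrite g'i rvi hcompm1 big1 ?addr0 // => l Pl; rewrite g'lvi // hcompm0.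
  rewrite g'i rvj // hcompm0 add0r [LHS]vE //.
  by apply: eq_bigr => l Pl; rewrite g'lvj.
- move=> j l; rewrite mem_rcons in_cons => /predU1P[->|js] /predU1P[->|Pl].
  + by rewrite ltnn.
  + by rewrite ltnNge bi ?Ps.
  + by rewrite g'i rvj.
  + by rewrite g'lvj //; apply: bP.
Qed.

Lemma span_elimination (J : finType) (A : J -> C) Y (v : forall j, Hom (A j) Y)
    (Q : pred J) :
  (forall j, Q j -> Simp (A j)) ->
  exists (P : pred J) (g : forall j, Hom Y (A j)),
  [/\ {subset P <= Q}, dual_on P v g
    & forall i, Q i -> v i = \sum_(l | P l) v l \oh (g l \oh v i)].
Proof.
move=> QS; have [|||P [g [PQ dvg vE _]]] :=
  @elimination J A Y v (fun=> 0%N) (enum Q).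
- by move=> j; rewrite mem_enum => /QS.
- exact: enum_uniq.
- by elim: (enum Q) => //= x t ->; rewrite andbT; apply/allP.
exists P, g; split=> // [j /PQ|i Qi]; first by rewrite mem_enum.
by apply: vE; rewrite mem_enum.
Qed.

(** [h] sends the coordinates along the pivots among the [f \oh e j] back to the basis vectors
    [e j]. Most splittings below come from this identity: [f \oh h] is a projection onto the image
    of [f], and [h \oh f] a projection along its kernel. *)
Lemma pseudo_inverse X Y (f : Hom X Y) : exists h : Hom Y X, f \oh h \oh f = f.
Proof.
have [J [A [e [e' [SA [_ ee']]]]]] := simp_basis sys X.
have [//|P [g [_ _ feE]]] := @span_elimination J A Y (fun j => f \oh e j) predT.
exists (\sum_(l | P l) e l \oh g l); apply: (basis_eq ee') => i _.
rewrite -hcompA [RHS]feE // hcomp_sumr hcomp_suml.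
by apply: eq_bigr => l _; rewrite !hcompA.
Qed.

(** The image of [p] is rebuilt as the abstract direct sum of the objects of the pivots among the
    [p \oh e j], so that no kernels are needed. *)
Lemma split_idempotent X (p : Hom X X) : p \oh p = p ->
  exists (Z : C) (i : Hom Z X) (r : Hom X Z), r \oh i = Id Z /\ i \oh r = p.
Proof.
move=> pp; have [J [A [e [e' [SA [_ ee']]]]]] := simp_basis sys X.
have [//|P [g [_ dg peE]]] := @span_elimination J A X (fun j => p \oh e j) predT.
have [//|Z [u [u' [du uu']]]] := simp_sum sys (P := P) (A := A).
exists Z, (\sum_(l | P l) p \oh e l \oh u' l), (\sum_(l | P l) u l \oh g l \oh p).
split.
  apply: (basis_eq uu') => l Pl; rewrite hcomp1m -hcompA.
  have -> : (\sum_(l | P l) p \oh e l \oh u' l) \oh u l = p \oh e l.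
    rewrite hcomp_suml; under eq_bigr => m Pm do rewrite -hcompA du //.
    exact: (sum_deltar (fun m => p \oh e m)).
  rewrite hcomp_suml.
  under eq_bigr => m Pm do rewrite -!hcompA [p \oh (p \oh _)]hcompA pp dg //.
  exact: (sum_deltar u).
apply: (basis_eq ee') => i _; rewrite [RHS]peE // -hcompA !hcomp_suml.
apply: eq_bigr => l Pl; rewrite -hcompA; congr (_ \oh _).
rewrite hcomp_sumr.
under eq_bigr => m Pm do rewrite -!hcompA [u' l \oh (u m \oh _)]hcompA du //.
exact: (sum_deltal (fun m => g m \oh (p \oh e i))).
Qed.

(** Here [f] factors through the direct sum of the [A j]; in [mx_indep], the identity of that sum
    factors through [f]. Both are stated by matrices, without forming the sum, and they bound the
    rank from above and from below. *)
Definition mx_factors X Y (f : Hom X Y) (J : finType) (P : pred J) (A : J -> C) :=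
  exists (v : forall j, Hom (A j) Y) (h : forall j, Hom X (A j)),
    f = \sum_(j | P j) v j \oh h j.

Definition mx_indep X Y (f : Hom X Y) (J : finType) (P : pred J) (A : J -> C) :=
  exists (g : forall j, Hom Y (A j)) (u : forall j, Hom (A j) X),
    forall i j, P i -> P j -> g i \oh f \oh u j = delta pC A j i.

(* Pivoting on a nonzero entry removes one index on each side and preserves the
   hypothesis. *)
Lemma steinitz (c : C -> bool) (J K : finType) (P : pred J) (Q : pred K)
    (A : J -> C) (B : K -> C) (a : forall j k, Hom (A j) (B k))
    (b : forall k j, Hom (B k) (A j)) :
  (forall S T, isomorphic S T -> c S = c T) ->
  (forall j, P j -> Simp (A j)) -> (forall k, Q k -> Simp (B k)) ->
  (forall i j, P i -> P j -> \sum_(k | Q k) b k i \oh a j k = delta pC A j i) ->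
  (#|[pred j | P j & c (A j)]| <= #|[pred k | Q k & c (B k)]|)%N.
Proof.
move=> c_iso; move: {2}#|P| (leqnn #|P|) => n.
elim: n J K P Q A B a b => [|n IHn] J K P Q A B a b.
  rewrite leqn0 => /eqP/card0_eq P0 _ _ _; rewrite eq_card0 // => j.
  by rewrite !inE -[P j]/(j \in P) P0.
move=> Pn AS BS ba.
have [j0 Pj0|P0] := pickP P; last first.
  by rewrite eq_card0 // => j; rewrite !inE P0.
have [k0 Qk0 bak0] : exists2 k, Q k & b k j0 \oh a j0 k <> 0.
  apply: contrapT => /forall2NP bak.
  apply: (simp_neq0 sys (AS _ Pj0)); rewrite -(delta_id pC A) -ba // big1 // => k Qk.
  by have [|/contrapT] := bak k.
have a0 : a j0 k0 <> 0 by move=> a0; apply: bak0; rewrite a0 hcompm0.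
have [h [ha ah]] := simp_schur sys (AS _ Pj0) (BS _ Qk0) a0.
have cE : c (A j0) = c (B k0) by apply: c_iso; exists (a j0 k0), h.
pose P' := [pred j | P j & j != j0]; pose Q' := [pred k | Q k & k != k0].
have P'n : (#|P'| <= n)%N.
  move: Pn; rewrite (cardD1 j0) [j0 \in _]Pj0 add1n ltnS.
  by apply: leq_trans; apply/subset_leq_card/fintype.subsetP => j; rewrite !inE andbC.
(* The Schur complement of the pivot [a j0 k0], with [b] unchanged. *)
have H := IHn _ _ P' Q' A B (fun j k => a j k - a j0 k \oh h \oh a j k0) b P'n.
have {H} : (#|[pred j | P' j & c (A j)]| <= #|[pred k | Q' k & c (B k)]|)%N.
  apply: H => [j /andP[/AS]//|k /andP[/BS]//|i j /andP[Pi ij0] /andP[Pj jj0]].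
  transitivity (\sum_(k | Q k) b k i \oh (a j k - a j0 k \oh h \oh a j k0)).
    by rewrite [RHS](bigD1 k0) //= ah hcomp1m subrr hcompm0 add0r.
  under eq_bigr do rewrite hcompBr !hcompA.
  rewrite sumrB ba // -[RHS]subr0; congr (_ - _).
  by rewrite -!hcomp_suml ba // delta_neq ?hcomp0m // eq_sym.
rewrite -(leq_add2l (c (A j0))) {2}cE => H.
rewrite (cardD1 j0) (cardD1 k0) !inE Pj0 Qk0 /=.
apply: leq_trans (leq_trans _ H) _.
  rewrite leq_add2l; apply/subset_leq_card/fintype.subsetP => j; rewrite !inE.
  by rewrite /P' /= => /and3P[-> -> ->].
rewrite leq_add2l; apply/subset_leq_card/fintype.subsetP => k; rewrite !inE.
by rewrite /Q' /= => /andP[/andP[-> ->] ->].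
Qed.
End SimpleSystem.

(** * Colored ranks and the Frobenius inequality *)

Section Rank.
Variables (C : category) (pC : preadditive C) (Simp : C -> Prop).
Hypothesis sys : simple_system pC Simp.
Local Notation Hom := (hmor pC).
Local Notation Id := (hid pC).

Definition iso_invariant (c : C -> bool) := forall S T, isomorphic S T -> c S = c T.

(* The number of simple summands of the image of [f] that satisfy [c]. *)
Definition rank_is (c : C -> bool) X Y (f : Hom X Y) (n : nat) : Prop :=
  exists (J : finType) (P : pred J) (A : J -> C),
    [/\ forall j, P j -> Simp (A j), mx_indep f P A, mx_factors f P A
      & n = #|[pred j | P j & c (A j)]|].

Definition rk (c : C -> bool) X Y (f : Hom X Y) : nat :=
  xget 0%N [set n | rank_is c f n].

Lemma indep_le_factors c X Y (f : Hom X Y) (J K : finType) (P : pred J)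
    (Q : pred K) (A : J -> C) (B : K -> C) :
  iso_invariant c -> (forall j, P j -> Simp (A j)) -> (forall k, Q k -> Simp (B k)) ->
  mx_indep f P A -> mx_factors f Q B ->
  (#|[pred j | P j & c (A j)]| <= #|[pred k | Q k & c (B k)]|)%N.
Proof.
move=> cP AS BS [g [u guP]] [v [h fE]].
apply: (steinitz sys (a := fun j k => h k \oh u j) (b := fun k j => g j \oh v k)) => //.
move=> i j Pi Pj; rewrite -guP // fE hcomp_sumr hcomp_suml.
by apply: eq_bigr => k _; rewrite !hcompA.
Qed.

Lemma rank_exists X Y (f : Hom X Y) :
  exists (J : finType) (P : pred J) (A : J -> C),
  [/\ forall j, P j -> Simp (A j), mx_indep f P A & mx_factors f P A].
Proof.
have [J [A [e [e' [SA [_ ee']]]]]] := simp_basis sys X.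
have [//|P [g [_ dg feE]]] := span_elimination sys (fun j => f \oh e j) (Q := predT).
exists J, P, A; split=> //.
  by exists g, e => i j Pi Pj; rewrite -dg // hcompA.
exists (fun l => f \oh e l), (fun l => g l \oh f); apply: (basis_eq ee') => i _.
by rewrite [LHS]feE // hcomp_suml; apply: eq_bigr => l _; rewrite !hcompA.
Qed.

Lemma rk_is c X Y (f : Hom X Y) : rank_is c f (rk c f).
Proof.
have [J [P [A [AS fi ff]]]] := rank_exists f.
rewrite /rk; case: xgetP => [n -> //|/(_ #|[pred j | P j & c (A j)]|)] [].
by exists J, P, A.
Qed.

Lemma rk_ge c X Y (f : Hom X Y) (J : finType) (P : pred J) (A : J -> C) :
  iso_invariant c -> (forall j, P j -> Simp (A j)) -> mx_indep f P A ->
  (#|[pred j | P j & c (A j)]| <= rk c f)%N.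
Proof.
move=> cP AS fi; have [K [Q [B [BS _ ff ->]]]] := rk_is c f.
exact: indep_le_factors fi ff.
Qed.

Lemma rk_le c X Y (f : Hom X Y) (J : finType) (P : pred J) (A : J -> C) :
  iso_invariant c -> (forall j, P j -> Simp (A j)) -> mx_factors f P A ->
  (rk c f <= #|[pred j | P j & c (A j)]|)%N.
Proof.
move=> cP AS ff; have [K [Q [B [BS fi _ ->]]]] := rk_is c f.
exact: indep_le_factors fi ff.
Qed.

Lemma rk_eq c X Y (f : Hom X Y) (J : finType) (P : pred J) (A : J -> C) :
  iso_invariant c -> (forall j, P j -> Simp (A j)) ->
  mx_indep f P A -> mx_factors f P A ->
  rk c f = #|[pred j | P j & c (A j)]|.
Proof. by move=> *; apply/eqP; rewrite eqn_leq rk_le // rk_ge. Qed.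

Section Color.
Variable c : C -> bool.
Hypothesis c_inv : iso_invariant c.

Lemma rk_comp_le_r X Y Z (g : Hom Y Z) (f : Hom X Y) : (rk c (g \oh f) <= rk c f)%N.
Proof.
have [J [P [A [AS _ [v [h fE]] ->]]]] := rk_is c f.
apply: rk_le => //; exists (fun j => g \oh v j), h.
by rewrite fE hcomp_sumr; under eq_bigr do rewrite hcompA.
Qed.

Lemma rk_comp_le_l X Y Z (g : Hom Y Z) (f : Hom X Y) : (rk c (g \oh f) <= rk c g)%N.
Proof.
have [J [P [A [AS _ [v [h fE]] ->]]]] := rk_is c g.
apply: rk_le => //; exists v, (fun j => h j \oh f).
by rewrite fE hcomp_suml; under eq_bigr do rewrite -hcompA.
Qed.

Lemma rk_comp_split_epi X Y Z (g : Hom Y Z) (f : Hom X Y) (s : Hom Y X) :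
  f \oh s = Id Y -> rk c (g \oh f) = rk c g.
Proof.
move=> fs; apply/eqP; rewrite eqn_leq rk_comp_le_l /=.
by rewrite -{1}(hcompm1 g) -fs hcompA rk_comp_le_l.
Qed.

Lemma rk_comp_split_mono X Y Z (g : Hom Y Z) (f : Hom X Y) (r : Hom Z Y) :
  r \oh g = Id Y -> rk c (g \oh f) = rk c f.
Proof.
move=> rg; apply/eqP; rewrite eqn_leq rk_comp_le_r /=.
by rewrite -{1}(hcomp1m f) -rg -hcompA rk_comp_le_r.
Qed.

Lemma card_sum_pred (J K : finType) (P : pred (J + K)%type) :
  #|P| = (#|[pred j | P (inl j)]| + #|[pred k | P (inr k)]|)%N.
Proof.
rewrite -!sum1_card big_sumType /=; congr (_ + _)%N; exact: eq_bigl.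
Qed.

Lemma rkD X Y (f g : Hom X Y) : (rk c (f + g)%R <= rk c f + rk c g)%N.
Proof.
have [J [P [A [AS _ [v [h fE]] ->]]]] := rk_is c f.
have [K [Q [B [BS _ [w [k gE]] ->]]]] := rk_is c g.
pose AB (x : J + K) := match x with inl j => A j | inr k => B k end.
pose PQ (x : J + K) := match x with inl j => P j | inr k => Q k end.
have -> : (#|[pred j | P j & c (A j)]| + #|[pred k | Q k & c (B k)]| =
  #|[pred x | PQ x & c (AB x)]|)%N by rewrite [RHS]card_sum_pred.
apply: rk_le => //; first by case.
exists (fun x => match x return Hom (AB x) Y with inl j => v j | inr k => w k end).
exists (fun x => match x return Hom X (AB x) with inl j => h j | inr l => k l end).
by rewrite big_sumType /= fE gE.
Qed.

Lemma delta_inl (J K : finType) (AB : J + K -> C) i j :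
  delta pC AB (inl i) (inl j) = delta pC (AB \o inl) i j.
Proof.
have [->|ij] := eqVneq i j; first by rewrite !delta_id.
by rewrite !delta_neq // (inj_eq inl_inj).
Qed.

Lemma delta_inr (J K : finType) (AB : J + K -> C) i j :
  delta pC AB (inr i) (inr j) = delta pC (AB \o inr) i j.
Proof.
have [->|ij] := eqVneq i j; first by rewrite !delta_id.
by rewrite !delta_neq // (inj_eq inr_inj).
Qed.

(* With [k f h] the projection onto the image of [f], the ranks of [k f] and of
   the complementary part of [b] add up below that of [b]. *)
Lemma rk_complement W X Y (b : Hom X Y) (f : Hom W X) (h : Hom Y W) :
  (b \oh f) \oh h \oh (b \oh f) = b \oh f ->
  (rk c (b \oh f) + rk c ((Id Y - b \oh f \oh h)%R \oh b) <= rk c b)%N.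
Proof.
set t := b \oh f => tht.
have [J [P [A [AS [g [u gu]] _ ->]]]] := rk_is c t.
have [K [Q [B [BS [g' [u' gu']] _ ->]]]] := rk_is c ((Id Y - t \oh h) \oh b).
pose AB (x : J + K) := match x with inl j => A j | inr k => B k end.
pose PQ (x : J + K) := match x with inl j => P j | inr k => Q k end.
have -> : (#|[pred j | P j & c (A j)]| + #|[pred k | Q k & c (B k)]| =
  #|[pred x | PQ x & c (AB x)]|)%N by rewrite [RHS]card_sum_pred.
pose G x := match x return Hom Y (AB x) with
  inl j => g j \oh (t \oh h) | inr k => g' k \oh (Id Y - t \oh h) end.
pose U x := match x return Hom (AB x) X with
  inl j => f \oh u j | inr k => u' k - f \oh h \oh b \oh u' k end.
have bU1 j : b \oh U (inl j) = t \oh u j by rewrite /= hcompA.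
have bU2 k : b \oh U (inr k) = (Id Y - t \oh h) \oh b \oh u' k.
  by rewrite /= hcompBr !hcompA !hcompBl hcomp1m.
have tth Z (w : Hom Z W) : t \oh h \oh (t \oh w) = t \oh w by rewrite hcompA tht.
have thq Z (w : Hom Z Y) : t \oh h \oh ((Id Y - t \oh h) \oh w) = 0.
  by rewrite hcompA hcompBr hcompm1 hcompA tht subrr hcomp0m.
have qt Z (w : Hom Z W) : (Id Y - t \oh h) \oh (t \oh w) = 0.
  by rewrite hcompBl hcomp1m tth subrr.
have qq Z (w : Hom Z Y) : (Id Y - t \oh h) \oh ((Id Y - t \oh h) \oh w) =
    (Id Y - t \oh h) \oh w by rewrite [LHS]hcompBl hcomp1m thq subr0.
clearbody t; apply: rk_ge => //; first by case.
exists G, U => -[i|i] [j|j] Pi Pj; rewrite -hcompA.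
- by rewrite bU1 delta_inl -gu //= -hcompA tth hcompA.
- by rewrite bU2 delta_neq //= -!hcompA [t \oh (h \oh _)]hcompA thq hcompm0.
- by rewrite bU1 delta_neq //= -hcompA qt hcompm0.
- by rewrite bU2 delta_inr -gu' //= -[X in _ \oh X]hcompA -hcompA qq !hcompA.
Qed.

(** Let [t = b \oh f], with [t \oh h] the projection onto its image. Then [g \oh b] is
    [g \oh t \oh h \oh b] plus [g] after the complementary part of [b]. The first term has rank at
    most that of [g \oh t], and the second at most the rank of [b] minus that of [t], by
    [rk_complement]. *)
Lemma frobenius W X Y Z (g : Hom Y Z) (b : Hom X Y) (f : Hom W X) :
  (rk c (g \oh b) + rk c (b \oh f) <= rk c (g \oh b \oh f) + rk c b)%N.
Proof.
have [h tht] := pseudo_inverse sys (b \oh f).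
have gbE : g \oh b = g \oh b \oh f \oh (h \oh b) + g \oh ((Id Y - b \oh f \oh h) \oh b).
  by rewrite hcompBl hcompBr hcomp1m !hcompA addrC subrK.
rewrite {1}gbE; apply: leq_trans (leq_add (rkD _ _) (leqnn _)) _.
rewrite -addnA leq_add ?rk_comp_le_l //.
apply: leq_trans (rk_complement tht); rewrite addnC leq_add2l.
exact: rk_comp_le_r.
Qed.

Definition hdim X := rk c (Id X).

Lemma dim_basis X (J : finType) (P : pred J) (A : J -> C)
    (v : forall j, Hom (A j) X) (g : forall j, Hom X (A j)) :
  (forall j, P j -> Simp (A j)) -> basis_on P v g ->
  hdim X = #|[pred j | P j & c (A j)]|.
Proof.
move=> AS [dvg vg]; apply: rk_eq => //; last by exists v, g.
by exists g, v => i j Pi Pj; rewrite hcompm1 dvg.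
Qed.

Lemma rk_le_dim_r X Y (f : Hom X Y) : (rk c f <= hdim Y)%N.
Proof. by rewrite -(hcomp1m f) rk_comp_le_l. Qed.

Lemma dim_le_split X Y (i : Hom X Y) (r : Hom Y X) : r \oh i = Id X -> (hdim X <= hdim Y)%N.
Proof. by move=> ri; rewrite /hdim -ri (leq_trans (rk_comp_le_r _ _)) ?rk_le_dim_r. Qed.

Lemma rk_split_mono X Y (i : Hom X Y) (r : Hom Y X) : r \oh i = Id X -> rk c i = hdim X.
Proof. by move=> ri; rewrite -(hcompm1 i) (rk_comp_split_mono _ ri). Qed.

Lemma rk_split_epi X Y (q : Hom X Y) (s : Hom Y X) : q \oh s = Id Y -> rk c q = hdim Y.
Proof. by move=> qs; rewrite -(hcomp1m q) (rk_comp_split_epi _ qs). Qed.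

Lemma dim_biproduct X Y Z (i : Hom X Y) (r : Hom Y X) (q : Hom Y Z) (s : Hom Z Y) :
  r \oh i = Id X -> q \oh s = Id Z -> q \oh i = 0 -> i \oh r + s \oh q = Id Y ->
  hdim Y = (hdim X + hdim Z)%N.
Proof.
move=> ri qs qi sum1; apply/eqP; rewrite eqn_leq; apply/andP; split.
  rewrite {1}/hdim -sum1 (leq_trans (rkD _ _)) // leq_add //.
    by rewrite (leq_trans (rk_comp_le_r _ _)) ?rk_le_dim_r.
  by rewrite (leq_trans (rk_comp_le_r _ _)) ?rk_le_dim_r.
have /rk_complement : (Id Y \oh i) \oh r \oh (Id Y \oh i) = Id Y \oh i.
  by rewrite !hcomp1m -hcompA ri hcompm1.
have -> : (Id Y - Id Y \oh i \oh r) \oh Id Y = s \oh q.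
  by rewrite hcompm1 hcomp1m -{1}sum1 addrC addKr.
by rewrite hcomp1m (rk_split_mono ri) (rk_comp_split_epi _ qs) (rk_split_mono qs).
Qed.

End Color.

End Rank.

(** * Length *)

Section Split.
Variable C : category.

Lemma split_mono_mono (X Y : C) (f : mor X Y) (r : mor Y X) :
  r \oc f = idm X -> is_mono f.
Proof.
by move=> rf Z g h fg; rewrite -(mcomp1m g) -(mcomp1m h) -rf -!mcompA fg.
Qed.

Lemma split_epi_regular (X Y : C) (f : mor X Y) (s : mor Y X) :
  f \oc s = idm Y -> is_regular_epi f.
Proof.
move=> fs; exists X, (idm X), (s \oc f); split.
  by rewrite mcompm1 mcompA fs mcomp1m.
move=> T t; rewrite mcompm1 => tE; exists (t \oc s); split.
  by rewrite -mcompA -tE.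
by move=> u uf; rewrite -uf -mcompA fs mcompm1.
Qed.

Lemma regular_epi_epi (X Y : C) (f : mor X Y) : is_regular_epi f -> is_epi f.
Proof.
move=> [W [a [b [fab fU]]]] Z g h gh.
have [|s [_ sU]] := fU Z (g \oc f); first by rewrite -!mcompA fab.
by rewrite -(sU g) // (sU h).
Qed.

End Split.

Section SplitSystem.
Variables (C : category) (pC : preadditive C) (Simp : C -> Prop).
Hypothesis sys : simple_system pC Simp.
Local Notation Hom := (hmor pC).
Local Notation Id := (hid pC).

Lemma mono_split X Y (f : Hom X Y) : is_mono f -> exists r : Hom Y X, r \oh f = Id X.
Proof.
move=> fm; have [h fhf] := pseudo_inverse sys f; exists h; apply: fm.
rewrite -[LHS]/(f \oh (h \oh f)) hcompA fhf; exact/esym/(hcompm1 f).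
Qed.

Lemma epi_split X Y (f : Hom X Y) : is_epi f -> exists s : Hom Y X, f \oh s = Id Y.
Proof.
move=> fe; have [h fhf] := pseudo_inverse sys f; exists h; apply: fe.
rewrite -[LHS]/(f \oh h \oh f) fhf; exact/esym/(hcomp1m f).
Qed.

Lemma zero_objP X : is_zero_obj X <-> Id X = 0.
Proof.
split=> [[Xi _]|X0]; first by have [f [_ fU]] := Xi X; rewrite -(fU (Id X)) // (fU (0 : Hom X X)).
split=> Y; exists (0 : Hom _ _); split=> // f _.
  by rewrite -[RHS](hcompm1 (f : Hom X Y)) X0 hcompm0.
by rewrite -[RHS](hcomp1m (f : Hom Y X)) X0 hcomp0m.
Qed.

Lemma zero_obj_exists : exists Z : C, is_zero_obj Z.
Proof.
have [S _|Z [v [g [_ vg]]]] := simp_sum sys (J := void) (P := pred0) (A := of_void C).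
  by case: S.
by exists Z; apply/zero_objP; rewrite -vg big_pred0.
Qed.

Lemma zero_mor_eq0 X Y (f : Hom X Y) : is_zero_mor f -> f = 0.
Proof.
move=> [Z [g [h [/zero_objP Z0 ->]]]].
rewrite -[LHS]/((g : Hom Z Y) \oh (h : Hom X Z)).
by rewrite -(hcomp1m (h : Hom X Z)) Z0 hcomp0m hcompm0.
Qed.

Lemma zero_mor0 X Y : (exists Z : C, is_zero_obj Z) -> is_zero_mor (0 : Hom X Y).
Proof.
move=> [Z Z0]; exists Z, (0 : Hom _ _), (0 : Hom _ _); split=> //.
exact/esym/(hcompm0 X (0 : Hom Z Y)).
Qed.

Lemma zero_morP X Y (f : Hom X Y) : is_zero_mor f <-> f = 0.
Proof. by split=> [/zero_mor_eq0//|->]; exact/zero_mor0/zero_obj_exists. Qed.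

Lemma rk0 c X Y : iso_invariant c -> rk Simp c (0 : Hom X Y) = 0%N.
Proof.
move=> cP; apply/eqP; rewrite -leqn0.
have := @rk_le _ _ _ sys c X Y 0 void pred0 (of_void C) cP.
rewrite eq_card0 //; apply=> //.
by exists (fun=> 0), (fun=> 0); rewrite big_pred0.
Qed.

Lemma iso_predT : iso_invariant (predT : C -> bool). Proof. by []. Qed.

Lemma rk_eq0 X Y (f : Hom X Y) : rk Simp predT f = 0%N -> f = 0.
Proof.
have [J [P [A [_ _ [v [h ->]] ->]]]] := rk_is sys predT f.
by move=> /card0_eq P0; rewrite big_pred0 // => j; have := P0 j; rewrite !inE andbT.
Qed.

(** The complement [Id X - p] has rank zero by [rk_complement]. *)
Lemma rk_full_idem X (p : Hom X X) :
  p \oh p = p -> (hdim pC Simp predT X <= rk Simp predT p)%N -> p = Id X.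
Proof.
move=> pp dp; apply/esym/subr0_eq/rk_eq0/eqP; rewrite -leqn0.
have := @rk_complement _ _ _ sys predT iso_predT _ _ _ (Id X) p (Id X).
rewrite hcomp1m !hcompm1 => /(_ pp) /leq_trans/(_ dp).
by rewrite -[leqRHS]addn0 leq_add2l.
Qed.

(** A pseudo-inverse [h] makes [h \oh f] and [f \oh h] idempotents of full rank, hence
    identities. *)
Lemma rk_full_iso X Y (f : Hom X Y) :
  rk Simp predT f = hdim pC Simp predT X -> rk Simp predT f = hdim pC Simp predT Y ->
  is_iso f.
Proof.
move=> fX fY; have [h fhf] := pseudo_inverse sys f; exists h; split.
  apply: (@rk_full_idem _ (h \oh f)); first by rewrite -hcompA [f \oh _]hcompA fhf.
  by rewrite -fX -{1}fhf -hcompA (rk_comp_le_r sys iso_predT).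
apply: (@rk_full_idem _ (f \oh h)); first by rewrite hcompA fhf.
by rewrite -fY -{1}fhf (rk_comp_le_l sys iso_predT).
Qed.

Lemma Simp_mono_iso S Y (f : Hom Y S) : Simp S -> is_mono f -> is_zero_obj Y \/ is_iso f.
Proof.
move=> SS fm; have [J [A [v [g [AS [dvg vg]]]]]] := simp_basis sys Y.
have [j _|J0] := pickP (predT : pred J); last first.
  by left; apply/zero_objP; rewrite -vg big_pred0.
right; have fv0 : f \oh v j <> 0.
  move=> fv0; apply: (simp_neq0 sys (AS j)).
  have v0 : v j = 0 by apply: fm; rewrite -[LHS]/(f \oh v j) fv0; exact/esym/(hcompm0 _ f).
  by rewrite -(delta_id pC A) -dvg // v0 hcompm0.
have [h [_ fvh]] := simp_schur sys (AS j) SS fv0.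
have [r rf] := mono_split fm; exists r; split=> //.
rewrite -hcompA in fvh; rewrite -[LHS]/(f \oh r) -(hcompm1 r) -fvh.
by rewrite [r \oh _]hcompA rf hcomp1m.
Qed.

(** A simple system only asks for Schur's lemma; simplicity in terms of subobjects is what the
    definition of [length] refers to. *)
Lemma Simp_is_simple S : Simp S -> is_simple S.
Proof.
move=> SS; split=> [/zero_objP|Y f]; first exact: simp_neq0 SS.
exact: Simp_mono_iso.
Qed.

Lemma dim_iso c X Y : iso_invariant c -> isomorphic X Y ->
  hdim pC Simp c X = hdim pC Simp c Y.
Proof.
move=> cP [f [g [gf fg]]]; apply/eqP; rewrite eqn_leq.
by rewrite (dim_le_split sys cP (i := f) (r := g)) // (dim_le_split sys cP (i := g) (r := f)).
Qed.

Lemma dim_Simp S : Simp S -> hdim pC Simp predT S = 1%N.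
Proof.
move=> SS; have := @dim_basis _ _ _ sys predT iso_predT S unit predT (fun=> S)
  (fun=> Id S) (fun=> Id S) (fun _ _ => SS).
move=> ->; first by rewrite (@eq_card _ _ predT) ?card_unit.
split=> [[] [] _ _|]; first by rewrite delta_id hcomp1m.
by rewrite big_const card_unit /= addr0 hcomp1m.
Qed.

Lemma simple_iso_Simp X : is_simple X -> exists2 S, Simp S & isomorphic S X.
Proof.
move=> [X0 Xs]; have [J [A [v [g [AS [dvg vg]]]]]] := simp_basis sys X.
have [j _|J0] := pickP (predT : pred J); last first.
  by case: X0; apply/zero_objP; rewrite -vg big_pred0.
have gv : g j \oh v j = Id (A j) by rewrite dvg // delta_id.
exists (A j) => //; exists (v j).
have [/zero_objP A0|//] := Xs _ (v j) (split_mono_mono gv).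
by have := simp_neq0 sys (AS j).
Qed.

Lemma dim_simple X : is_simple X -> hdim pC Simp predT X = 1%N.
Proof. by move=> /simple_iso_Simp[S SS SX]; rewrite -(dim_iso iso_predT SX) dim_Simp. Qed.

(** By induction along the chain: [i] and its cokernel split, so dimensions add up and a simple
    quotient contributes one. Hence the number chosen in [length] does not depend on the chain. *)
Lemma has_length_dim X n : has_length X n -> n = hdim pC Simp predT X.
Proof.
elim=> {X n} [X X0|n X Y Q i q _ -> im [/zero_morP qi qU] Qs].
  have X0' : Id X = 0 by apply/zero_objP.
  by rewrite /hdim X0' rk0.
have [r ri] := mono_split im.
have [|t [tq _]] := qU Y (Id Y - i \oh r : Hom Y Y).
  apply/zero_morP; rewrite -[LHS]/((Id Y - i \oh r) \oh i).
  by rewrite hcompBl hcomp1m -hcompA ri hcompm1 subrr.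
have q0 : (q : Hom Y Q) \oh i = 0 := qi.
have qt : (q : Hom Y Q) \oh t = Id Q.
  have [|s [_ sU]] := qU Q q; first by apply/zero_morP.
  rewrite -(sU (Id Q)); last exact: hcomp1m.
  apply/esym/sU; rewrite -mcompA tq -[LHS]/((q : Hom Y Q) \oh (Id Y - i \oh r)).
  by rewrite hcompBr hcompm1 hcompA q0 hcomp0m subr0.
rewrite -addn1 -(dim_simple Qs).
apply/esym/(dim_biproduct sys iso_predT ri qt q0).
by rewrite -[X in _ + X]/(t \oc q) tq addrC subrK.
Qed.

(** A chain is obtained by dropping one summand [j0] at a time: the sum [Z] of the others embeds by
    [i], and the cokernel is the coordinate [g j0]. *)
Lemma basis_has_length n X (J : finType) (P : pred J) (A : J -> C)
    (v : forall j, Hom (A j) X) (g : forall j, Hom X (A j)) :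
  (forall j, P j -> Simp (A j)) -> basis_on P v g -> #|P| = n -> has_length X n.
Proof.
elim: n X P v g => [|n IHn] X P v g AS [dvg vg] Pn.
  apply: has_length0; apply/zero_objP; rewrite -vg big_pred0 // => j.
  exact: (card0_eq Pn j).
have [j0 Pj0|P0] := pickP P; last by move: Pn; rewrite eq_card0.
pose P' := [pred j | P j & j != j0].
have AS' j : P' j -> Simp (A j) by move=> /andP[/AS].
have [Z [u [u' uB]]] := simp_sum sys AS'; have [duu uu] := uB.
have P'n : #|P'| = n.
  apply: succn_inj; rewrite -Pn (cardD1 j0) [j0 \in _]Pj0; congr _.+1.
  by apply: eq_card => j; rewrite !inE andbC.
pose i : Hom Z X := \sum_(j | P' j) v j \oh u' j.
pose r : Hom X Z := \sum_(j | P' j) u j \oh g j.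
have iu j : P' j -> i \oh u j = v j.
  move=> Pj; rewrite hcomp_suml; under eq_bigr => k Pk do rewrite -hcompA duu //.
  exact: (sum_deltar v).
have rv j : P' j -> r \oh v j = u j.
  move=> Pj; rewrite hcomp_suml.
  under eq_bigr => k Pk.
    rewrite -hcompA dvg; [over|by case/andP: Pk|by case/andP: Pj].
  exact: (sum_deltar u).
have ri : r \oh i = Id Z.
  by apply: (basis_eq uu) => j Pj; rewrite -hcompA iu // rv // hcomp1m.
apply: (has_lengthS (i := i) (q := g j0) (IHn _ _ _ _ AS' uB P'n)).
- exact: split_mono_mono ri.
- split.
    apply/zero_morP; apply: (basis_eq (f := g j0 \oh i) uu) => j Pj.
    have /andP[Pj' jj0] := Pj.
    by rewrite -hcompA iu // dvg // hcomp0m delta_neq.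
  move=> T t /zero_morP ti; exists ((t : Hom X T) \oh v j0); split=> [|s <-].
    apply: (basis_eq (f := (t : Hom X T) \oh v j0 \oh g j0) (f' := t) vg) => j Pj.
    rewrite -hcompA dvg //; have [->|jj0] := eqVneq j j0; first by rewrite delta_id hcompm1.
    have P'j : P' j by rewrite /= Pj jj0.
    by rewrite delta_neq // hcompm0 -iu // hcompA -[_ \oh i]/(t \oc i) ti hcomp0m.
  rewrite -[LHS]/((s : Hom (A j0) T) \oh g j0 \oh v j0) -hcompA dvg // delta_id.
  exact: hcompm1.
- exact/Simp_is_simple/AS.
Qed.

Lemma dim_has_length X : has_length X (hdim pC Simp predT X).
Proof.
have [J [A [v [g [AS vgB]]]]] := simp_basis sys X.
apply: (basis_has_length (fun j _ => AS j) vgB).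
by rewrite (dim_basis sys iso_predT (fun j _ => AS j) vgB).
Qed.

Lemma lengthE X : length X = (hdim pC Simp predT X)%:Z.
Proof.
congr Posz; apply: xget_unique => [|n]; [exact: dim_has_length|exact: has_length_dim].
Qed.

Lemma image_split X Y (f : Hom X Y) :
  exists (Z : C) (m : Hom Z Y) (e : Hom X Z) (r : Hom Y Z) (s : Hom Z X),
  [/\ r \oh m = Id Z, e \oh s = Id Z & f = m \oh e].
Proof.
have [h fhf] := pseudo_inverse sys f.
have [|Z [i [r [ri ir]]]] := split_idempotent sys (p := f \oh h).
  by rewrite hcompA fhf.
exists Z, i, (r \oh f), r, (h \oh i); split=> //; last by rewrite hcompA ir fhf.
rewrite -[LHS]hcompA [f \oh _]hcompA -ir -[i \oh r \oh i]hcompA ri hcompm1 //.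
Qed.

Lemma is_image_dim X Y (f : Hom X Y) (Z : C) :
  is_image f Z -> length Z = (rk Simp predT f)%:Z.
Proof.
move=> [m [e [/mono_split[r rm] /regular_epi_epi/epi_split[s es] fE]]].
rewrite lengthE; congr Posz; rewrite [in RHS]fE.
rewrite (rk_comp_split_mono sys iso_predT (g := m) e rm).
by rewrite (rk_split_epi sys iso_predT es).
Qed.

Lemma image_exists X Y (f : Hom X Y) : exists Z : C, is_image f Z.
Proof.
have [Z [m [e [r [s [rm es fE]]]]]] := image_split f; exists Z, m, e; split=> //.
  exact: split_mono_mono rm.
exact: split_epi_regular es.
Qed.

Lemma biproduct X Y : exists (Z : C) (i1 : Hom X Z) (p1 : Hom Z X)
    (i2 : Hom Y Z) (p2 : Hom Z Y),
  [/\ p1 \oh i1 = Id X, p2 \oh i2 = Id Y, p1 \oh i2 = 0, p2 \oh i1 = 0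
    & i1 \oh p1 + i2 \oh p2 = Id Z].
Proof.
have [J [A [v [g [AS [dvg vg]]]]]] := simp_basis sys X.
have [K [B [w [h [BS [dwh wh]]]]]] := simp_basis sys Y.
pose AB (x : J + K) := match x with inl j => A j | inr k => B k end.
have [[j _|k _]|Z [u [u' [duu uu]]]] := simp_sum sys (P := predT) (A := AB).
- exact: AS.
- exact: BS.
pose U1 j : Hom (A j) Z := u (inl j); pose U2 k : Hom (B k) Z := u (inr k).
pose U1' j : Hom Z (A j) := u' (inl j); pose U2' k : Hom Z (B k) := u' (inr k).
pose i1 : Hom X Z := \sum_j U1 j \oh g j.
pose p1 : Hom Z X := \sum_j v j \oh U1' j.
pose i2 : Hom Y Z := \sum_k U2 k \oh h k.
pose p2 : Hom Z Y := \sum_k w k \oh U2' k.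
have d11 i j : U1' i \oh U1 j = delta pC A j i.
  rewrite -[LHS]/(u' (inl i) \oh u (inl j)) duu //; exact: delta_inl.
have d22 i j : U2' i \oh U2 j = delta pC B j i.
  rewrite -[LHS]/(u' (inr i) \oh u (inr j)) duu //; exact: delta_inr.
have d12 i j : U1' i \oh U2 j = 0.
  rewrite -[LHS]/(u' (inl i) \oh u (inr j)) duu //; exact: delta_neq.
have d21 i j : U2' i \oh U1 j = 0.
  rewrite -[LHS]/(u' (inr i) \oh u (inl j)) duu //; exact: delta_neq.
have i1v j : i1 \oh v j = U1 j.
  rewrite hcomp_suml; under eq_bigr do rewrite -hcompA dvg //.
  exact: (sum_deltar (P := predT) U1).
have i2w k : i2 \oh w k = U2 k.
  rewrite hcomp_suml; under eq_bigr do rewrite -hcompA dwh //.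
  exact: (sum_deltar (P := predT) U2).
have p1u1 j : p1 \oh U1 j = v j.
  rewrite hcomp_suml; under eq_bigr do rewrite -hcompA d11.
  exact: (sum_deltar (P := predT) v).
have p1u2 k : p1 \oh U2 k = 0.
  by rewrite hcomp_suml big1 // => j _; rewrite -hcompA d12 hcompm0.
have p2u1 j : p2 \oh U1 j = 0.
  by rewrite hcomp_suml big1 // => k _; rewrite -hcompA d21 hcompm0.
have p2u2 k : p2 \oh U2 k = w k.
  rewrite hcomp_suml; under eq_bigr do rewrite -hcompA d22.
  exact: (sum_deltar (P := predT) w).
exists Z, i1, p1, i2, p2; split.
- by apply: (basis_eq vg) => j _; rewrite -hcompA i1v p1u1 hcomp1m.
- by apply: (basis_eq wh) => k _; rewrite -hcompA i2w p2u2 hcomp1m.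
- by apply: (basis_eq wh) => k _; rewrite -hcompA i2w p1u2 hcomp0m.
- by apply: (basis_eq vg) => j _; rewrite -hcompA i1v p2u1 hcomp0m.
- apply: (basis_eq uu) => -[j|k] _; rewrite hcompDl -!hcompA hcomp1m.
    by rewrite -/(U1 j) p1u1 p2u1 i1v hcompm0 addr0.
  by rewrite -/(U2 k) p1u2 p2u2 i2w hcompm0 add0r.
Qed.

Lemma kernel_split X Y (f : Hom X Y) :
  exists (K : C) (i : Hom K X) (r : Hom X K) (h : Hom Y X),
  [/\ r \oh i = Id K, i \oh r = Id X - h \oh f, f \oh i = 0, r \oh h = 0
    & f \oh h \oh f = f].
Proof.
have [h0 fhf0] := pseudo_inverse sys f.
(* This modification of [h0] also satisfies [h \oh f \oh h = h], which yields [r \oh h = 0]. *)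
pose h := h0 \oh f \oh h0.
have fhfl W (x : Hom Y W) : x \oh f \oh h0 \oh f = x \oh f.
  by rewrite -!hcompA [f \oh (h0 \oh f)]hcompA fhf0.
have fhf : f \oh h \oh f = f by rewrite /h !hcompA fhf0 fhf0.
have hfh : h \oh f \oh h = h.
  by rewrite /h !hcompA !fhfl.
have [|K [i [r [ri ir]]]] := split_idempotent sys (p := Id X - h \oh f).
  rewrite hcompBl hcomp1m hcompBr hcompm1 -hcompA [f \oh (h \oh f)]hcompA fhf.
  by rewrite subrr subr0.
exists K, i, r, h; split=> //.
  rewrite -(hcompm1 i) -ri [i \oh _]hcompA ir hcompA hcompBr hcompm1 hcompA fhf.
  by rewrite subrr hcomp0m.
rewrite -(hcomp1m r) -ri -[r \oh i \oh r]hcompA ir -hcompA hcompBl hcomp1m hfh.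
by rewrite subrr hcompm0.
Qed.

Lemma pullback_exists X Y Z (f : Hom X Z) (g : Hom Y Z) :
  exists (P : C) (p : mor P X) (q : mor P Y), is_pullback p q f g.
Proof.
have [W [i1 [p1 [i2 [p2 [p1i1 p2i2 p1i2 p2i1 ip]]]]]] := biproduct X Y.
have [P [i [r [h [ri ir di _ _]]]]] := kernel_split (f \oh p1 - g \oh p2).
exists P, (p1 \oh i), (p2 \oh i); split.
  by apply: (@subr0_eq (hmor pC P Z)); rewrite -di hcompBl -!hcompA.
move=> T a b fagb; pose w : Hom T W := i1 \oh (a : Hom T X) + i2 \oh (b : Hom T Y).
have p1w : p1 \oh w = a by rewrite hcompDr !hcompA p1i1 p1i2 hcomp1m hcomp0m addr0.
have p2w : p2 \oh w = b by rewrite hcompDr !hcompA p2i1 p2i2 hcomp1m hcomp0m add0r.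
have irw : i \oh (r \oh w) = w.
  rewrite hcompA ir hcompBl -hcompA hcompBl -!hcompA p1w p2w.
  by rewrite [f \oh _]fagb subrr hcompm0 subr0 hcomp1m.
exists (r \oh w); split.
  by split; rewrite -[LHS]/(_ \oh i \oh (r \oh w)) -hcompA irw.
move=> t [pt qt].
have it : i \oh (t : Hom T P) = w.
  have pt' : p1 \oh (i \oh (t : Hom T P)) = a by rewrite hcompA; exact: pt.
  have qt' : p2 \oh (i \oh (t : Hom T P)) = b by rewrite hcompA; exact: qt.
  by rewrite -(hcomp1m (i \oh _)) -ip hcompDl -!hcompA pt' qt'.
by rewrite -it hcompA ri hcomp1m.
Qed.

Lemma coequalizer_exists X Y (p q : Hom X Y) :
  exists (Q : C) (c : mor Y Q), is_coequalizer p q c.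
Proof.
have [h dhd] := pseudo_inverse sys (p - q).
have [|Q [i [r [ri ir]]]] := split_idempotent sys (p := Id Y - (p - q) \oh h).
  rewrite [LHS]hcompBl hcomp1m hcompBr hcompm1 hcompA dhd.
  by rewrite subrr subr0.
exists Q, r; split.
  apply: (@subr0_eq (hmor pC X Q)); rewrite -[LHS]/(r \oh p - r \oh q) -hcompBr.
  rewrite -(hcomp1m r) -ri -[r \oh i \oh r]hcompA ir -hcompA hcompBl hcomp1m dhd.
  by rewrite subrr hcompm0.
move=> T t tpq; exists ((t : Hom Y T) \oh i); split=> [|s <-].
  rewrite -[LHS]/((t : Hom Y T) \oh i \oh r) -hcompA ir hcompBr hcompm1 hcompA hcompBr.
  by rewrite -[_ \oh p]/(t \oc p) -[_ \oh q]/(t \oc q) tpq subrr hcomp0m subr0.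
by rewrite -[LHS]/((s : Hom Q T) \oh r \oh i) -hcompA ri hcompm1.
Qed.

Lemma regular_system : regular_category C.
Proof.
split.
- by have [Z [_ Zt]] := zero_obj_exists; exists Z.
- by move=> X Y Z f g; exact: pullback_exists.
- by move=> X Y P f p q _; exact: coequalizer_exists.
(* Regular epimorphisms split, and a section of [g] pulls back to a section of [p]. *)
- move=> P X Y Z p q f g [pfg pU] /regular_epi_epi/epi_split[s gs].
  have [|t [[pt _] _]] := pU X (Id X) ((s : Hom Z Y) \oh (f : Hom X Z)).
    rewrite -[RHS]/((g : Hom Y Z) \oh (s \oh (f : Hom X Z))) hcompA gs hcomp1m.
    exact: mcompm1.
  exact: split_epi_regular pt.
Qed.

Lemma dim_kernel X Y (f : Hom X Y) K (i : Hom K X) (r : Hom X K) (s : Hom Y X) :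
  r \oh i = Id K -> i \oh r = Id X - s \oh f -> r \oh s = 0 -> f \oh s = Id Y ->
  hdim pC Simp predT X = (hdim pC Simp predT Y + hdim pC Simp predT K)%N.
Proof.
move=> ri ir rs fs; apply: (dim_biproduct sys iso_predT fs ri rs).
by rewrite ir addrC subrK.
Qed.

Lemma ranked_system : ranked_category (@length C).
Proof.
split.
- exact: regular_system.
- by exists 0 => X; rewrite lengthE.
- move=> A B f /mono_split[r rf]; rewrite !lengthE lez_nat.
  exact: (dim_le_split sys iso_predT rf).
- move=> B D f /regular_epi_epi/epi_split[s fs]; rewrite !lengthE lez_nat.
  exact: (dim_le_split sys iso_predT fs).
- move=> A B E D i e q j [qije _] /mono_split[i' i'i] _.
  move=> /regular_epi_epi ee /regular_epi_epi qe.
  have [K [k [k' [s [kk ks ek ks0 ese]]]]] := kernel_split e.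
  have [L [l [l' [t [ll lt ql lt0 qtq]]]]] := kernel_split q.
  have es : (e : Hom A E) \oh s = Id E.
    by apply: ee; rewrite -[LHS]/(_ \oh _ \oh (e : Hom A E)) ese;
       exact/esym/(hcomp1m (e : Hom A E)).
  have qt : (q : Hom B D) \oh t = Id D.
    by apply: qe; rewrite -[LHS]/(_ \oh _ \oh (q : Hom B D)) qtq;
       exact/esym/(hcomp1m (q : Hom B D)).
  rewrite !lengthE (dim_kernel kk ks ks0 es) (dim_kernel ll lt lt0 qt).
  (* The lengths of [A] and [B] exceed those of [E] and [D] by the lengths of the kernels of [e] and
     [q], so it suffices that [i] embeds the first kernel in the second. *)
  have KL : (hdim pC Simp predT K <= hdim pC Simp predT L)%N.
    apply: (dim_le_split sys iso_predT (i := l' \oh (i : Hom A B) \oh k)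
      (r := k' \oh (i' : Hom B A) \oh l)).
    rewrite -!hcompA [l \oh (l' \oh _)]hcompA lt hcompBl hcomp1m.
    have -> : t \oh (q : Hom B D) \oh ((i : Hom A B) \oh k) = 0.
      rewrite -hcompA [(q : Hom B D) \oh (_ \oh _)]hcompA -[_ \oh (i : Hom A B)]/(q \oc i) qije.
      by rewrite -[_ \oc e]/((j : Hom E D) \oh (e : Hom A E))
         -[(j : Hom E D) \oh _ \oh _]hcompA ek !hcompm0.
    by rewrite subr0 [i' \oh _]hcompA i'i hcomp1m kk.
  by rewrite !PoszD opprD addrACA lerDl subr_ge0 lez_nat.
Qed.

End SplitSystem.

(** * Semisimple Abelian categories as simple systems *)

Section Abelian.
Variables (C : category) (abC : abelian C) (ssC : semisimple C).
Let pC : preadditive C := abC.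
Local Notation Hom := (hmor pC).
Local Notation Id := (hid pC).

Lemma schur S T (f : Hom S T) : is_simple S -> is_simple T -> f <> 0 -> is_iso f.
Proof.
move=> [S0 Ss] [T0 Ts] f0; have [K [k [fk kU]]] := ab_kernel abC f.
have fk0 : f \oh (k : Hom K S) = 0 by exact: (zero_mor_eq0 (pC := pC)).
have km : is_mono k.
  move=> Z g h kgh; have [|s [_ sU]] := kU Z (k \oc g).
    rewrite mcompA; have -> : f \oc k = (0 : Hom K T) by [].
    have -> : (0 : Hom K T) \oc g = (0 : Hom Z T) by exact: hcomp0m.
    exact/zero_mor0/(ab_zero abC).
  by rewrite -(sU g) // (sU h).
have [/(zero_objP pC) K0|[k' [_ kk']]] := Ss _ k km; last first.
  by case: f0; rewrite -(hcompm1 f) -[Id S]/(idm S) -kk'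
    -[k \oc k']/((k : Hom K S) \oh (k' : Hom S K)) hcompA fk0 hcomp0m.
have fm : is_mono f.
  move=> Z g h fgh; apply: (@subr0_eq (Hom Z S)).
  have [|s [<- _]] := kU Z ((g : Hom Z S) - (h : Hom Z S)).
    have -> : f \oc ((g : Hom Z S) - (h : Hom Z S)) = (0 : Hom Z T).
      rewrite -[LHS]/(f \oh ((g : Hom Z S) - (h : Hom Z S))) hcompBr.
      by rewrite -[_ \oh g]/(f \oc g) -[_ \oh h]/(f \oc h) fgh subrr.
    exact/zero_mor0/(ab_zero abC).
  by rewrite -[LHS]/((k : Hom K S) \oh (s : Hom Z K)) -(hcomp1m (s : Hom Z K)) K0 hcomp0m hcompm0.
by have [|] := Ts _ f fm.
Qed.

Lemma direct_sum_exists (J : finType) (P : pred J) (A : J -> C) :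
  exists X (v : forall j, Hom (A j) X) (g : forall j, Hom X (A j)), basis_on P v g.
Proof.
suff [X [v [g [dvg vg]]]] : exists X (v : forall j, Hom (A j) X) (g : forall j, Hom X (A j)),
    basis_on (mem (enum P)) v g.
  exists X, v, g; split=> [i j Pi Pj|].
    by apply: dvg; rewrite /= mem_enum.
  by rewrite -vg; apply: eq_bigl => j /=; rewrite mem_enum.
elim: (enum P) (enum_uniq P) => [_|j s IHs /= /andP[jNs us]].
  have [Z /(zero_objP pC) Z0] := ab_zero abC; exists Z, (fun=> 0), (fun=> 0).
  by split=> //; rewrite big_pred0.
have [X [v [g [dvg vg]]]] := IHs us.
have [Z [i [l [p [q [pi0 ql0 ipq]]]]]] := ab_biproduct abC X (A j).
have pi : (p : Hom Z X) \oh (i : Hom X Z) = Id X := pi0.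
have ql : (q : Hom Z (A j)) \oh (l : Hom (A j) Z) = Id (A j) := ql0.
have ip : (i : Hom X Z) \oh (p : Hom Z X) + (l : Hom (A j) Z) \oh (q : Hom Z (A j)) = Id Z := ipq.
(* [ab_biproduct] does not state that the cross terms vanish. Composing the sum formula with [p]
   gives [p = p + p \oh l \oh q], and [q] is split by [l]. *)
have pl : (p : Hom Z X) \oh (l : Hom (A j) Z) = 0.
  have plq : (p : Hom Z X) \oh (l : Hom (A j) Z) \oh (q : Hom Z (A j)) = 0.
    apply: (addrI (p : Hom Z X)); rewrite addr0 -[RHS](hcompm1 (p : Hom Z X)) -ip.
    by rewrite hcompDr !hcompA pi hcomp1m.
  by rewrite -(hcompm1 (_ \oh _)) -ql hcompA plq hcomp0m.
have qi : (q : Hom Z (A j)) \oh (i : Hom X Z) = 0.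
  have qip : (q : Hom Z (A j)) \oh (i : Hom X Z) \oh (p : Hom Z X) = 0.
    apply: (addIr (q : Hom Z (A j))); rewrite add0r -[RHS](hcompm1 (q : Hom Z (A j))) -ip.
    by rewrite hcompDr !hcompA ql hcomp1m.
  by rewrite -(hcompm1 (_ \oh _)) -pi hcompA qip hcomp0m.
pose v' k : Hom (A k) Z :=
  (if k == j then 0 else (i : Hom X Z) \oh v k) + (l : Hom (A j) Z) \oh delta pC A k j.
pose g' k : Hom Z (A k) :=
  (if k == j then 0 else g k \oh (p : Hom Z X)) + delta pC A j k \oh (q : Hom Z (A j)).
have v'j : v' j = l by rewrite /v' eqxx add0r delta_id hcompm1.
have g'j : g' j = q by rewrite /g' eqxx add0r delta_id hcomp1m.
have v'k k : k != j -> v' k = (i : Hom X Z) \oh v k.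
  by move=> kj; rewrite /v' (negbTE kj) delta_neq // hcompm0 addr0.
have g'k k : k != j -> g' k = g k \oh (p : Hom Z X).
  by move=> kj; rewrite /g' (negbTE kj) delta_neq 1?eq_sym // hcomp0m addr0.
have sj k : k \in s -> k != j by apply: contraTneq => ->.
exists Z, v', g'; split=> [a b|].
  rewrite /= !in_cons => /predU1P[->|asj] /predU1P[->|bs].
  - by rewrite v'j g'j delta_id.
  - by rewrite g'j v'k ?sj // hcompA qi hcomp0m delta_neq ?sj.
  - by rewrite v'j g'k ?sj // -hcompA pl hcompm0 delta_neq // eq_sym sj.
  - rewrite v'k ?sj // g'k ?sj // -hcompA [(p : Hom Z X) \oh (_ \oh _)]hcompA pi hcomp1m.
    exact: dvg.
rewrite -ip -big_uniq /= ?jNs // big_cons v'j g'j addrC; congr (_ + _).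
rewrite -[i : Hom X Z]hcompm1 -vg -big_uniq // hcomp_sumr hcomp_suml.
by apply: eq_big_seq => k ks; rewrite v'k ?sj // g'k ?sj // !hcompA.
Qed.

Lemma abelian_system : simple_system pC (@is_simple C).
Proof.
split.
- by move=> S [S0 _] /zero_objP.
- by move=> S T f Ss Ts /(schur Ss Ts).
- move=> X; have [n [A [inj [As sumX]]]] := ssC X.
  have [g vgB] := direct_sum_basis (pC := pC) sumX.
  by exists 'I_n, A, inj, g.
- by move=> J P A _; exact: direct_sum_exists.
Qed.

End Abelian.

Definition full_preadditive (C : category) (pC : preadditive C) (P : C -> Prop) :
  preadditive (full_subcategory P) :=
  @Preadditive (full_subcategory P)
    (fun X Y => @hadd C pC (sval X) (sval Y))
    (fun X Y => @hzero C pC (sval X) (sval Y))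
    (fun X Y => @hopp C pC (sval X) (sval Y))
    (fun X Y => @haddA C pC (sval X) (sval Y))
    (fun X Y => @haddC C pC (sval X) (sval Y))
    (fun X Y => @hadd0 C pC (sval X) (sval Y))
    (fun X Y => @haddN C pC (sval X) (sval Y))
    (fun X Y Z => @comp_haddl C pC (sval X) (sval Y) (sval Z))
    (fun X Y Z => @comp_haddr C pC (sval X) (sval Y) (sval Z)).

(** * Isotypic subcategories *)

Section Isotypic.
Variables (C : category) (abC : abelian C) (ssC : semisimple C).
Let pC : preadditive C := abC.
Let sys : simple_system pC (@is_simple C) := abelian_system abC ssC.
Local Notation Hom := (hmor pC).
Local Notation Id := (hid pC).

Lemma isomorphic_sym (D : category) (X Y : D) : isomorphic X Y -> isomorphic Y X.
Proof. by move=> [f [g [gf fg]]]; exists g, f. Qed.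

Lemma isomorphic_trans (D : category) (X Y Z : D) :
  isomorphic X Y -> isomorphic Y Z -> isomorphic X Z.
Proof.
move=> [f [f' [ff' f'f]]] [g [g' [gg' g'g]]]; exists (g \oc f), (f' \oc g'); split.
  by rewrite -mcompA [g' \oc _]mcompA gg' mcomp1m.
by rewrite -mcompA [f \oc _]mcompA f'f mcomp1m.
Qed.

Lemma isomorphic_refl (D : category) (X : D) : isomorphic X X.
Proof. by exists (idm X), (idm X); rewrite mcomp1m. Qed.

Lemma is_iso_comp (D : category) (X Y Z : D) (g : mor Y Z) (f : mor X Y) :
  is_iso g -> is_iso f -> is_iso (g \oc f).
Proof.
move=> [g' [gg' g'g]] [f' [ff' f'f]]; exists (f' \oc g'); split.
  by rewrite -mcompA [g' \oc _]mcompA gg' mcomp1m.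
by rewrite -mcompA [f \oc _]mcompA f'f mcomp1m.
Qed.

Lemma simple_iso (X Y : C) : isomorphic X Y -> is_simple X -> is_simple Y.
Proof.
move=> [f [f' [ff' f'f]]] [X0 Xs]; split.
  move=> /(zero_objP pC) Y0; apply/X0/(zero_objP pC).
  rewrite -[LHS]ff' -[LHS]/((f' : Hom Y X) \oh (f : Hom X Y)) -(hcomp1m (f : Hom X Y)) Y0.
  by rewrite hcomp0m hcompm0.
move=> Z i im; have f'i : is_mono (f' \oc i).
  move=> W g h; rewrite -!mcompA => gh; apply: im.
  by rewrite -(mcomp1m (i \oc g)) -(mcomp1m (i \oc h)) -f'f -!mcompA gh.
have [|f'ii] := Xs Z _ f'i; [by left|right].
have -> : i = f \oc (f' \oc i) by rewrite mcompA f'f mcomp1m.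
by apply: is_iso_comp => //; exists f'.
Qed.

Lemma basis_isotypic S X (J : finType) (P : pred J) (A : J -> C)
    (v : forall j, Hom (A j) X) (g : forall j, Hom X (A j)) :
  (forall j, P j -> isomorphic S (A j)) -> basis_on P v g ->
  exists (n : nat) (inj : 'I_n -> mor S X), is_direct_sum inj.
Proof.
move=> AS [dvg vg].
have th j : exists t : Hom S (A j) * Hom (A j) S,
    P j -> t.2 \oh t.1 = Id S /\ t.1 \oh t.2 = Id (A j).
  have [Pj|] := boolP (P j); last by exists (0, 0).
  by have [f [f' ff']] := AS j Pj; exists (f, f').
have [t tP] := dep_choice th.
have Pe (i : 'I_#|P|) : P (enum_val i) := enum_valP i.
exists #|P|, (fun k => v (enum_val k) \oh (t (enum_val k)).1).
apply: (basis_direct_sum (pC := pC) (g := fun k => (t (enum_val k)).2 \oh g (enum_val k))).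
split=> [i j _ _|].
  rewrite -hcompA [g _ \oh _]hcompA dvg ?Pe //.
  have [->|ij] := eqVneq i j; first by rewrite !delta_id hcomp1m (tP _ (Pe j)).1.
  by rewrite !delta_neq ?hcomp0m ?hcompm0 // 1?eq_sym // (inj_eq enum_val_inj).
rewrite -[RHS]vg [RHS](big_enum_val (fun j => v j \oh g j)); apply: eq_bigr => i _.
by rewrite hcompA -[v _ \oh _ \oh _]hcompA (tP _ (Pe i)).2 hcompm1.
Qed.

Variable S : C.
Hypothesis Ss : is_simple S.

Lemma isotypic_self : exists (n : nat) (inj : 'I_n -> mor S S), is_direct_sum inj.
Proof.
apply: (@basis_isotypic S S unit predT (fun=> S) (fun=> Id S) (fun=> Id S)).
  by move=> *; exact: isomorphic_refl.
split=> [[] [] _ _|]; first by rewrite delta_id hcomp1m.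
by rewrite big_const card_unit /= addr0 hcomp1m.
Qed.

Local Notation pS := (full_preadditive pC (fun X : C =>
  exists (n : nat) (inj : 'I_n -> mor S X), is_direct_sum inj)).

Lemma full_basis (P : C -> Prop) (J : finType) (Q : pred J)
    (A : J -> full_subcategory P) (X : full_subcategory P)
    (v : forall j, Hom (sval (A j)) (sval X)) (g : forall j, Hom (sval X) (sval (A j))) :
  basis_on (pC := pC) Q v g -> basis_on (pC := full_preadditive pC P) Q v g.
Proof.
move=> [dvg vg]; split=> [i j Qi Qj|]; last exact: vg.
by rewrite -[LHS]/(g i \oh v j) dvg.
Qed.

Lemma isotypic_simple (X : isotypic S) : is_simple (sval X) -> isomorphic S (sval X).
Proof.
case: X => X [n [inj sumX]] /= Xs; have [g [dg sg]] := direct_sum_basis (pC := pC) sumX.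
case: n inj sumX g dg sg => [|n] inj sumX g dg sg.
  by case: Xs.1; apply/(zero_objP pC); rewrite -sg big_ord0.
have g0 : g ord0 \oh (inj ord0 : Hom S X) = Id S by rewrite dg // delta_id.
exists (inj ord0); have := @schur C abC S X (inj ord0) Ss Xs; apply=> inj0.
by apply: Ss.1; apply/(zero_objP pC); rewrite -g0 inj0 hcompm0.
Qed.

(** Simplicity is that of the underlying object: Schur's lemma is inherited from [C], and sums of
    simple objects stay in the subcategory because each of these is isomorphic to [S]. *)
Lemma isotypic_system : simple_system pS (fun X : isotypic S => is_simple (sval X)).
Proof.
split.
- by move=> X /(simp_neq0 sys).
- by move=> X Y f Xs Ys f0; exact: (simp_schur sys (f := f)).
- move=> [X Xiso].
  have [n [inj sumX]] : exists (n : nat) (inj : 'I_n -> mor S X), is_direct_sum inj.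
    exact: Xiso.
  have [g vgB] := direct_sum_basis (pC := pC) sumX.
  exists 'I_n, (fun=> exist _ S isotypic_self : isotypic S), inj, g; by split.
- move=> J P A As.
  have [X [v [g vgB]]] := direct_sum_exists abC P (fun j => sval (A j)).
  have Xiso := basis_isotypic (fun j Pj => isotypic_simple (As j Pj)) vgB.
  exists (exist _ X Xiso : isotypic S), v, g.
  exact: (@full_basis _ _ P A (exist _ X Xiso) v g).
Qed.

End Isotypic.

Definition has_color (C : category) (Gamma : set C) (S : Gamma) (A : C) : bool :=
  `[< isomorphic A (set_val S) >].

(** * The coloring by isotypic components *)

Section Maximal.
Variables (C : category) (abC : abelian C) (Gamma : set C).
Hypothesis maxGamma : maximal_simples Gamma.

Lemma color_simple (S : Gamma) : is_simple (set_val S).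
Proof. exact/maxGamma.1.1/set_valP. Qed.

Lemma color_inj (S T : Gamma) : isomorphic (set_val S) (set_val T) -> S = T.
Proof. by move=> ST; apply/val_inj/maxGamma.1.2 => //; exact: set_valP. Qed.

(** Otherwise [A] could be adjoined to [Gamma], against maximality. *)
Lemma color_exists (A : C) : is_simple A -> exists S : Gamma, isomorphic A (set_val S).
Proof.
move=> As; apply/not_existsP => AS.
have AG : Gamma A.
  apply: (maxGamma.2 (A |` Gamma)); [|exact: subsetUr|by left].
  split=> [S [->|/maxGamma.1.1]//|S T [->|GS] [->|GT] //].
  - by move=> AT; case: (AS (SigSub (mem_set GT))).
  - by move=> SA; case: (AS (SigSub (mem_set GS))); exact: isomorphic_sym.
  - exact: maxGamma.1.2.
by case: (AS (SigSub (mem_set AG))); exact: isomorphic_refl.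
Qed.

Lemma has_color_inv (S : Gamma) : iso_invariant (has_color S).
Proof.
move=> A B AB; apply/asboolP/asboolP; last exact: isomorphic_trans.
by apply: isomorphic_trans; exact: isomorphic_sym.
Qed.

Lemma color_uniq (S T : Gamma) (A : C) : has_color S A -> has_color T A -> S = T.
Proof.
move=> /asboolP AS /asboolP AT; apply: color_inj.
exact: isomorphic_trans (isomorphic_sym AS) AT.
Qed.

End Maximal.

(** * Ranks of isotypic components *)

Section Component.
Variables (C : category) (abC : abelian C) (ssC : semisimple C) (Gamma : set C).
Hypothesis maxGamma : maximal_simples Gamma.
Variable K : isotypic_decomposition Gamma.
Let pC : preadditive C := abC.
Let sys : simple_system pC (@is_simple C) := abelian_system abC ssC.
Local Notation Hom := (hmor pC).
Local Notation Id := (hid pC).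
Definition isotypic_preadditive (S : C) : preadditive (isotypic S) :=
  full_preadditive pC (fun X : C =>
    exists (n : nat) (inj : 'I_n -> mor S X), is_direct_sum inj).
Local Notation pS S := (isotypic_preadditive (set_val S)).

Let sysS (S : Gamma) : simple_system (pS S) (fun X : isotypic (set_val S) => is_simple (sval X)).
Proof. exact/isotypic_system/color_simple. Qed.

Definition incl (S : Gamma) X : Hom (sval (K S X)) X := component_incl K S X.

Definition Kmor (S : Gamma) X Y (f : Hom X Y) : hmor (pS S) (K S X) (K S Y) := fmor (K S) f.

Lemma incl_natural (S : Gamma) X Y (f : Hom X Y) :
  f \oh incl S X = incl S Y \oh (Kmor S f : Hom (sval (K S X)) (sval (K S Y))).
Proof. exact: component_incl_natural. Qed.

(** The universal property applied to the Kronecker family; [{classic Gamma}] provides a Boolean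
    equality on the colors by excluded middle. *)
Lemma incl_retract X : exists r : forall S : Gamma, Hom X (sval (K S X)),
  forall S T : Gamma, r S \oh incl T X =
     delta pC (J := {classic Gamma}) (fun S => sval (K S X)) T S.
Proof.
apply: (@dep_choice Gamma (fun S => Hom X (sval (K S X))) (fun S (f : Hom X (sval (K S X))) =>
  forall T : Gamma, f \oh incl T X =
    delta pC (J := {classic Gamma}) (fun S => sval (K S X)) T S)) => S.
have [h [hE _]] := @component_direct_sum C Gamma K X _
  (fun T => delta pC (J := {classic Gamma}) (fun S => sval (K S X)) T S).
by exists h.
Qed.

Lemma incl_mono S X Y (f g : Hom Y (sval (K S X))) :
  incl S X \oh f = incl S X \oh g -> f = g.
Proof.
have [r rE] := incl_retract X => fg.
rewrite -(hcomp1m f) -(hcomp1m g) -(delta_id pC (fun S : {classic Gamma} => sval (K S X)) S).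
by rewrite -rE -!hcompA fg.
Qed.

Lemma incl_eq X Y (f g : Hom X Y) :
  (forall S, f \oh incl S X = g \oh incl S X) -> f = g.
Proof.
move=> fg; have [h [_ hU]] := @component_direct_sum C Gamma K X _ (fun S : Gamma => g \oh incl S X).
by rewrite -(hU f) ?(hU g).
Qed.

(** The functors of a decomposition are not assumed to be additive: naturality of the inclusions
    forces it, since these are monomorphisms. *)
Lemma KmorD S X Y (f g : Hom X Y) : Kmor S (f + g) = Kmor S f + Kmor S g.
Proof.
apply: (incl_mono (f := Kmor S (f + g)) (g := Kmor S f + Kmor S g)).
by rewrite -incl_natural hcompDl [in RHS]hcompDr -!incl_natural.
Qed.

Lemma Kmor0 S X Y : Kmor S (0 : Hom X Y) = 0.
Proof. by apply: (addrI (Kmor S 0)); rewrite -KmorD !addr0. Qed.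

Lemma Kmor_sum S X Y (J : Type) (s : seq J) (P : pred J) (f : J -> Hom X Y) :
  Kmor S (\sum_(j <- s | P j) f j) = \sum_(j <- s | P j) Kmor S (f j).
Proof.
by apply: (big_morph (@Kmor S X Y)) => [? ?|]; rewrite ?KmorD ?Kmor0.
Qed.

Lemma KmorM S X Y Z (g : Hom Y Z) (f : Hom X Y) : Kmor S (g \oh f) = Kmor S g \oh Kmor S f.
Proof. exact: fmorM. Qed.

Lemma Kmor1 S X : Kmor S (Id X) = hid _ (K S X).
Proof. exact: fmor1. Qed.

(** A nonzero component would contain a copy of [S], and its inclusion in [A] would be a nonzero
    morphism between simple objects. *)
Lemma component_other S A : is_simple A -> ~~ has_color S A -> hid (pS S) (K S A) = 0.
Proof.
move=> As /asboolPn AS; apply: contrapT => K0; apply: AS.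
have [J [B [v [g [Bs [dvg vg]]]]]] := simp_basis (sysS S) (K S A).
have [j _|J0] := pickP (predT : pred J); last first.
  by case: K0; rewrite -vg big_pred0.
apply: isomorphic_sym.
have SB : isomorphic (set_val S) (sval (B j)).
  exact: (isotypic_simple abC (color_simple maxGamma S) (Bs j)).
apply: (isomorphic_trans SB).
exists (incl S A \oh (v j : Hom (sval (B j)) (sval (K S A)))).
apply: (@schur C abC) => // f0; apply: (simp_neq0 (sysS S) (Bs j)).
have vj0 : v j = 0.
  apply: (incl_mono (f := v j) (g := 0)).
  by rewrite [LHS]f0 hcompm0.
by have := dvg j j isT isT; rewrite delta_id => <-; rewrite vj0 hcompm0.
Qed.

(** The other components of [A] vanish, so the inclusion of this one is nonzero; it is a split
    monomorphism into a simple object. *)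
Lemma component_own S A : is_simple A -> has_color S A -> isomorphic (sval (K S A)) A.
Proof.
move=> As AS.
have i0 : incl S A <> 0.
  move=> i0; apply: (simp_neq0 sys As); apply: incl_eq => T.
  rewrite hcomp1m hcomp0m; have [->|TS] := pselect (T = S); first exact: i0.
  have TA : ~~ has_color T A by apply/negP => TA; apply: TS; exact: color_uniq TA AS.
  rewrite -[LHS]hcompm1; have := component_other As TA.
  by rewrite -[hid (pS T) _]/(Id (sval (K T A))) => ->; exact: hcompm0.
have [r rE] := incl_retract A.
have im : is_mono (incl S A) by apply: (split_mono_mono (r := r S));
    have := rE S S; rewrite delta_id.
have [K0|//] := As.2 _ _ im; last by exists (incl S A).
case: i0; rewrite -(hcompm1 (incl S A)).
by move/(zero_objP pC): K0 => ->; rewrite hcompm0.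
Qed.

(** The additive functor [K S] carries the matrices that compute the rank of [f] to matrices for
    [Kmor S f]: the summands of color [S] are preserved up to isomorphism, and the others become
    zero. *)
Lemma rk_component S X Y (f : Hom X Y) :
  rk (pC := pS S) (fun X : isotypic (set_val S) => is_simple (sval X)) predT (Kmor S f) =
  rk (@is_simple C) (has_color S) f.
Proof.
have [J [P [A [As [g [u gu]] [v [h fE]] ->]]]] := rk_is sys (has_color S) f.
pose P' j := P j && has_color S (A j).
rewrite (@rk_eq _ _ _ (sysS S) predT _ _ (Kmor S f) J P' (fun j => K S (A j))) //.
- by apply: eq_card => j; rewrite !inE andbT.
- move=> j /andP[Pj jS]; apply: (simple_iso abC) (As j Pj).
  exact/isomorphic_sym/(component_own (As j Pj) jS).
- exists (fun j => Kmor S (g j)), (fun j => Kmor S (u j)) => i j /andP[Pi _] /andP[Pj _].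
  rewrite -!KmorM gu //; have [->|ij] := eqVneq i j; first by rewrite !delta_id Kmor1.
  by rewrite !delta_neq ?Kmor0 // eq_sym.
- exists (fun j => Kmor S (v j)), (fun j => Kmor S (h j)).
  have fE' : Kmor S f = \sum_(j | P' j) Kmor S (v j) \oh Kmor S (h j).
    rewrite {1}fE Kmor_sum (bigID (fun j => has_color S (A j))).
    rewrite -[RHS]addr0; congr (_ + _); first by apply: eq_bigr => j _; rewrite KmorM.
    apply: big1 => j /andP[Pj jS]; rewrite KmorM -(hcompm1 (Kmor S (v j))).
    by rewrite component_other ?hcompm0 ?hcomp0m //; exact: As.
  exact: fE'.
Qed.

Lemma length_component S X :
  length (K S X) = (hdim pC (@is_simple C) (has_color S) X)%:Z.
Proof.
by rewrite (lengthE (sysS S)) /hdim -Kmor1 rk_component.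
Qed.

End Component.

(** * The coloring axioms and the existence of the decomposition *)

Section Coloring.
Variables (C : category) (abC : abelian C) (ssC : semisimple C) (Gamma : set C).
Hypothesis maxGamma : maximal_simples Gamma.
Let pC : preadditive C := abC.
Let sys : simple_system pC (@is_simple C) := abelian_system abC ssC.
Local Notation Hom := (hmor pC).
Local Notation Id := (hid pC).

Section Components.
Variable K : isotypic_decomposition Gamma.

Lemma components_fully_faithful : fully_faithful (induced_functor K).
Proof.
move=> X Y.
have lift (g : forall S, mor (K S X) (K S Y)) :
    exists h : Hom X Y, forall S, Kmor K S h = g S.
  have [h [hE _]] := @component_direct_sum C Gamma K X Y
    (fun S => component_incl K S Y \oc g S).
  exists h => S; apply: (incl_mono (f := Kmor K S h) (g := g S)).
  exact: etrans (esym (incl_natural K S h)) (hE S).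
have [h hE] := choice lift.
exists h => [f|g].
  apply: (incl_eq (abC := abC) (K := K)) => S.
  by rewrite !incl_natural hE.
by apply: functional_extensionality_dep => S; exact: hE.
Qed.

Lemma color_count X (J : finType) (A : J -> C) (v : forall j, Hom (A j) X)
    (g : forall j, Hom X (A j)) S :
  (forall j, is_simple (A j)) -> basis_on predT v g ->
  length (K S X) = (#|[pred j | has_color S (A j)]|)%:Z.
Proof.
move=> As vgB; rewrite (length_component abC ssC maxGamma); congr Posz.
by rewrite (dim_basis sys (has_color_inv S) (fun j _ => As j) vgB).
Qed.

Lemma color_fun (J : Type) (A : J -> C) : (forall j, is_simple (A j)) ->
  exists col : J -> Gamma, forall j S, has_color S (A j) = (S == col j :> {classic Gamma}).
Proof.
move=> As; have [col colP] := choice (fun j => color_exists maxGamma (As j)).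
exists col => j S; apply/idP/eqP => [jS|->]; last exact/asboolP.
by apply: (color_uniq maxGamma jS); exact/asboolP.
Qed.

Lemma components_coloring :
  is_coloring (@length C) (fun S : Gamma => @length (isotypic (set_val S))) K.
Proof.
split.
- exact: ranked_system sys.
- by move=> S; exact: ranked_system (isotypic_system abC ssC (color_simple maxGamma S)).
- move=> S X Y f /(mono_split sys)[r rf].
  apply: (split_mono_mono (r := fmor (K S) (r : mor Y X))).
  by rewrite -fmorM -[r \oc f]/(r \oh (f : Hom X Y)) rf; exact: fmor1.
- move=> S X Y f /regular_epi_epi/(epi_split sys)[s fs].
  apply: (split_epi_regular (s := fmor (K S) (s : mor Y X))).
  by rewrite -fmorM -[f \oc s]/((f : Hom X Y) \oh s) fs; exact: fmor1.
- exact: components_fully_faithful.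
- move=> X; have [J [A [v [g [As vgB]]]]] := simp_basis sys X.
  have [col colE] := color_fun As.
  apply: (@sub_finite_set _ _ [set` map (col : J -> {classic Gamma}) (enum J)]); last first.
    exact: finite_seq.
  move=> S /=; rewrite (color_count S As vgB) => /eqP n0.
  have [j jS|J0] := pickP [pred j | has_color S (A j)]; last by rewrite eq_card0 in n0.
  by move: jS; rewrite inE colE => /eqP ->; apply: map_f; rewrite mem_enum.
- move=> X; have [J [A [v [g [As vgB]]]]] := simp_basis sys X.
  have [col colE] := color_fun As.
  pose s := undup (map (col : J -> {classic Gamma}) (enum J)).
  have us : uniq s by exact: undup_uniq.
  have cols j : (col j : {classic Gamma}) \in s by rewrite mem_undup map_f // mem_enum.
  rewrite (@fsbigE _ _ _ _ _ s) //; last first.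
    move=> S _ Ss; rewrite (color_count S As vgB) eq_card0 // => j.
    by rewrite inE colE; apply: contraNF Ss => /eqP ->.
  rewrite (lengthE sys) (dim_basis sys (@iso_predT C) (fun j _ => As j) vgB).
  rewrite (eq_bigl predT) => [|S]; last exact: in_setT.
  under [RHS]eq_bigr => S _ do rewrite (color_count S As vgB).
  rewrite -(big_morph Posz PoszD (erefl _)); congr Posz.
  rewrite -sum1_card.
  (* Every summand [j] is counted once, under its only color; then the order of summation is
     exchanged. *)
  transitivity (\sum_j \sum_(S <- s | S == col j :> {classic Gamma}) 1)%N.
    by apply: eq_big => [j|j _]; rewrite ?inE // sum1_count [RHS](count_uniq_mem _ us) cols.
  rewrite (exchange_big_dep predT) //=; apply: eq_bigr => S _.
  by rewrite -sum1_card; apply: eq_bigl => j; rewrite inE colE.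
Qed.

End Components.

(** The last two clauses describe the projection by its effect on morphisms from simple objects,
    without reference to the chosen basis; this is the form from which naturality follows. *)
Lemma component_exists (S : Gamma) X : exists z : {Z : isotypic (set_val S) &
    (Hom (sval Z) X * Hom X (sval Z))%type},
  let i := (projT2 z).1 in let r := (projT2 z).2 in
  [/\ r \oh i = Id _,
      forall B (f : Hom B X), is_simple B -> has_color S B -> i \oh r \oh f = f
    & forall B (f : Hom B X), is_simple B -> ~~ has_color S B -> r \oh f = 0].
Proof.
have [J [A [v [g [As [dvg vg]]]]]] := simp_basis sys X.
pose P j := has_color S (A j).
have [Z [u [u' uB]]] := direct_sum_exists abC P A; have [duu uu] := uB.
have Ziso := basis_isotypic (fun j Pj => isomorphic_sym (asboolW Pj)) uB.
pose i : Hom Z X := \sum_(j | P j) v j \oh u' j.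
pose r : Hom X Z := \sum_(j | P j) u j \oh g j.
have iu j : P j -> i \oh u j = v j.
  move=> Pj; rewrite hcomp_suml; under eq_bigr => k Pk do rewrite -hcompA duu //.
  exact: (sum_deltar v).
have rv j : P j -> r \oh v j = u j.
  move=> Pj; rewrite hcomp_suml; under eq_bigr => k Pk do rewrite -hcompA dvg //.
  exact: (sum_deltar u).
have irE : i \oh r = \sum_(j | P j) v j \oh g j.
  rewrite /r hcomp_sumr; apply: eq_bigr => j Pj; by rewrite hcompA iu.
have gf B (f : Hom B X) j : is_simple B -> has_color S B != P j -> g j \oh f = 0.
  move=> Bs BP; apply: contrapT => gf0; case/negP: BP.
  by apply/eqP/has_color_inv; exists (g j \oh f); exact: schur Bs (As j) gf0.
exists (existT (fun Z : isotypic (set_val S) => (Hom (sval Z) X * Hom X (sval Z))%type)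
  (exist _ Z Ziso : isotypic (set_val S)) (i, r)); split=> /=.
- by apply: (basis_eq uu) => j Pj; rewrite -hcompA iu // rv // hcomp1m.
- move=> B f Bs BS; rewrite irE -[RHS]hcomp1m -vg !hcomp_suml.
  rewrite [RHS](bigID P) /= [X in _ + X]big1 ?addr0 // => j Pj.
  by rewrite -hcompA gf ?hcompm0 // BS eq_sym eqb_id.
- move=> B f Bs BS; rewrite hcomp_suml big1 // => j Pj.
  by rewrite -hcompA gf ?hcompm0 // Pj (negbTE BS).
Qed.

Lemma decomposition_exists : inhabited (isotypic_decomposition Gamma).
Proof.
have [z zP] := dep_choice (fun S => dep_choice (component_exists S)).
pose Z S X := projT1 (z S X); pose i S X := (projT2 (z S X)).1.
pose r S X := (projT2 (z S X)).2.
have ri S X : r S X \oh i S X = Id _ by have [] := zP S X.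
have irf S X B (f : Hom B X) : is_simple B -> has_color S B -> i S X \oh (r S X \oh f) = f.
  by move=> Bs BS; rewrite hcompA; have [_ irf _] := zP S X; exact: irf.
have rf0 S X B (f : Hom B X) : is_simple B -> ~~ has_color S B -> r S X \oh f = 0.
  by move=> Bs BS; have [_ _] := zP S X; exact.
(* [f] maps the part of color [S] into the part of color [S]: simple summands of that color are
   fixed by [i] after [r], and no other color occurs in [Z S X], since [r S X] kills it while
   [i S X] is a split monomorphism. *)
have nat S X Y (f : Hom X Y) : i S Y \oh (r S Y \oh (f \oh i S X)) = f \oh i S X.
  have [J [B [v [g [Bs [_ vg]]]]]] := simp_basis sys (sval (Z S X)).
  apply: (basis_eq vg) => j _; have [jS|jS] := boolP (has_color S (B j)).
    by rewrite -!hcompA irf.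
  have -> : v j = 0 by rewrite -(hcomp1m (v j)) -ri -hcompA rf0.
  by rewrite !hcompm0.
pose Kf S X Y (f : mor X Y) : mor (Z S X) (Z S Y) := r S Y \oh ((f : Hom X Y) \oh i S X).
have Kf1 S X : Kf S X X (idm X) = idm (Z S X).
  by rewrite -[RHS](ri S X) /Kf -[idm X]/(Id X) hcomp1m.
have KfM S X Y W (g : mor Y W) (f : mor X Y) : Kf S X W (g \oc f) = Kf S Y W g \oc Kf S X Y f.
  rewrite -[RHS]/(r S W \oh ((g : Hom Y W) \oh i S Y) \oh (r S Y \oh ((f : Hom X Y) \oh i S X))).
  rewrite -!hcompA nat -[LHS]/(r S W \oh ((g : Hom Y W) \oh (f : Hom X Y) \oh i S X)).
  by rewrite -[X in _ \oh X = _]hcompA.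
pose K S : functor C (isotypic (set_val S)) :=
  @Functor C (isotypic (set_val S)) (Z S) (Kf S) (Kf1 S) (KfM S).
constructor; apply: (@IsotypicDecomposition C Gamma K i) => [S X Y f|X Y w].
  exact/esym/nat.
have [J [A [v [g [As [dvg vg]]]]]] := simp_basis sys X.
have [col colE] := color_fun As.
have hsum S B (f : Hom B X) : is_simple B -> has_color S B ->
    \sum_j (w (col j) : Hom _ Y) \oh (r (col j) X \oh v j) \oh g j \oh f = w S \oh (r S X \oh f).
  move=> Bs BS; rewrite -[in RHS](hcomp1m f) -vg hcomp_suml !hcomp_sumr.
  apply: eq_bigr => j _; have [jS|jS] := boolP (has_color S (A j)).
    by move: jS; rewrite colE => /eqP ->; rewrite !hcompA.
  have gf0 : g j \oh f = 0.
    apply: contrapT => gf0; case/negP: jS; rewrite -(@has_color_inv _ _ S B) //.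
    by exists (g j \oh f); exact: schur Bs (As j) gf0.
  by rewrite -!hcompA gf0 !hcompm0.
(* The sum runs over the finitely many simple summands of [X] and not over [Gamma], which may be
   infinite. *)
exists (\sum_j (w (col j) : Hom _ Y) \oh (r (col j) X \oh v j) \oh g j); split.
  move=> S; rewrite -[LHS]/(_ \oh i S X).
  have [K' [B [u [u' [Bs [_ uu]]]]]] := simp_basis sys (sval (Z S X)).
  apply: (basis_eq uu) => k _; rewrite -hcompA hcomp_suml.
  have [kS|kS] := boolP (has_color S (B k)).
    by rewrite (hsum S) // [r S X \oh _]hcompA ri hcomp1m.
  have -> : u k = 0 by rewrite -(hcomp1m (u k)) -ri -hcompA rf0.
  by rewrite !hcompm0 big1 // => j _; rewrite !hcompm0.
move=> h hi; apply: (basis_eq (f' := h) vg) => j _.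
have jS : has_color (col j) (A j) by rewrite colE.
rewrite hcomp_suml (hsum (col j)) //.
by rewrite -hi -[_ \oc i _ _]/((h : Hom X Y) \oh i (col j) X) -hcompA irf.
Qed.

End Coloring.

(** * Barcodes of tame diagrams *)

Section Transition.
Variables (R : realType) (C : category) (pC : preadditive C).
Local Notation Hom := (hmor pC).
Local Notation Id := (hid pC).
Implicit Type F : functor (real_line R) C.

(** Transition maps that do not depend on a proof of [s <= t]; the value 0 is a mere default. *)
Definition tr F (s t : R) : Hom (F s) (F t) :=
  match pselect (s <= t) with
  | left h => fmor F (h : @mor (real_line R) s t)
  | right _ => 0
  end.

Lemma trE F (s t : R) (h : s <= t) : tr F s t = fmor F (h : @mor (real_line R) s t).
Proof. by rewrite /tr; case: pselect => // h'; rewrite (bool_irrelevance h' h). Qed.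

Lemma tr_id F (s : R) : tr F s s = Id (F s).
Proof. by rewrite (trE F (lexx s)); exact: fmor1. Qed.

Lemma trM F (s t u : R) : s <= t -> t <= u -> tr F t u \oh tr F s t = tr F s u.
Proof.
move=> st tu; rewrite (trE F st) (trE F tu) (trE F (le_trans st tu)).
rewrite -[LHS]/(fmor F (tu : @mor (real_line R) t u) \oc fmor F (st : @mor (real_line R) s t)).
by rewrite -fmorM.
Qed.

(** As [M] and [N] are disjoint, the matrix [c] squares to zero and [1 - c] has the inverse [1 + c].
    By the condition on [c], a vector of [Q] is never corrected by one outside [Q]; this is what
    lets one matrix serve at all times. *)
Lemma basis_shear (J : finType) (Q M N : pred J) (A : J -> C) X
    (v : forall j, Hom (A j) X) (g : forall j, Hom X (A j))
    (c : forall i j, Hom (A j) (A i)) :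
  basis_on Q v g -> (forall j, M j -> ~~ N j) ->
  (forall i j, M i -> N j -> Q j -> ~~ Q i -> c i j = 0) ->
  basis_on Q (fun j => if N j then v j - \sum_(i | M i) v i \oh c i j else v j)
    (fun i => if M i then g i + \sum_(j | N j && Q j) c i j \oh g j else g i).
Proof.
move=> [dvg vg] MN cQ.
have NM j : N j -> ~~ M j by apply: contraL => /MN.
have gvc i j : Q i -> Q j -> N j -> g i \oh (\sum_(k | M k) v k \oh c k j) =
    if M i then c i j else 0.
  move=> Qi Qj Nj; rewrite hcomp_sumr.
  have gvcE k : M k -> g i \oh (v k \oh c k j) = if k == i then c i j else 0.
    move=> Mk; have [Qk|/(cQ k j Mk Nj Qj) ck0] := boolP (Q k).
      rewrite hcompA dvg //; have [->|ki] := eqVneq k i; first by rewrite delta_id hcomp1m.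
      by rewrite delta_neq // hcomp0m.
    by rewrite ck0 !hcompm0; case: eqVneq => // <-.
  rewrite (eq_bigr _ gvcE); case: ifP => Mi; last first.
    by apply: big1 => k Mk; case: eqVneq Mk => // ->; rewrite Mi.
  rewrite (bigD1 i) //= eqxx big1 ?addr0 // => k /andP[_ /negbTE ->] //.
split=> [i j Qi Qj|].
  have vgij : (if M i then g i + \sum_(k | N k && Q k) c i k \oh g k else g i) \oh v j =
      delta pC A j i + if M i && N j then c i j else 0.
    case: ifP => Mi /=; last by rewrite addr0 dvg.
    rewrite hcompDl dvg // hcomp_suml; congr (_ + _).
    case: ifP => Nj.
      rewrite (bigD1 j) ?Nj //= -hcompA dvg // delta_id hcompm1 big1 ?addr0 //.
      move=> k /andP[/andP[_ Qk] kj].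
      by rewrite -hcompA dvg // delta_neq ?hcompm0 // eq_sym.
    apply: big1 => k /andP[Nk Qk]; rewrite -hcompA dvg // delta_neq ?hcompm0 //.
    by apply: contraFneq Nj => ->.
  have [Nj|Nj] := boolP (N j); last by rewrite vgij (negbTE Nj) andbF addr0.
  rewrite hcompBr vgij Nj andbT; case: ifP => Mi; last first.
    by rewrite gvc // Mi addr0 subr0.
  rewrite hcompDl gvc // Mi hcomp_suml big1 ?addr0 ?addrK //.
  move=> k /andP[Nk Qk]; rewrite -hcompA gvc // (negbTE (NM _ Nk)) hcompm0 //.
transitivity (\sum_(j | Q j) v j \oh g j); last exact: vg.
pose a i j := v i \oh c i j \oh g j.
have termE j : Q j ->
    (if N j then v j - \sum_(i | M i) v i \oh c i j else v j) \oh
    (if M j then g j + \sum_(k | N k && Q k) c j k \oh g k else g j) =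
    v j \oh g j + ((\sum_(k | N k && Q k) if M j then a j k else 0)
                   - (\sum_(i | M i) if N j then a i j else 0)).
  move=> Qj; have [Nj|Nj] := boolP (N j).
    rewrite (negbTE (NM _ Nj)) hcompBl hcomp_suml [X in _ + (X - _)]big1 // sub0r //.
  rewrite [X in _ + (_ - X)]big1 // subr0; case: ifP => Mj.
    by rewrite hcompDr hcomp_sumr; congr (_ + _); apply: eq_bigr => k _; rewrite hcompA.
  by rewrite big1 // addr0.
rewrite (eq_bigr _ termE) big_split /= -[RHS]addr0; congr (_ + _).
rewrite sumrB; apply/eqP; rewrite subr_eq0; apply/eqP.
transitivity (\sum_j \sum_(k | N k && Q k) if M j then a j k else 0).
  rewrite big_mkcond; apply: eq_bigr => j _; case: ifP => // Qj.
  rewrite big1 // => k /andP[Nk Qk]; case: ifP => // Mj.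
  by rewrite /a cQ ?Qj // hcompm0 hcomp0m.
rewrite exchange_big [RHS]big_mkcond [LHS]big_mkcond.
apply: eq_bigr => k _; case: (Q k); rewrite ?andbF // andbT; case: (N k).
  by rewrite [RHS]big_mkcond.
by rewrite big1.
Qed.

Section Chain.
Variable Simp : C -> Prop.
Hypothesis sys : simple_system pC Simp.
Variables (F : functor (real_line R) C) (x : nat -> R).
Hypothesis x_mono : forall m n, (m <= n)%N -> x m <= x n.

(* A bar [j] is alive at the times in the half-open interval [b j, d j), which
   may be empty. *)
Definition chain_barcode (m : nat) := exists (J : finType) (A : J -> C)
  (b d : J -> nat) (e : forall j l, Hom (A j) (F (x l)))
  (e' : forall j l, Hom (F (x l)) (A j)),
  [/\ forall j, Simp (A j), forall j, (b j <= m)%N,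
      forall l, (l <= m)%N ->
        basis_on [pred j | (b j <= l < d j)%N] (e ^~ l) (e' ^~ l)
    & forall j l n, (b j <= l < d j)%N -> (l <= n <= m)%N ->
        tr F (x l) (x n) \oh e j l = if (n < d j)%N then e j n else 0].

Lemma chain_barcode0 : chain_barcode 0.
Proof.
have [J [A [v [g [As [dvg vg]]]]]] := simp_basis sys (F (x 0%N)).
exists J, A, (fun=> 0%N), (fun=> 1%N), (fun j l => tr F (x 0%N) (x l) \oh v j),
  (fun j l => g j \oh tr F (x l) (x 0%N)).
have tr00 j : tr F (x 0%N) (x 0%N) \oh v j = v j by rewrite tr_id hcomp1m.
split=> // [l|j l n].
  rewrite leqn0 => /eqP ->; split=> [i j _ _|].
    by rewrite tr_id hcomp1m hcompm1 dvg.
  by rewrite -vg; apply: eq_bigr => j _; rewrite tr00 tr_id hcompm1.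
rewrite ltnS leqn0 => /andP[_ /eqP ->]; rewrite leq0n leqn0 => /eqP ->.
by rewrite ltnSn !tr_id !hcomp1m.
Qed.

Lemma chain_barcodeS m : chain_barcode m -> chain_barcode m.+1.
Proof.
move=> [J [A [b [d [e [e' [As bm eB eT]]]]]]].
have [K [B [w [w' [Bs [dw ww]]]]]] := simp_basis sys (F (x m.+1)).
pose f : Hom (F (x m)) (F (x m.+1)) := tr F (x m) (x m.+1).
pose alive j := (b j <= m < d j)%N.
(* The new index set joins the old bars, pushed forward by [f], to a basis of the new object, whose
   members are candidates for bars born at [m.+1]. *)
pose AB (y : J + K) := match y with inl j => A j | inr k => B k end.
have ABs y : Simp (AB y) by case: y.
pose v y : Hom (AB y) (F (x m.+1)) :=
  match y with inl j => f \oh e j m | inr k => w k end.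
pose be (y : J + K) : nat := match y with inl j => b j | inr k => m.+1 end.
pose ok (y : J + K) : bool := match y with inl j => alive j | inr k => true end.
(* Sorting by birth implements the elder rule: older bars are tested first and the candidates last,
   so that a dependence is charged to its youngest member. *)
pose s := sort (relpre be leq) [seq y <- enum {: J + K} | ok y].
have sE y : (y \in s) = ok y by rewrite mem_sort mem_filter mem_enum andbT.
have us : uniq s by rewrite sort_uniq filter_uniq // enum_uniq.
have ps : pairwise (relpre be leq) s.
  rewrite -sorted_pairwise; last by move=> y1 y2 y3 /=; apply: leq_trans.
  by apply: sort_sorted => y1 y2 /=; exact: leq_total.
have [P [g [Ps dvg vE bP]]] := elimination sys v (b := be) (fun y _ => ABs y) us ps.
have okP y : P y -> ok y by move=> /Ps; rewrite sE.
(* [M] collects the surviving bars and [N] those that die at [m.+1]; the column [j] of [c] expresses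
   the image of [j] in terms of the survivors. *)
pose M j := P (inl j); pose N j := alive j && ~~ P (inl j).
pose c i j : Hom (A j) (A i) := g (inl i) \oh v (inl j).
have MN j : M j -> ~~ N j by rewrite /M /N => ->; rewrite andbF.
have c0 l i j : M i -> N j -> (b j <= l)%N -> ~~ (b i <= l)%N -> c i j = 0.
  move=> Mi /andP[aj _] bj; rewrite -ltnNge => bi.
  apply: (bP (inl j) (inl i)) => //; first by rewrite sE. exact: leq_ltn_trans bj bi.
pose b' := be.
(* A bar alive at [m.+1] gets the provisional death [m.+2]. A rejected candidate is born and dies at
   [m.+1], hence is never alive. *)
pose d' (y : J + K) : nat := match y with
  | inl j => if alive j then (if M j then m.+2 else m.+1) else d j
  | inr k => if P (inr k) then m.+2 else m.+1 end.
(* At all past times a dying bar is corrected by survivors that are not younger, so that its image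
   at [m.+1] becomes exactly zero; the forms [E'] undergo the inverse shear. *)
pose E y l : Hom (AB y) (F (x l)) := match y with
  | inl j => if (l <= m)%N
             then if N j then e j l - \sum_(i | M i) e i l \oh c i j else e j l
             else tr F (x m) (x l) \oh e j m
  | inr k => tr F (x m.+1) (x l) \oh w k end.
pose E' y l : Hom (F (x l)) (AB y) :=
  if (l <= m)%N then match y return Hom (F (x l)) (AB y) with
    | inl i => if M i then e' i l + \sum_(j | N j && (b j <= l < d j)%N) c i j \oh e' j l
               else e' i l
    | inr k => 0 end
  else g y \oh tr F (x l) (x m.+1).
have d'lt j l : (l <= m)%N -> (l < d' (inl j))%N && (b j <= l)%N = (b j <= l < d j)%N.
  move=> lm; rewrite /d' andbC; case: (boolP (alive j)) => // /andP[_ mj].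
  by rewrite (leq_ltn_trans lm mj); case: (M j); rewrite ltnS ?(leqW lm) ?lm ?andbT.
have Em y : E y m.+1 = v y.
  case: y => [j|k] /=; first by rewrite ltnn.
  by rewrite tr_id hcomp1m.
have dead j : ~~ alive j -> (d j <= m)%N.
  by rewrite /alive bm /= -leqNgt.
exists (J + K)%type, AB, b', d', E, E'; split=> //.
- by case=> [j|k] //=; exact: leqW (bm j).
- move=> l; rewrite leq_eqVlt => /predU1P[->|]; last rewrite ltnS => lm.
    have QP y : (b' y <= m.+1 < d' y)%N = P y.
      case: y => [j|k] /=; last by rewrite leqnn; case: (P _); rewrite ?ltnSn ?ltnn.
      rewrite (leqW (bm j)) /=; case: (boolP (alive j)) => [aj|aj].
        by rewrite /M; case: (P _); rewrite ?ltnSn ?ltnn.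
      rewrite ltnNge (leqW (dead _ aj)); apply/esym/negP => /okP /=.
      by rewrite (negbTE aj).
    have E'm y : E' y m.+1 = g y by rewrite /E' ltnn tr_id hcompm1.
    split=> [y z /=|]; first by rewrite !QP => Py Pz; rewrite E'm Em dvg.
    rewrite (eq_bigl _ _ QP); under eq_bigr => y Py do rewrite E'm Em.
    apply: (basis_eq ww) => k _; rewrite hcomp1m hcomp_suml [RHS](vE (inr k)) ?sE //.
    by apply: eq_bigr => y _; rewrite hcompA.
  have [dE sumE] : basis_on [pred j | (b j <= l < d j)%N] (fun j => E (inl j) l)
      (fun j => E' (inl j) l).
    rewrite /E /E' lm; apply: basis_shear (eB l lm) MN _ => i j Mi Nj /andP[bj _].
    move=> nQi; apply: (c0 l) => //; apply: contra nQi => /= ->.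
    by have /okP/andP[_] := Mi; exact: leq_ltn_trans.
  have Q1 j : (b' (inl j) <= l < d' (inl j))%N = (b j <= l < d j)%N.
    by rewrite -d'lt // andbC.
  have Q2 k : (b' (inr k) <= l < d' (inr k))%N = false by rewrite /= ltnNge lm.
  split=> [[i|k] [j|k'] /=|]; rewrite ?Q1 ?Q2 //.
    by move=> Qi Qj; rewrite delta_inl; exact: dE.
  rewrite big_sumType /= [X in _ + X]big_pred0 ?addr0 //.
  by rewrite -[RHS]sumE; apply: eq_bigl => j; rewrite /= Q1.
- move=> y l n /andP[bl ld] /andP[ln nm]; have [lm|ml] := leqP l m; last first.
    have lE : l = m.+1 by apply/eqP; rewrite eqn_leq ml (leq_trans ln nm).
    have nE : n = l by apply/eqP; rewrite eqn_leq ln lE nm.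
    by rewrite nE ld tr_id hcomp1m.
  case: y bl ld => [j|k] bl ld; last by rewrite /= leqNgt ltnS lm in bl.
  have /andP[bj ldj] : (b j <= l < d j)%N by rewrite -d'lt // ld.
  have Malive i : M i -> (m < d i)%N by move=> /okP/andP[].
  have trM_e i p : M i -> N j -> (l <= p <= m)%N ->
      tr F (x l) (x p) \oh (e i l \oh c i j) = e i p \oh c i j.
    move=> Mi Nj /andP[lp pm]; rewrite hcompA.
    have [bi|nbi] := boolP (b i <= l)%N; last by rewrite (c0 l) // !hcompm0.
    by rewrite eT ?lp ?bi ?(leq_ltn_trans pm (Malive _ Mi)) ?(leq_ltn_trans lm (Malive _ Mi)).
  have trE_ p : (l <= p <= m)%N -> alive j ->
      tr F (x l) (x p) \oh E (inl j) l = E (inl j) p.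
    move=> /andP[lp pm] /andP[_ mj]; rewrite /E lm pm.
    have ep : tr F (x l) (x p) \oh e j l = e j p.
      by rewrite eT ?bj ?lp // (leq_ltn_trans pm mj).
    case: (boolP (N j)) => Nj; last exact: ep.
    rewrite hcompBr ep hcomp_sumr; congr (_ - _).
    by apply: eq_bigr => i Mi; rewrite trM_e ?lp.
  have dead_E p : (l <= p <= m)%N -> ~~ alive j ->
      tr F (x l) (x p) \oh E (inl j) l = if (p < d j)%N then E (inl j) p else 0.
    move=> /andP[lp pm] aj; rewrite /E lm pm {1 2}/N (negbTE aj) /=.
    by rewrite eT ?bj ?lp.
  have [aj|aj] := boolP (alive j); last first.
    have -> : d' (inl j) = d j by rewrite /d' (negbTE aj).
    have [pm|mn] := leqP n m; first by rewrite dead_E ?ln.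
    rewrite ltnNge (leq_trans (dead _ aj) (ltnW mn)) /=.
    rewrite -(trM F (x_mono lm) (x_mono (ltnW mn))) -hcompA dead_E ?lm ?leqnn //.
    by rewrite ltnNge dead // hcompm0.
  have [pm|mn] := leqP n m.
    rewrite trE_ ?ln //; case: ifP => // /negP[].
    by rewrite /d' aj; case: (M j); rewrite ltnS // leqW.
  have nE : n = m.+1 by apply/eqP; rewrite eqn_leq nm.
  rewrite nE -(trM F (x_mono lm) (x_mono (leqnSn m))) -hcompA trE_ ?lm ?leqnn //.
  have -> : (m.+1 < d' (inl j))%N = M j.
    by rewrite /d' aj; case: (M j); rewrite ?ltnSn ?ltnn.
  rewrite Em -/f /E leqnn /N aj {2}/M /=; case: (boolP (P (inl j))) => //= Mj.
  rewrite hcompBr hcomp_sumr -[f \oh e j m]/(v (inl j)) [X in X - _](vE (inl j)) ?sE //.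
  rewrite big_sumType /= [X in _ + X - _]big1 ?addr0.
    apply/eqP; rewrite subr_eq0; apply/eqP.
    by apply: eq_bigr => i Mi; rewrite /c -hcompA.
  (* By the birth clause of [elimination], the image of an old bar has no coordinate along a newborn
     pivot. *)
  by move=> k Pk; rewrite (bP (inl j) (inr k)) ?sE ?hcompm0 //= ltnS bm.
Qed.

Lemma chain_barcode_exists m : chain_barcode m.
Proof. by elim: m => [|m]; [exact: chain_barcode0|exact: chain_barcodeS]. Qed.

End Chain.
End Transition.

(* Whether a bar contains its endpoints is left open. *)
Record barcode (R : realType) (C : category) (pC : preadditive C)
    (Simp : C -> Prop) (F : functor (real_line R) C) := Barcode {
  bar :> finType;
  bar_obj : bar -> C;
  bar_alive : bar -> R -> bool;
  bar_in : forall j t, hmor pC (bar_obj j) (F t);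
  bar_out : forall j t, hmor pC (F t) (bar_obj j);
  bar_simple : forall j, Simp (bar_obj j);
  bar_convex : forall j s t u,
    s <= t -> t <= u -> bar_alive j s -> bar_alive j u -> bar_alive j t;
  bar_basis : forall t, basis_on (bar_alive ^~ t) (bar_in ^~ t) (bar_out ^~ t);
  bar_tr : forall j s t, s <= t -> bar_alive j s ->
    tr pC F s t \oh bar_in j s = if bar_alive j t then bar_in j t else 0 }.

(** * From chains of times to the real line *)

Section RealBarcode.
Variables (R : realType) (C : category) (pC : preadditive C) (Simp : C -> Prop).
Hypothesis sys : simple_system pC Simp.
Local Notation Hom := (hmor pC).
Local Notation Id := (hid pC).
Variable F : functor (real_line R) C.
Local Notation tr := (tr pC F).

Section Cells.
Variables (k : R -> nat) (N : nat) (t0 : R).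
Hypothesis k_mono : forall s t, s <= t -> (k s <= k t)%N.
Hypothesis k_bound : forall t, (k t <= N)%N.
Hypothesis k0 : k t0 = 0%N.
Hypothesis k_iso : forall s t, s <= t -> k s = k t -> is_iso (tr s t).

(** One time is chosen in each cell, by recursion on the cell number. A number that no time realizes
    repeats the previous time, which keeps [x] monotone. *)
Lemma cell_points : exists x : nat -> R,
  (forall m n, (m <= n)%N -> x m <= x n) /\ forall t, k (x (k t)) = k t.
Proof.
pose step n y := if pselect (exists t, k t = n.+1) is left h then sval (cid h) else y.
pose x := fix x n := if n is n'.+1 then step n' (x n') else t0.
have kx n : (k (x n) <= n)%N.
  elim: n => [|n IHn] /=; first by rewrite k0.
  rewrite /step; case: pselect => [h|_]; first by case: cid => t /= ->.
  exact: leqW.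
exists x; split.
  apply: (@homo_leq R x (fun y z => y <= z)) => [//|z y w|n] /=; first exact: le_trans.
  rewrite /step; case: pselect => // h; case: cid => t /= kt.
  by rewrite leNgt; apply/negP => /ltW/k_mono; rewrite kt leqNgt ltnS kx.
move=> t; case kt: (k t) => [|n] //=; rewrite /step; case: pselect => [h|[]].
  by case: cid.
by exists t.
Qed.

Lemma cell_barcode : inhabited (barcode pC Simp F).
Proof.
have [x [x_mono xk]] := cell_points.
have [J [A [b [d [e [e' [As bN eB eT]]]]]]] := chain_barcode_exists sys F x_mono N.
(* [F t] is identified with its value at the time chosen in the cell of [t], which may lie on either
   side of [t]. The last clause makes the identification compatible with the maps from all earlier
   times. *)
have tau t : exists z : Hom (F (x (k t))) (F t) * Hom (F t) (F (x (k t))),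
    [/\ z.2 \oh z.1 = Id _, z.1 \oh z.2 = Id _
      & forall u, u <= x (k t) -> u <= t -> z.1 \oh tr u (x (k t)) = tr u t].
  have [xt|tx] := leP (x (k t)) t.
    have [z [z1 z2]] := k_iso xt (xk t).
    by exists (tr (x (k t)) t, z); split=> //= u ux ut; rewrite trM.
  have [z [z1 z2]] := k_iso (ltW tx) (esym (xk t)).
  exists (z, tr t (x (k t))); split=> //= u ux ut.
  by rewrite -(trM pC F ut (ltW tx)) hcompA -[z \oh _]/(z \oc _) z1 [LHS]hcomp1m.
have [z zP] := dep_choice tau.
have zn s t : s <= t -> tr s t \oh (z s).1 = (z t).1 \oh tr (x (k s)) (x (k t)).
  move=> st; have [zs1 zs2 zsu] := zP s; have [zt1 zt2 ztu] := zP t.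
  (* The square is checked after precomposition with the isomorphism from the earlier of [s] and
     [x (k s)], which turns every map involved into a transition map. *)
  pose u := Order.min s (x (k s)).
  have us : u <= s by rewrite ge_min lexx.
  have ux : u <= x (k s) by rewrite ge_min lexx orbT.
  have ku : k u = k (x (k s)).
    by rewrite /u minEle; case: ifP => _; rewrite ?xk.
  have [w [_ w2]] := k_iso ux ku.
  have xx : x (k s) <= x (k t) by apply/x_mono/k_mono.
  rewrite -[LHS]hcompm1 -[RHS]hcompm1 -[Id _]/(idm _) -w2 -[_ \oc w]/(_ \oh (w : Hom _ _)) !hcompA.
  congr (_ \oh _); rewrite -!hcompA zsu // !trM // ztu //; first exact: le_trans xx.
  exact: le_trans st.
pose alive j t := (b j <= k t < d j)%N.
constructor; apply: (@Barcode R C pC Simp F J A alive (fun j t => (z t).1 \oh e j (k t))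
  (fun j t => e' j (k t) \oh (z t).2) As) => [j s t u st tu|t|j s t st aj].
- move=> /andP[bs _] /andP[_ ud]; rewrite /alive (leq_trans bs (k_mono st)).
  exact: leq_ltn_trans (k_mono tu) ud.
- have [de see] := eB _ (k_bound t); have [z1 z2 _] := zP t; split=> [i j ai aj|].
    by rewrite -hcompA [(z t).2 \oh _]hcompA z1 hcomp1m de.
  under eq_bigr do rewrite hcompA -[_ \oh e _ _ \oh _]hcompA.
  by rewrite -hcomp_suml -hcomp_sumr see hcompm1.
- rewrite hcompA zn // -hcompA eT //; last by rewrite k_mono ?k_bound.
  rewrite /alive (leq_trans _ (k_mono st)) /=; last by case/andP: aj.
  by case: ifP => // _; rewrite hcompm0.
Qed.

End Cells.

Definition iso_off (xs : seq R) : Prop :=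
  forall s t, s <= t -> (forall c, c \in xs -> ~~ (s <= c <= t)) -> is_iso (tr s t).

Lemma barcode_exists (xs : seq R) : iso_off xs -> inhabited (barcode pC Simp F).
Proof.
move=> isoF.
(* [k t] is the index of the cell of [t]: odd for the points of [xs], even for
   the open intervals between them. *)
pose k (t : R) := ((count (fun c => (c < t)%R) xs).*2 + (t \in xs))%N.
have cnt (s t : R) : s <= t -> (count (fun c => (c < s)%R) xs <= count (fun c => (c < t)%R) xs)%N.
  by move=> st; apply: sub_count => c /= cs; exact: lt_le_trans cs st.
have cntS (s t : R) : s < t -> has (fun c => (s <= c < t)%R) xs ->
    (count (fun c => (c < s)%R) xs < count (fun c => (c < t)%R) xs)%N.
  move=> st; rewrite has_count.
  have -> : count (fun c => (c < t)%R) xs =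
      (count (fun c => (c < s)%R) xs + count (fun c => (s <= c < t)%R) xs)%N.
    rewrite -count_predUI (@eq_count _ (predI _ _) pred0) ?count_pred0 ?addn0.
      apply: eq_count => c /=; case: (ltP c s) => //= cs.
      by rewrite (lt_trans cs st).
    by move=> c /=; case: ltP.
  by move=> h; rewrite -[ltnLHS]addn0 ltn_add2l.
have [t0 t0P] : exists t0, forall c, c \in xs -> t0 < c.
  elim: xs {isoF k cnt cntS} => [|c xs [t0 t0P]]; first by exists 0.
  exists (Order.min t0 (c - 1)) => c'; rewrite in_cons => /predU1P[->|/t0P t0c].
    by rewrite gt_min ltrBlDr ltrDl ltr01 orbT.
  by rewrite gt_min t0c.
apply: (@cell_barcode k (size xs).*2.+1 t0) => [s t st|t||s t st kst].
- rewrite /k; have [<-//|snt] := eqVneq s t.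
  have {}st : s < t by rewrite lt_neqAle snt.
  have [sx|sx] := boolP (s \in xs); last first.
    by rewrite addn0 (leq_trans _ (leq_addr _ _)) // leq_double cnt // ltW.
  have : (count (fun c => (c < s)%R) xs < count (fun c => (c < t)%R) xs)%N.
    by apply: cntS => //; apply/hasP; exists s => //; rewrite lexx.
  rewrite -leq_double doubleS => /leq_trans; rewrite addn1 => h.
  by apply: leq_trans (leq_addr _ _); apply: leq_trans (leqnSn _) _; exact: h.
- rewrite /k -addn1 leq_add ?leq_double ?count_size //; exact: leq_b1.
- rewrite /k (_ : t0 \in xs = false) ?addn0.
    apply/eqP; rewrite double_eq0 -leqn0 leqNgt -has_count.
    by apply/hasPn => c /t0P /ltW; rewrite leNgt.
  by apply/negP => /t0P; rewrite ltxx.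
- have [sE|snt] := eqVneq s t.
    by rewrite -{}sE tr_id; exists (Id _); split; exact: hcomp1m.
  have {}st : s < t by rewrite lt_neqAle snt.
  have nst : ~~ has (fun c => s <= c < t) xs.
    apply/negP => /(cntS _ _ st); rewrite -leq_double doubleS => cst.
    have : (k s < k t)%N; last by rewrite kst ltnn.
    apply: leq_trans (leq_addr _ _); apply: leq_trans cst.
    by rewrite ltnS -addn1 leq_add2l leq_b1.
  apply: isoF (ltW st) _ => c cx; apply/negP => /andP[sc ct].
  (* A point of [xs] in [[s, t]] has to be [t] itself; then the common cell number is odd, so [s]
     belongs to [xs] as well, a contradiction. *)
  have cE : c = t.
    apply/eqP; rewrite eq_le ct leNgt; apply: contra nst => ct'.
    by apply/hasP; exists c => //; rewrite sc.
  have : odd (k s) by rewrite kst /k -cE cx oddD odd_double.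
  rewrite /k oddD odd_double /=; case: (boolP (s \in xs)) => // sx _.
  by case/negP: nst; apply/hasP; exists s => //; rewrite lexx.
Qed.

Lemma pers_rk (u v : R) : u <= v ->
  pers (@length C) F u v = (rk Simp predT (tr u v))%:Z.
Proof.
move=> uv; apply: xget_unique => [|n [h [Z [FZ ->]]]].
  exists uv; have [Z FZ] := image_exists sys (tr u v).
  exists Z; split; first by rewrite -(trE pC F uv).
  by rewrite (is_image_dim sys FZ).
by rewrite -(is_image_dim sys (f := tr u v) (Z := Z)) // (trE pC F h).
Qed.

Lemma constant_iso (I : set R) s t : constant_on (@length C) F I ->
  I s -> I t -> s <= t -> is_iso (tr s t).
Proof.
move=> Ic Is It st; have [] := Ic s t Is It st; rewrite !pers_rk // !tr_id => -[sst] [stt].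
by apply: (rk_full_iso sys); rewrite /hdim.
Qed.

Lemma is_iso_tr (s t u : R) : s <= t -> t <= u ->
  is_iso (tr s t) -> is_iso (tr t u) -> is_iso (tr s u).
Proof. by move=> st tu; rewrite -(trM pC F st tu) => ? ?; exact: is_iso_comp. Qed.

(** A supremum argument: near a regular value all transition maps are isomorphisms, so the set [A]
    of times reached from [s] by an isomorphism extends past its supremum, unless that is [t]. *)
Lemma regular_iso (s t : R) : s <= t ->
  (forall y, s <= y <= t -> regular_value (@length C) F y) -> is_iso (tr s t).
Proof.
move=> st reg.
have loc y : s <= y <= t -> exists2 e : R, 0 < e &
    forall a b, `|a - y| < e -> `|b - y| < e -> a <= b -> is_iso (tr a b).
  move=> /reg[I [/nbhs_ballP[e /= e0 yI] _ Ic]]; exists e => // a b ay by_ ab.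
  by apply: (constant_iso Ic) => //; apply: yI; rewrite /ball /= distrC.
pose A := [set y | s <= y <= t /\ is_iso (tr s y)].
have As : A s.
  by split; [rewrite lexx|rewrite tr_id; exists (Id _); split; exact: hcomp1m].
have supA : has_sup A by split; [exists s|exists t => y [/andP[]]].
pose z := sup A.
have sz : s <= z by apply: ub_le_sup => //; case: supA.
have zt : z <= t by apply: ge_sup; [exists s|move=> y [/andP[]]].
have [e e0 eP] := loc z (introT andP (conj sz zt)).
have [y Ay zy] := sup_adherent e0 supA.
have yz : y <= z by apply: ub_le_sup => //; case: supA.
have [/andP[sy _] iy] := Ay.
have near_y : `|y - z| < e by rewrite distrC ger0_norm ?subr_ge0 // ltrBlDl -ltrBlDr.
pose w := Order.min t (z + e / 2).
have zw : z <= w by rewrite le_min zt lerDl divr_ge0 // ltW.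
have near_w : `|w - z| < e.
  rewrite ger0_norm ?subr_ge0 // ltrBlDl gt_min; apply/orP; right.
  by rewrite ltrD2l gtr_pMr // invf_lt1 // ltr1n.
have iw : is_iso (tr s w).
  by apply: is_iso_tr iy _ => //; [exact: le_trans zw|apply: eP => //; exact: le_trans zw].
have Aw : A w by split=> //; rewrite (le_trans sz zw) ge_min lexx.
have : w <= z by apply: ub_le_sup => //; case: supA.
rewrite ge_min => /orP[tz|]; last first.
  by rewrite gerDl leNgt divr_gt0.
have <- : w = t; last exact: iw.
by apply/eqP; rewrite eq_le ge_min lexx /= (le_trans tz zw).
Qed.

Lemma tame_iso_off : tame (@length C) F -> exists xs, iso_off xs.
Proof.
move=> /finite_seqP[xs xsE]; exists xs => s t st nxs; apply: regular_iso => // y syt.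
apply: contrapT => ny; have : [set` xs] y by rewrite -xsE.
by move=> /nxs; rewrite syt.
Qed.

End RealBarcode.

(** * Multiplicities *)

Section Ereal.
Variable R : realType.
Local Open Scope ereal_scope.
Implicit Types (x y u v z : \bar R) (E : seq (\bar R)).

(** As there are finitely many endpoints, a single real time can witness all strict inequalities
    between [z] and the endpoints above it, also for [z = -oo]. *)
Lemma gap_right z E : z < +oo ->
  exists t : R, z < t%:E /\ forall e, e \in E -> z < e -> t%:E < e.
Proof.
move=> zoo; elim: E => [|e E [t [zt tE]]].
  case: z zoo => [r _|//|_]; last by exists 0%R; rewrite ltNyr.
  by exists (r + 1)%R; rewrite lte_fin ltrDl ltr01.
have [ez|ze] := leP e z.
  exists t; split=> // e'; rewrite in_cons => /predU1P[->|]; last exact: tE.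
  by rewrite ltNge ez.
have [s [zs se]] : exists s : R, z < s%:E /\ s%:E < e.
  case: z zoo ze {zt tE} => [r _|//|_].
    case: e => [q rq|_|//]; last by exists (r + 1)%R; rewrite ltry lte_fin ltrDl ltr01.
    have [p1 p2] := midf_lt rq.
    by exists ((r + q) / 2)%R; rewrite !lte_fin p1 p2.
  case: e => [q _|_|//]; last by exists 0%R; rewrite ltNyr ltry.
  by exists (q - 1)%R; rewrite ltNyr lte_fin gtrDl ltrN10.
exists (Order.min s t); split=> [|e']; first by rewrite EFin_min lt_min zs zt.
rewrite in_cons EFin_min gt_min => /predU1P[-> _|e'E ze']; first by rewrite se.
by rewrite tE // orbT.
Qed.

Lemma gap_left z E : -oo < z ->
  exists t : R, t%:E < z /\ forall e, e \in E -> e < z -> e < t%:E.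
Proof.
move=> zoo; have [|t [zt tE]] := @gap_right (- z) [seq - e | e <- E].
  by rewrite lteNl.
exists (- t)%R; split=> [|e eE ez]; first by rewrite EFinN lteNl.
by rewrite EFinN lteNr tE ?map_f // lteN2.
Qed.

Lemma ereal_dense x y : x < y -> exists t : R, x < t%:E < y.
Proof.
move=> xy; have [|t [xt ty]] := @gap_right x [:: y].
  exact: lt_le_trans xy (leey _).
by exists t; rewrite xt ty ?mem_head.
Qed.

(** The closure takes in the endpoints, infinite ones included, and inherits connectedness from the
    real interval. *)
Definition oitv x y : set (\bar R) := closure (EFin @` [set t | x < t%:E < y]).

Lemma oitv_connected x y : connected (oitv x y).
Proof.
apply: connected_closure; apply: connected_continuous_connected.
  apply/connected_intervalP => s t /= /andP[xs _] /andP[_ ty] r /andP[sr rt].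
  by rewrite (lt_le_trans xs) ?lee_fin //= (le_lt_trans _ ty) ?lee_fin.
by apply: continuous_subspaceT => t; exact: cvg_id.
Qed.

Lemma oitv_le x y z : oitv x y z -> x <= z <= y.
Proof.
have H : EFin @` [set t | x < t%:E < y] `<=` [set z | x <= z] `&` [set z | z <= y].
  by move=> _ [t /andP[xt ty] <-]; split; exact: ltW.
move=> /(closureS H).
rewrite -(_ : [set z | x <= z] `&` [set z | z <= y] = closure _); last first.
  apply/closure_id; apply: closedI; [exact: closed_ereal_le_ereal|exact: closed_ereal_ge_ereal].
by move=> [/= -> ->].
Qed.

Lemma ereal_sup_oitv x y : x < y -> ereal_sup (oitv x y) = y.
Proof.
move=> xy; apply/eqP; rewrite eq_le; apply/andP; split.
  by apply: ge_ereal_sup => z /oitv_le/andP[].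
rewrite leNgt; apply/negP => sy.
have [t /andP[st ty]] : exists t : R, maxe x (ereal_sup (oitv x y)) < t%:E < y.
  by apply: ereal_dense; rewrite gt_max xy.
move: st; rewrite gt_max => /andP[xt]; apply/negP; rewrite -leNgt.
by apply/ereal_sup_ubound/subset_closure; exists t => //=; rewrite xt.
Qed.

Lemma ereal_inf_oitv x y : x < y -> ereal_inf (oitv x y) = x.
Proof.
move=> xy; apply/eqP; rewrite eq_le; apply/andP; split; last first.
  by apply: le_ereal_inf_tmp => z /oitv_le/andP[].
rewrite leNgt; apply/negP => sy.
have [t /andP[st ty]] : exists t : R, x < t%:E < mine y (ereal_inf (oitv x y)).
  by apply: ereal_dense; rewrite lt_min xy.
move: ty; rewrite lt_min => /andP[yt]; apply/negP; rewrite -leNgt.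
by apply/ereal_inf_lbound/subset_closure; exists t => //=; rewrite st.
Qed.

Lemma nbhs_oitv x y u : x < y ->
  (x < u \/ u = -oo /\ x = -oo) -> (u < y \/ u = +oo /\ y = +oo) ->
  nbhs u (oitv x y).
Proof.
move=> xy; case: u => [r| |].
- move=> [xr|[//]] [ry|[//]].
  have : \forall t \near r, x < t%:E < y.
    near=> t; apply/andP; split; near: t; [exact: (open_ereal_gt' xr)|exact: (open_ereal_lt' ry)].
  by apply: filterS => t xty; apply: subset_closure; exists t.
- move=> xoo [|[_ yoo]]; first by rewrite ltNge leey.
  rewrite {}yoo in xy *.
  have [t /andP[xt _]] := ereal_dense xy.
  exists t; split; first exact: num_real.
  move=> [r| |] //= tr; first
    by apply: subset_closure; exists r => //=; rewrite (lt_trans xt tr) ltry.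
  move=> B [M [_ MB]]; exists (Order.max t M + 1)%:E; split.
    exists (Order.max t M + 1)%R => //=; rewrite ltry andbT (lt_trans xt) // lte_fin.
    by rewrite ltr_pwDr // le_max lexx.
  by apply: MB; rewrite lte_fin ltr_pwDr // le_max lexx orbT.
- move=> [xoo|[_ xoo]] yoo; first by rewrite ltNge leNye in xoo.
  rewrite {}xoo in xy *.
  have [t /andP[_ ty]] := ereal_dense xy.
  exists t; split; first exact: num_real.
  move=> [r| |] //= tr; first
    by apply: subset_closure; exists r => //=; rewrite (lt_trans tr ty) ltNyr.
  move=> B [M [_ MB]]; exists (Order.min t M - 1)%:E; split.
    exists (Order.min t M - 1)%R => //=; rewrite ltNyr /= (lt_trans _ ty) // lte_fin.
    by rewrite ltrBlDr ltr_pwDr // ge_min lexx.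
  by apply: MB; rewrite lte_fin ltrBlDr ltr_pwDr // ge_min lexx orbT.
Unshelve. all: by end_near. Qed.

Lemma connected_ereal (I : set (\bar R)) x y z :
  connected I -> I x -> I z -> x < y -> y < z -> I y.
Proof.
move=> Ic Ix Iz xy yz; apply: contrapT => Iy.
have : I `&` [set e | e < y] = I.
  apply: Ic.
  - by exists x.
  - by exists [set e | e < y] => //; exact: open_ereal_lt_ereal.
  - exists [set e | e <= y]; first exact: closed_ereal_ge_ereal.
    apply/seteqP; split=> e [Ie /=]; first by move=> /ltW; split.
    by rewrite le_eqVlt => /predU1P[ey|]; [rewrite -ey in Iy|split].
move=> /seteqP[_ /(_ z Iz)[_ /=]].
by rewrite ltNge (ltW yz).
Qed.

(** Connected sets of extended reals are convex, so a point of [I] above a point of [I'] would force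
    a common point. *)
Lemma connected_sup_inf (I I' : set (\bar R)) u v :
  connected I -> connected I' -> I u -> I' v -> u < v -> I `&` I' = set0 ->
  ereal_sup I <= ereal_inf I'.
Proof.
move=> Ic I'c Iu I'v uv II'; apply: ge_ereal_sup => x Ix.
apply: le_ereal_inf_tmp => y I'y; rewrite leNgt; apply/negP => yx.
have no z : I z -> I' z -> False by move=> Iz I'z; have : set0 z by rewrite -II'.
have [vx|xv] := ltP v x; first exact: no v (connected_ereal Ic Iu Ix uv vx) I'v.
have [uy|yu] := ltP u y.
  have [yE|] := eqVneq y x; first by rewrite yE ltxx in yx.
  by move=> _; exact: no y (connected_ereal Ic Iu Ix uy yx) I'y.
have [uyE|uyn] := eqVneq u y; first by apply: (no u) => //; rewrite uyE.
apply: (no u) => //; apply: connected_ereal I'c I'y I'v _ uv.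
by rewrite lt_neqAle eq_sym uyn.
Qed.

Lemma nbhs_sup_gt (I : set (\bar R)) u : nbhs u I -> u < +oo -> u < ereal_sup I.
Proof.
case: u => [r|_|]; [|by rewrite ltxx|]; last first.
  move=> [M [_ MI]] _; have IM : I (M - 1)%:E by apply: MI; rewrite lte_fin gtrDl ltrN10.
  exact: lt_le_trans (ltNyr _) (ereal_sup_ubound IM).
move=> nI _; have /nbhs_ballP[e /= e0 eI] : nbhs r (fun t => I t%:E) := nI.
have Ie : I (r + e / 2)%:E.
  apply: eI; rewrite /ball /= opprD addrA subrr sub0r normrN gtr0_norm ?divr_gt0 //.
  by rewrite gtr_pMr // invf_lt1 // ltr1n.
by apply: lt_le_trans (ereal_sup_ubound Ie); rewrite lte_fin ltrDl divr_gt0.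
Qed.

Lemma nbhs_inf_lt (I : set (\bar R)) u : nbhs u I -> -oo < u -> ereal_inf I < u.
Proof.
case: u => [r||_]; [| |by rewrite ltxx]; last first.
  move=> [M [_ MI]] _; have IM : I (M + 1)%:E by apply: MI; rewrite lte_fin ltrDl ltr01.
  exact: le_lt_trans (ereal_inf_lbound IM) (ltry _).
move=> nI _; have /nbhs_ballP[e /= e0 eI] : nbhs r (fun t => I t%:E) := nI.
have Ie : I (r - e / 2)%:E.
  apply: eI; rewrite /ball /= opprB addrC subrK gtr0_norm ?divr_gt0 //.
  by rewrite gtr_pMr // invf_lt1 // ltr1n.
by apply: le_lt_trans (ereal_inf_lbound Ie) _; rewrite lte_fin gtrDl oppr_lt0 divr_gt0.
Qed.

End Ereal.

Lemma minimumE (A : set int) n : A n -> (forall m, A m -> n <= m) -> minimum A = n.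
Proof.
move=> An nA; apply: xget_unique => [|m [Am mA]]; first by split.
by apply/eqP; rewrite eq_le mA //= nA.
Qed.

(** * Multiplicities as numbers of bars *)

Section Endpoints.
Variables (R : realType) (J : finType) (alive : J -> R -> bool).
Hypothesis alive_convex : forall j s t u,
  s <= t -> t <= u -> alive j s -> alive j u -> alive j t.

(** A bar that is never alive gets [bar_lo = +oo] and [bar_hi = -oo], so the condition [lo < hi]
    leaves it out, together with the bars reduced to a point. *)
Definition bar_lo j : \bar R := ereal_inf (EFin @` [set t | alive j t]).
Definition bar_hi j : \bar R := ereal_sup (EFin @` [set t | alive j t]).
Local Notation lo := bar_lo.
Local Notation hi := bar_hi.

Lemma bar_lo_le j t : alive j t -> (lo j <= t%:E)%E.
Proof. by move=> jt; apply: ereal_inf_lbound; exists t. Qed.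

Lemma bar_hi_ge j t : alive j t -> (t%:E <= hi j)%E.
Proof. by move=> jt; apply: ereal_sup_ubound; exists t. Qed.

Lemma bar_between j t : (lo j < t%:E)%E -> (t%:E < hi j)%E -> alive j t.
Proof.
move=> /ereal_inf_lt[_ [s js <-]]; rewrite lte_fin => st.
move=> /ereal_sup_gt[_ [u ju <-]]; rewrite lte_fin => tu.
exact: alive_convex (ltW st) (ltW tu) js ju.
Qed.

(** Meant for times [s] and [t] in gaps between endpoints: there [p] and [q] are conditions on the
    endpoints alone, whether or not the bar contains them. *)
Lemma alive_pair j (s t : R) (p q : bool) : s <= t ->
  (alive j s -> p) -> (p -> (lo j < s%:E)%E) ->
  (alive j t -> q) -> (q -> (t%:E < hi j)%E) ->
  alive j s && alive j t = p && q.
Proof.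
move=> st sp ps tq qt; apply/andP/andP => [[/sp ? /tq ?]|[/ps los /qt thi]] //.
split; apply: bar_between => //; first by apply: le_lt_trans thi; rewrite lee_fin.
by apply: lt_le_trans los _; rewrite lee_fin.
Qed.

Variable P : pred J.
Definition bar_count (b : J -> bool) : int := \sum_(j | P j) (b j)%:Z.

Lemma bar_countE b : bar_count b = (#|[pred j | P j & b j]|)%:Z.
Proof.
rewrite /bar_count -sum1_card [RHS](big_morph Posz PoszD (erefl _)).
by rewrite [RHS]big_mkcondr; apply: eq_bigr => j _ /=; case: (b j).
Qed.

Variables (C : category) (r : C -> int) (F : functor (real_line R) C).
Hypothesis persE : forall u v, u <= v ->
  pers r F u v = bar_count (fun j => alive j u && alive j v).

Definition whole j := (lo j == -oo%E) && (hi j == +oo%E).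
Let ends : seq (\bar R) := [seq lo j | j <- enum J] ++ [seq hi j | j <- enum J].

Let lo_ends j : lo j \in ends.
Proof. by rewrite mem_cat map_f // mem_enum. Qed.
Let hi_ends j : hi j \in ends.
Proof. by rewrite mem_cat map_f ?orbT // mem_enum. Qed.

Lemma whole_alive j t : whole j -> alive j t.
Proof. by move=> /andP[/eqP l /eqP h]; apply: bar_between; rewrite ?l ?h ?ltNyr ?ltry. Qed.

Lemma bar_count_le (b b' : J -> bool) : (forall j, b j -> b' j) -> bar_count b <= bar_count b'.
Proof.
move=> bb; apply: ler_sum => j _; have := bb j.
by case: (b j) => [->|] //; case: (b' j).
Qed.

(** The minimum is attained between a time before all finite endpoints and a time after them: only
    the bars unbounded on both sides are alive at both. *)
Lemma min_persE : min_pers r F = bar_count whole.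
Proof.
apply: minimumE => [|_ [x [y [xy ->]]]]; last first.
  by rewrite persE //; apply: bar_count_le => j jw; rewrite !whole_alive.
have [//|x [_ xE]] := @gap_right R -oo%E ends.
have [//|y [_ yE]] := @gap_left R +oo%E (x%:E :: ends).
have xy : x <= y by rewrite -lee_fin ltW // yE ?mem_head ?ltry.
exists x, y; split=> //; rewrite persE //; apply: eq_bigr => j _; congr (nat_of_bool _)%:Z.
rewrite (alive_pair (p := lo j == -oo%E) (q := hi j == +oo%E)) //.
- move=> /bar_lo_le; apply: contraTT => lj; rewrite -ltNge xE //.
  by rewrite lt_neqAle eq_sym lj leNye.
- by move=> /eqP ->; rewrite ltNyr.
- move=> /bar_hi_ge; apply: contraTT => hj; rewrite -ltNge yE ?in_cons ?hi_ends ?orbT //.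
  by rewrite lt_neqAle hj leey.
- by move=> /eqP ->; rewrite ltry.
Qed.

(** The inequality holds bar by bar: by convexity each bar contributes a nonnegative term to the
    alternating sum, and a bar with endpoints [u] and [v] contributes one. *)
Lemma box_count_ge u v Iu Iv : (u < v)%E -> ~~ ((u == -oo%E) && (v == +oo%E)) ->
  nbhs u Iu -> connected Iu -> nbhs v Iv -> connected Iv -> Iu `&` Iv = set0 ->
  bar_count (fun j => (lo j == u) && (hi j == v)) <= box_count r F Iu Iv.
Proof.
move=> uv uvoo nu cu nv cv Iuv.
have ua := nbhs_sup_gt nu (lt_le_trans uv (leey _)).
have bv := nbhs_inf_lt nv (le_lt_trans (leNye _) uv).
have ab := connected_sup_inf cu cv (nbhs_singleton nu) (nbhs_singleton nv) uv Iuv.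
have xu := nbhs_inf_lt nu; have vy := nbhs_sup_gt nv.
have xu' : (ereal_inf Iu <= u)%E by apply: ereal_inf_lbound; exact: nbhs_singleton.
have vy' : (v <= ereal_sup Iv)%E by apply: ereal_sup_ubound; exact: nbhs_singleton.
rewrite /box_count; move: ua bv ab xu vy xu' vy'.
move: (ereal_sup Iu) (ereal_inf Iv) (ereal_inf Iu) (ereal_sup Iv) => a b x y.
move=> ua bv ab xu vy xu' vy'.
have /fineK aE : a \is a fin_num.
  by rewrite fin_numElt (le_lt_trans (leNye u) ua) (le_lt_trans ab (lt_le_trans bv (leey v))).
have /fineK bE : b \is a fin_num.
  by rewrite fin_numElt (lt_le_trans (le_lt_trans (leNye u) ua) ab) (lt_le_trans bv (leey v)).
move: (fine a) (fine b) aE bE => a' b' aE bE.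
rewrite -{}aE -{}bE lee_fin in ua bv ab *.
have Ta j : ((lo j == u) && (hi j == v)) ==> alive j a'.
  apply/implyP => /andP[/eqP lj /eqP hj]; apply: bar_between; rewrite ?lj ?hj //.
  by apply: le_lt_trans bv; rewrite lee_fin.
have Tb j : ((lo j == u) && (hi j == v)) ==> alive j b'.
  apply/implyP => /andP[/eqP lj /eqP hj]; apply: bar_between; rewrite ?lj ?hj //.
  by apply: lt_le_trans ua _; rewrite lee_fin.
have Tw j : ((lo j == u) && (hi j == v)) ==> ~~ whole j.
  by apply/implyP => /andP[/eqP lj /eqP hj]; rewrite /whole lj hj.
have wa j : whole j ==> alive j a' by apply/implyP => ?; exact: whole_alive.
have wb j : whole j ==> alive j b' by apply/implyP => ?; exact: whole_alive.
have xlt x' : x = x'%:E -> (x'%:E < u)%E.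
  by move=> xE; rewrite -xE xu // (lt_le_trans (ltNyr x')) // -xE.
have ylt y' : y = y'%:E -> (v < y'%:E)%E.
  by move=> yE; rewrite -yE vy // (le_lt_trans _ (ltry y')) // -yE.
have Tx j x' : x = x'%:E -> ((lo j == u) && (hi j == v)) ==> ~~ alive j x'.
  move=> /xlt xu2; apply/implyP => /andP[/eqP lj _]; apply/negP => /bar_lo_le.
  by rewrite lj leNgt xu2.
have Ty j y' : y = y'%:E -> ((lo j == u) && (hi j == v)) ==> ~~ alive j y'.
  move=> /ylt yv; apply/implyP => /andP[_ /eqP hj]; apply/negP => /bar_hi_ge.
  by rewrite hj leNgt yv.
have xa j x' : x = x'%:E -> (alive j x' && alive j b') ==> alive j a'.
  move=> /xlt xu2; apply/implyP => /andP[]; apply: alive_convex => //.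
  by rewrite -lee_fin ltW //; exact: lt_trans ua.
have yb j y' : y = y'%:E -> (alive j a' && alive j y') ==> alive j b'.
  move=> /ylt yv; apply/implyP => /andP[]; apply: alive_convex => //.
  by rewrite -lee_fin ltW //; exact: lt_trans yv.
have xb x' : x = x'%:E -> x' <= b'.
  move=> /xlt xu2; rewrite -lee_fin ltW // (lt_le_trans (lt_trans xu2 ua)) //.
have ay y' : y = y'%:E -> a' <= y'.
  move=> /ylt yv; rewrite -lee_fin ltW // (le_lt_trans _ (lt_trans bv yv)) //.
have xy x' y' : x = x'%:E -> y = y'%:E -> x' <= y'.
  by move=> xE yE; rewrite (le_trans (xb _ xE)) // -lee_fin ltW // (lt_trans bv) // ylt.
have xoo : x != +oo%E.
  by apply: contraTneq xu' => ->; rewrite -ltNge (lt_le_trans uv) ?leey.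
have yoo : y != -oo%E.
  by apply: contraTneq vy' => ->; rewrite -ltNge (le_lt_trans _ uv) ?leNye.
(* Four cases, as [x] and [y] may be finite or not; with an infinite argument, [epers] counts the
   whole bars. *)
case: x xoo {xu xu' xlt} Tx xa xb xy => [x'|//|] _ Tx xa xb xy;
  case: y yoo {vy vy' ylt} Ty yb ay xy => [y'||//] _ Ty yb ay xy;
  rewrite /= ?persE ?min_persE ?(xb x') ?(ay y') ?(xy x' y') //;
  rewrite /bar_count -?sumrB -?big_split /= -?sumrB -?big_split /=; apply: ler_sum => j _.
- move: (Ta j) (Tb j) (Tx j _ erefl) (Ty j _ erefl) (xa j _ erefl) (yb j _ erefl).
  by case: (_ && (hi j == v)); case: (alive j a'); case: (alive j b');
    case: (alive j x'); case: (alive j y').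
- move: (Ta j) (Tb j) (Tx j _ erefl) (xa j _ erefl).
  by case: (_ && (hi j == v)); case: (alive j a'); case: (alive j b');
    case: (alive j x'); case: (whole j).
- move: (Ta j) (Tb j) (Ty j _ erefl) (yb j _ erefl).
  by case: (_ && (hi j == v)); case: (alive j a'); case: (alive j b');
    case: (alive j y'); case: (whole j).
- move: (Ta j) (Tb j) (Tw j) (wa j) (wb j).
  by case: (_ && (hi j == v)); case: (alive j a'); case: (alive j b'); case: (whole j).
Qed.

(** The neighborhoods are so small that they contain no endpoints of bars besides [u] and [v]; the
    alternating sum then sees only the bars with these endpoints. *)
Lemma box_count_eq u v : (u < v)%E -> ~~ ((u == -oo%E) && (v == +oo%E)) ->
  exists Iu Iv, [/\ nbhs u Iu, connected Iu, nbhs v Iv, connected Iv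
    & Iu `&` Iv = set0 /\
      bar_count (fun j => (lo j == u) && (hi j == v)) = box_count r F Iu Iv].
Proof.
move=> uv uvoo.
have [|a [ua aE]] := @gap_right R u (v :: ends); first exact: lt_le_trans uv (leey _).
have [|b [bv bE]] := @gap_left R v (a%:E :: ends); first exact: le_lt_trans (leNye _) uv.
have ab : a < b by rewrite -lte_fin bE ?mem_head // aE ?mem_head.
have ab' : (a%:E < b%:E)%E by rewrite lte_fin.
have [x [xu xu' xE]] : exists x : \bar R, [/\ (x <= u)%E,
    (x < u)%E \/ u = -oo%E /\ x = -oo%E &
    x = -oo%E /\ u = -oo%E \/
      exists2 x' : R, x = x'%:E & forall e, e \in ends -> (e < u)%E -> (e < x)%E].
  (* Nothing lies to the left of [-oo], so [x] is infinite too; the two terms that contain it are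
     then both [min_pers] and cancel. *)
  have [->|uoo] := eqVneq u -oo%E; first by exists -oo%E; split=> //; [right|left].
  have [|x [xu xE]] := @gap_left R u ends; first by rewrite lt_neqAle eq_sym uoo leNye.
  by exists x%:E; split; [exact: ltW|left|right; exists x].
have [y [vy vy' yE]] : exists y : \bar R, [/\ (v <= y)%E,
    (v < y)%E \/ v = +oo%E /\ y = +oo%E &
    y = +oo%E /\ v = +oo%E \/
      exists2 y' : R, y = y'%:E & forall e, e \in ends -> (v < e)%E -> (y < e)%E].
  have [->|voo] := eqVneq v +oo%E; first by exists +oo%E; split=> //; [right|left].
  have [|y [yv yE]] := @gap_right R v ends; first by rewrite lt_neqAle voo leey.
  by exists y%:E; split; [exact: ltW|left|right; exists y].
have xa : (x < a%:E)%E by exact: le_lt_trans ua.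
have yb : (b%:E < y)%E by exact: lt_le_trans vy.
exists (oitv x a%:E), (oitv b%:E y); split; do ?exact: oitv_connected.
- by apply: nbhs_oitv => //; left.
- by apply: nbhs_oitv => //; left.
split.
  apply/seteqP; split=> // z [/oitv_le/andP[_ za] /oitv_le/andP[bz _]].
  by have := lt_le_trans ab' (le_trans bz za); rewrite ltxx.
rewrite /box_count !ereal_sup_oitv // !ereal_inf_oitv //.
have loj j : (lo j == u) = (lo j <= u)%E && ~~ (lo j < u)%E by rewrite -leNgt -eq_le.
have hij j : (hi j == v) = (v <= hi j)%E && ~~ (v < hi j)%E.
  by rewrite -leNgt andbC -eq_le.
have aP j : alive j a -> (lo j <= u)%E.
  move=> /bar_lo_le; apply: contraTT; rewrite -!ltNge => ul.
  by rewrite aE ?in_cons ?lo_ends ?orbT.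
have bP j : alive j b -> (v <= hi j)%E.
  move=> /bar_hi_ge; apply: contraTT; rewrite -!ltNge => hv.
  by rewrite bE ?in_cons ?hi_ends ?orbT.
have Pa j : (lo j <= u)%E -> (lo j < a%:E)%E by move=> /le_lt_trans; exact.
have Pb j : (v <= hi j)%E -> (b%:E < hi j)%E by exact: lt_le_trans.
have AB j : alive j a && alive j b = (lo j <= u)%E && (v <= hi j)%E.
  apply: alive_pair; [exact: ltW|exact: aP|exact: Pa|exact: bP|exact: Pb].
have xP j x' : x = x'%:E -> alive j x' -> (lo j < u)%E.
  move=> x'E /bar_lo_le/le_lt_trans; apply; rewrite -x'E; case: xu' => // -[uE xoo].
  by rewrite xoo in x'E.
have yP j y' : y = y'%:E -> alive j y' -> (v < hi j)%E.
  move=> y'E /bar_hi_ge; apply: lt_le_trans; rewrite -y'E; case: vy' => // -[uE yoo].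
  by rewrite yoo in y'E.
have Px j x' : x = x'%:E -> (lo j < u)%E -> (lo j < x'%:E)%E.
  by case: xE => [[->]//|[x'' -> H] [<-]]; apply: H.
have Py j y' : y = y'%:E -> (v < hi j)%E -> (y'%:E < hi j)%E.
  by case: yE => [[->]//|[y'' -> H] [<-]]; apply: H.
have xb x' : x = x'%:E -> x' <= b.
  by move=> x'E; rewrite -lee_fin -x'E ltW // (lt_trans xa).
have ay y' : y = y'%:E -> a <= y'.
  by move=> y'E; rewrite -lee_fin -y'E ltW // (lt_trans _ yb).
have xy x' y' : x = x'%:E -> y = y'%:E -> x' <= y'.
  by move=> x'E y'E; rewrite -lee_fin -x'E -y'E ltW // (lt_trans xa) // (lt_trans ab').
have XB j x' : x = x'%:E -> alive j x' && alive j b = (lo j < u)%E && (v <= hi j)%E.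
  move=> x'E; apply: alive_pair; [exact: xb|exact: xP|exact: Px|exact: bP|exact: Pb].
have AY j y' : y = y'%:E -> alive j a && alive j y' = (lo j <= u)%E && (v < hi j)%E.
  move=> y'E; apply: alive_pair; [exact: ay|exact: aP|exact: Pa|exact: yP|exact: Py].
have XY j x' y' : x = x'%:E -> y = y'%:E ->
    alive j x' && alive j y' = (lo j < u)%E && (v < hi j)%E.
  move=> x'E y'E; apply: alive_pair; [exact: xy|exact: xP|exact: Px|exact: yP|exact: Py].
have lt_leP j : ((lo j < u) ==> (lo j <= u))%E by apply/implyP; exact: ltW.
have gt_geP j : ((v < hi j) ==> (v <= hi j))%E by apply/implyP; exact: ltW.
have wE j : whole j = (lo j == -oo%E) && (hi j == +oo%E) by [].
rewrite [epers _ _ a%:E b%:E]/= persE ?(ltW ab) //.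
have TE j : ((lo j == u) && (hi j == v)) =
    [&& (lo j <= u)%E, ~~ (lo j < u)%E, (v <= hi j)%E & ~~ (v < hi j)%E].
  by rewrite loj hij -andbA.
case: xE => [[xoo uoo]|[x' x'E _]]; case: yE => [[yoo voo]|[y' y'E _]].
- by move: uvoo; rewrite uoo voo !eqxx.
- rewrite xoo y'E /= persE ?(ay _ y'E) // !min_persE.
  rewrite /bar_count -!sumrB -big_split; apply: eq_bigr => j _ /=.
  rewrite AB (AY _ _ y'E) TE; move: (gt_geP j).
  have -> : (lo j < u)%E = false by rewrite uoo ltNge leNye.
  by case: (lo j <= u)%E; case: (v <= hi j)%E; case: (v < hi j)%E; case: (whole j).
- rewrite x'E yoo /= persE ?(xb _ x'E) // !min_persE.
  rewrite /bar_count -!sumrB -big_split; apply: eq_bigr => j _ /=.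
  rewrite AB (XB _ _ x'E) TE; move: (lt_leP j).
  have -> : (v < hi j)%E = false by rewrite voo ltNge leey.
  by case: (lo j <= u)%E; case: (v <= hi j)%E; case: (lo j < u)%E; case: (whole j).
- rewrite x'E y'E /= !persE ?(xb _ x'E) ?(ay _ y'E) ?(xy _ _ x'E y'E) //.
  rewrite /bar_count -!sumrB -big_split; apply: eq_bigr => j _ /=.
  rewrite AB (XB _ _ x'E) (AY _ _ y'E) (XY _ _ _ x'E y'E) TE.
  move: (lt_leP j) (gt_geP j).
  by case: (lo j <= u)%E; case: (v <= hi j)%E; case: (lo j < u)%E; case: (v < hi j)%E.
Qed.

Lemma multiplicityE u v : (u < v)%E ->
  multiplicity r F u v =
  (#|[pred j | P j & (bar_lo j == u) && (bar_hi j == v)]|)%:Z.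
Proof.
move=> uv; rewrite -bar_countE /multiplicity; case: ifPn => [/andP[/eqP -> /eqP ->]|uvoo].
  exact: min_persE.
apply: minimumE.
  by have [Iu [Iv [? ? ? ? [? ?]]]] := box_count_eq uv uvoo; exists Iu, Iv; split.
by move=> _ [Iu [Iv [? ? ? ? [? ->]]]]; exact: box_count_ge.
Qed.

End Endpoints.

(** * Matchings and interleavings *)

Section MatchingMorphism.
Variables (R : realType) (C : category) (pC : preadditive C) (Simp : C -> Prop).
Local Notation Hom := (hmor pC).
Local Notation Id := (hid pC).
Local Notation functorR := (functor (real_line R) C).
Local Notation barcodeR := (barcode pC Simp).

Lemma trans_barcode_eq (F : functorR) (b : barcodeR F) t Y (f g : Hom (F t) Y) :
  (forall j, bar_alive (b := b) j t -> f \oh bar_in j t = g \oh bar_in j t) -> f = g.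
Proof. by move=> fg; have [_ see] := bar_basis b t; apply: (basis_eq see). Qed.

Section Half.
Variables (F G : functorR) (bF : barcodeR F) (bG : barcodeR G).
Variables (e : R) (mt : bF -> bG -> bool).
Variable th : forall j k, Hom (bar_obj (b := bF) j) (bar_obj (b := bG) k).
Hypothesis mt_fun : forall j k k', mt j k -> mt j k' -> k = k'.
Hypothesis mt_alive : forall j k s t, mt j k -> bar_alive j s -> s <= t ->
  bar_alive k (t + e) -> bar_alive j t /\ bar_alive k (s + e).

Definition match_mor t : Hom (F t) (G (t + e)) :=
  \sum_(j | bar_alive (b := bF) j t) \sum_(k | mt j k && bar_alive k (t + e))
    bar_in k (t + e) \oh th j k \oh bar_out j t.

Lemma match_mor_in j t : bar_alive j t -> match_mor t \oh bar_in j t =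
  \sum_(k | mt j k && bar_alive k (t + e)) bar_in k (t + e) \oh th j k.
Proof.
move=> jt; have [de _] := bar_basis bF t; rewrite hcomp_suml (bigD1 j) //=.
rewrite hcomp_suml [X in _ + X = _]big1 ?addr0 => [|i /andP[it ij]].
  by apply: eq_bigr => k _; rewrite -hcompA de // delta_id hcompm1.
rewrite hcomp_suml big1 // => k _.
by rewrite -hcompA de // delta_neq ?hcompm0 // eq_sym.
Qed.

Lemma match_mor_matched j k t : bar_alive j t -> mt j k ->
  match_mor t \oh bar_in j t =
  if bar_alive k (t + e) then bar_in k (t + e) \oh th j k else 0.
Proof.
move=> jt jk; rewrite match_mor_in // big_mkcond (bigD1 k) //= jk big1 ?addr0 // => l lk.
by case: ifP => // /andP[/(mt_fun jk) kl]; rewrite kl eqxx in lk.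
Qed.

Lemma match_mor_unmatched j t : bar_alive j t -> (forall k, ~~ mt j k) ->
  match_mor t \oh bar_in j t = 0.
Proof.
by move=> jt jN; rewrite match_mor_in // big_pred0 // => k; rewrite (negbTE (jN k)).
Qed.

(** On a matched pair the only danger is a partner alive at the later time while the bar has died,
    or while the partner was not yet born at the earlier one; [mt_alive] excludes both. *)
Lemma match_mor_natural s t : s <= t ->
  match_mor t \oh tr pC F s t = tr pC G (s + e) (t + e) \oh match_mor s.
Proof.
move=> st; apply: (trans_barcode_eq (b := bF)) => j js; rewrite -!hcompA bar_tr //.
have [[k jk]|jN] := pselect (exists k, mt j k); last first.
  have {}jN k : ~~ mt j k by apply/negP => jk; apply: jN; exists k.
  rewrite (match_mor_unmatched js jN) hcompm0.
  by case: ifP => jt; rewrite ?hcompm0 // match_mor_unmatched.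
rewrite (match_mor_matched js jk).
have ste : s + e <= t + e by rewrite lerD2r.
have [kt|kt] := boolP (bar_alive k (t + e)).
  have [jt ks] := mt_alive jk js st kt.
  by rewrite jt ks (match_mor_matched jt jk) kt hcompA bar_tr // kt.
transitivity (0 : Hom (bar_obj j) (G (t + e))).
  by case: ifP => jt; rewrite ?hcompm0 // (match_mor_matched jt jk) (negbTE kt).
by case: ifP => ks; rewrite ?hcompm0 // hcompA bar_tr // (negbTE kt) hcomp0m.
Qed.

Lemma match_nattrans : exists phi : nattrans F (functor_comp G (shift_functor e)),
  forall t, phi t = match_mor t.
Proof.
have nat (s t : real_line R) (f : mor s t) :
    (match_mor t : mor (F t) (functor_comp G (shift_functor e) t)) \oc fmor F f =
    fmor (functor_comp G (shift_functor e)) f \oc match_mor s.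
  have := @match_mor_natural s t f; rewrite (@trE R C pC F s t f).
  by rewrite (@trE R C pC G (s + e) (t + e) (lerD (f : (s : R) <= t) (lexx e))).
by exists (Nattrans nat).
Qed.

End Half.

(** Compared on each bar: a matched bar needs its partner to be alive half way, and an unmatched one
    has to be dead after [e + e]. *)
Lemma match_mor_comp (F G : functorR) (bF : barcodeR F) (bG : barcodeR G) (e : R)
    (mt : bF -> bG -> bool) th th' t :
  (forall j k k', mt j k -> mt j k' -> k = k') ->
  (forall j j' k, mt j k -> mt j' k -> j = j') ->
  (forall j k, mt j k -> th' k j \oh th j k = Id _) ->
  (forall j k, mt j k -> bar_alive j t -> bar_alive j (t + e + e) -> bar_alive k (t + e)) ->
  (forall j, (forall k, ~~ mt j k) -> bar_alive j t -> ~~ bar_alive j (t + e + e)) ->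
  0 <= e ->
  match_mor e (fun k j => mt j k) th' (t + e) \oh match_mor e mt th t = tr pC F t (t + e + e).
Proof.
move=> mtF mtG thK mtal dead e0; apply: (trans_barcode_eq (b := bF)) => j jt.
have te : t <= t + e + e by rewrite -addrA lerDl addr_ge0.
rewrite bar_tr // -hcompA.
have [[k jk]|jN] := pselect (exists k, mt j k); last first.
  have {}jN k : ~~ mt j k by apply/negP => jk; apply: jN; exists k.
  by rewrite match_mor_unmatched // hcompm0 (negbTE (dead _ jN jt)).
rewrite (match_mor_matched e th mtF jt jk).
case: ifP => kt; last first.
  by rewrite hcompm0; case: ifP => // jte; rewrite (mtal j k) in kt.
have mtG' : forall j k k', mt k j -> mt k' j -> k = k' by move=> ? ? ?; exact: mtG.
rewrite hcompA (match_mor_matched e th' mtG' kt jk).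
by case: ifP => _; rewrite ?hcomp0m // -hcompA thK // hcompm1.
Qed.

Lemma match_interleaved (F G : functorR) (bF : barcodeR F) (bG : barcodeR G) (e : R)
    (mt : bF -> bG -> bool) : 0 <= e ->
  (forall j k k', mt j k -> mt j k' -> k = k') ->
  (forall j j' k, mt j k -> mt j' k -> j = j') ->
  (forall j k, mt j k -> isomorphic (bar_obj j) (bar_obj k)) ->
  (forall j k s t, mt j k -> bar_alive j s -> s <= t -> bar_alive k (t + e) ->
    bar_alive j t /\ bar_alive k (s + e)) ->
  (forall j k s t, mt j k -> bar_alive k s -> s <= t -> bar_alive j (t + e) ->
    bar_alive k t /\ bar_alive j (s + e)) ->
  (forall j k t, mt j k -> bar_alive j t -> bar_alive j (t + e + e) -> bar_alive k (t + e)) ->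
  (forall j k t, mt j k -> bar_alive k t -> bar_alive k (t + e + e) -> bar_alive j (t + e)) ->
  (forall j t, (forall k, ~~ mt j k) -> bar_alive j t -> ~~ bar_alive j (t + e + e)) ->
  (forall k t, (forall j, ~~ mt j k) -> bar_alive k t -> ~~ bar_alive k (t + e + e)) ->
  interleaved e F G.
Proof.
move=> e0 mtF mtG mtiso al1 al2 al3 al4 dead1 dead2.
have thP (p : bF * bG) : exists q : Hom (bar_obj p.1) (bar_obj p.2) *
    Hom (bar_obj p.2) (bar_obj p.1),
    mt p.1 p.2 -> q.2 \oh q.1 = Id _ /\ q.1 \oh q.2 = Id _.
  have [m|] := boolP (mt p.1 p.2); last by exists (0, 0).
  by have [f [g fg]] := mtiso _ _ m; exists (f, g).
have [q qP] := dep_choice thP.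
pose th j k := (q (j, k)).1; pose th' k j := (q (j, k)).2.
have mtG' k j j' : mt j k -> mt j' k -> j = j' by exact: mtG.
have [phi phiE] := match_nattrans (mt := mt) th mtF al1.
have al2' k j s t : mt j k -> bar_alive k s -> s <= t -> bar_alive j (t + e) ->
    bar_alive k t /\ bar_alive j (s + e) by exact: al2.
have [psi psiE] := match_nattrans (mt := fun k j => mt j k) th' mtG' al2'.
have H1 t := @match_mor_comp F G bF bG e mt th th' t mtF mtG
  (fun j k jk => (qP (j, k) jk).1) (fun j k => @al3 j k t) (fun j => @dead1 j t) e0.
have H2 t := @match_mor_comp G F bG bF e (fun k j => mt j k) th' th t
  mtG' (fun k k' j => @mtF j k k')
  (fun k j jk => (qP (j, k) jk).2) (fun k j => @al4 j k t) (fun k => @dead2 k t) e0.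
exists phi, psi => t h; split.
  by rewrite phiE psiE -(trE pC F h) -H1.
by rewrite phiE psiE -(trE pC G h) -H2.
Qed.

End MatchingMorphism.

(** * Pairing two families in descending order *)

Section SortedMatching.
Variable R : realType.
Local Open Scope ereal_scope.

Lemma sorted_index_lt (T : eqType) (v : T -> \bar R) (s : seq T) x z :
  pairwise (fun a b => v b <= v a) s -> x \in s -> z < v x ->
  (index x s < count (fun y => (z < v y)%E) s)%N.
Proof.
elim: s => //= y s IHs /andP[/allP ys ps]; rewrite in_cons => xys zx.
have [->|yx] := eqVneq y x; first by rewrite zx.
have xs : x \in s by move: xys; rewrite eq_sym (negbTE yx).
by rewrite (lt_le_trans zx (ys _ xs)) add1n ltnS IHs.
Qed.

Lemma sorted_index_ge (T : eqType) (v : T -> \bar R) (s : seq T) x z :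
  pairwise (fun a b => v b <= v a) s -> x \in s -> v x <= z ->
  (count (fun y => (z < v y)%E) s <= index x s)%N.
Proof.
elim: s => //= y s IHs /andP[/allP ys ps]; rewrite in_cons => xys xz.
have [yx|yx] := eqVneq y x.
  subst y; rewrite ltNge xz /= leqn0 -leqn0 leqNgt -has_count; apply/hasPn => w /ys wx.
  by rewrite -leNgt (le_trans wx).
have xs : x \in s by move: xys; rewrite eq_sym (negbTE yx).
by rewrite -addn1 addnC leq_add ?IHs ?leq_b1.
Qed.

(** Entries of equal index in the two descending lists are paired. A bound between the numbers of
    entries above every [z] is a bound between entries of equal index; past the end of the shorter
    list, [u] stands in for the missing entry, whence the last clause. *)
Lemma sorted_matching (J K : finType) (A : pred J) (B : pred K)
    (vJ : J -> \bar R) (vK : K -> \bar R) (u : \bar R) (d : R) :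
  u < +oo -> (forall k, B k -> u < vK k) -> (forall j, A j -> u < vJ j) ->
  (forall z, u <= z -> z < +oo -> (#|[pred k | B k & (z < vK k)%E]| <=
    #|[pred j | A j & (z < vJ j)%E]|)%N) ->
  (forall z, u <= z -> z < +oo -> (#|[pred j | A j & (z + d%:E < vJ j)%E]| <=
    #|[pred k | B k & (z < vK k)%E]|)%N) ->
  exists m : K -> J -> bool,
  [/\ forall k j, m k j -> [/\ B k, A j, vK k <= vJ j & vJ j <= vK k + d%:E],
      forall k j j', m k j -> m k j' -> j = j',
      forall k k' j, m k j -> m k' j -> k = k',
      forall k, B k -> exists j, m k j
    & forall j, A j -> (forall k, ~~ m k j) -> vJ j <= u + d%:E].
Proof.
move=> uoo Bu Au le1 le2.
pose sK := sort (fun a b => vK b <= vK a) (enum B).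
pose sJ := sort (fun a b => vJ b <= vJ a) (enum A).
have pK : pairwise (fun a b => vK b <= vK a) sK.
  rewrite -sorted_pairwise; last by move=> a b c ab bc; exact: le_trans bc ab.
  by apply: sort_sorted => a b; exact: le_total.
have pJ : pairwise (fun a b => vJ b <= vJ a) sJ.
  rewrite -sorted_pairwise; last by move=> a b c ab bc; exact: le_trans bc ab.
  by apply: sort_sorted => a b; exact: le_total.
have memK k : (k \in sK) = B k by rewrite mem_sort mem_enum.
have memJ j : (j \in sJ) = A j by rewrite mem_sort mem_enum.
have cK z : #|[pred k | B k & (z < vK k)%E]| = count (fun k => (z < vK k)%E) sK.
  rewrite /sK count_sort cardE -size_filter; congr size.
  by rewrite -filter_predI; apply: eq_filter => k; rewrite /= inE andbC.
have cJ z : #|[pred k | A k & (z < vJ k)%E]| = count (fun k => (z < vJ k)%E) sJ.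
  rewrite /sJ count_sort cardE -size_filter; congr size.
  by rewrite -filter_predI; apply: eq_filter => k; rewrite /= inE andbC.
have szK : count (fun k => (u < vK k)%E) sK = size sK.
  by apply/eqP; rewrite -all_count; apply/allP => k; rewrite memK => /Bu.
have szJ : count (fun k => (u < vJ k)%E) sJ = size sJ.
  by apply/eqP; rewrite -all_count; apply/allP => k; rewrite memJ => /Au.
have szKJ : (size sK <= size sJ)%N.
  by rewrite -szK -szJ -cK -cJ le1.
exists (fun k j => [&& B k, A j & index k sK == index j sJ]); split.
- move=> k j /and3P[Bk Aj /eqP kj]; rewrite -memK in Bk; rewrite -memJ in Aj.
  split; rewrite -?memK -?memJ // leNgt; apply/negP => vkj.
  (* At [z = vJ j], the index of [k] is below the number of [vK] above [z], hence below the number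
     of [vJ] above [z], which is at most the index of [j]. *)
  + have lt1 := sorted_index_lt pK Bk vkj.
    have uz : u <= vJ j by apply/ltW/Au; rewrite -memJ.
    have zoo : vJ j < +oo by exact: lt_le_trans vkj (leey _).
    have := leq_trans lt1 (leq_trans _ (sorted_index_ge pJ Aj (lexx (vJ j)))).
    by rewrite -cK -cJ le1 // => /(_ isT); rewrite kj ltnn.
  + have lt1 := sorted_index_lt pJ Aj vkj.
    have uz : u <= vK k by apply/ltW/Bu; rewrite -memK.
    have zoo : vK k < +oo.
      by rewrite ltey; apply: contraTneq vkj => ->; rewrite addye // -leNgt leey.
    have := leq_trans lt1 (leq_trans _ (sorted_index_ge pK Bk (lexx (vK k)))).
    by rewrite -cK -cJ le2 // => /(_ isT); rewrite kj ltnn.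
- move=> k j j' /and3P[_ Aj /eqP kj] /and3P[_ Aj' /eqP kj'].
  have jj : index j sJ = index j' sJ by rewrite -kj.
  by rewrite -(nth_index j (etrans (memJ j) Aj)) jj nth_index ?memJ.
- move=> k k' j /and3P[Bk _ /eqP kj] /and3P[Bk' _ /eqP kj'].
  have kk : index k sK = index k' sK by rewrite kj.
  by rewrite -(nth_index k (etrans (memK k) Bk)) kk nth_index ?memK.
- move=> k Bk; have ik : (index k sK < size sJ)%N.
    by apply: leq_trans szKJ; rewrite index_mem memK.
  have [j0 _] : exists j0, j0 \in sJ.
    by case: (sJ) ik => [|j0 s] // _; exists j0; exact: mem_head.
  exists (nth j0 sJ (index k sK)); rewrite Bk -memJ mem_nth //=.
  by rewrite index_uniq // sort_uniq enum_uniq.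
- move=> j Aj jN; rewrite leNgt; apply/negP => uj.
  have := sorted_index_lt pJ _ uj; rewrite memJ => /(_ Aj) lt1.
  have : (index j sJ < size sK)%N by rewrite (leq_trans lt1) // -cJ -szK -cK le2.
  move=> jk; have [k0 _] : exists k0, k0 \in sK.
    by case: (sK) jk => [|k0 s] // _; exists k0; exact: mem_head.
  case/negP: (jN (nth k0 sK (index j sJ))); rewrite -memK mem_nth // Aj /=.
  by rewrite index_uniq // sort_uniq enum_uniq.
Qed.
End SortedMatching.

(** * Counting bars by birth, and matchings that preserve births *)

Section HalfMatching.
Variable R : realType.

(** Endpoints are given abstractly, and not as infima and suprema, so that time-reversed bars with
    flipped endpoints qualify directly. *)
Definition has_ends (J : finType) (alive : J -> R -> bool) (lo hi : J -> \bar R) :=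
  (forall j t, alive j t -> (lo j <= t%:E)%E /\ (t%:E <= hi j)%E) /\
  (forall j t, (lo j < t%:E)%E -> (t%:E < hi j)%E -> alive j t).

Definition nbars (J : finType) (P : pred J) (alive : J -> R -> bool) (s t : R) : nat :=
  #|[pred j | P j & alive j s && alive j t]|.

Section Born.
Variables (J : finType) (P : pred J) (alive : J -> R -> bool) (lo hi : J -> \bar R).
Hypothesis ends : has_ends alive lo hi.

Lemma nbarsE (s t : R) (p q : J -> bool) : s <= t ->
  (forall j, alive j s -> p j) -> (forall j, p j -> (lo j < s%:E)%E) ->
  (forall j, alive j t -> q j) -> (forall j, q j -> (t%:E < hi j)%E) ->
  nbars P alive s t = #|[pred j | P j & p j && q j]|.
Proof.
move=> st sp ps tq qt; apply: eq_card => j; rewrite !inE; congr (_ && _).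
apply/andP/andP => [[/sp ? /tq ?]|[/ps los /qt thi]] //.
split; apply: ends.2 => //; first by apply: le_lt_trans thi; rewrite lee_fin.
by apply: lt_le_trans los _; rewrite lee_fin.
Qed.

Definition born (u z : \bar R) : nat :=
  #|[pred j | P j & (lo j == u) && (z < hi j)%E]|.

(** No birth other than [u] lies between [s] and [s'], and [t] comes just after [z]; so the
    difference of the two ranks is the number of bars born at [u] and alive after [z]. *)
Lemma nbars_born (s s' t : R) (u z : \bar R) : s <= s' -> s' <= t ->
  (s%:E < u)%E -> (u < s'%:E)%E -> (z < t%:E)%E ->
  (forall j, (lo j < u)%E -> (lo j < s%:E)%E) ->
  (forall j, (u < lo j)%E -> (s'%:E < lo j)%E) ->
  (forall j, (z < hi j)%E -> (t%:E < hi j)%E) ->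
  nbars P alive s' t = (nbars P alive s t + born u z)%N.
Proof.
move=> ss' s't su us' zt g1 g2 g3.
have hiz j : alive j t -> (z < hi j)%E by move=> /ends.1[_]; exact: lt_le_trans.
rewrite (@nbarsE s' t (fun j => (lo j <= u)%E) (fun j => (z < hi j)%E)) //; last first.
- by move=> j /le_lt_trans; exact.
- by move=> j /ends.1[l _]; rewrite leNgt; apply/negP => /g2; rewrite ltNge l.
rewrite (@nbarsE s t (fun j => (lo j < u)%E) (fun j => (z < hi j)%E)) //; last first.
- by move=> j /ends.1[l _]; exact: le_lt_trans su.
- exact: le_trans s't.
rewrite /born -!sum1_card big_mkcond [X in (_ = X + _)%N]big_mkcond.
rewrite [X in (_ = _ + X)%N]big_mkcond -big_split; apply: eq_bigr => j _ /=.
rewrite !inE; case: (P j) => //=; rewrite le_eqVlt.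
by case: eqVneq => [->|_]; rewrite ?ltxx ?orbF /=; case: (_ < hi j)%E; rewrite ?andbT ?andbF ?addn0.
Qed.

Lemma nbars_born_ninfty (s' t : R) (z : \bar R) : s' <= t -> (z < t%:E)%E ->
  (forall j, (-oo < lo j)%E -> (s'%:E < lo j)%E) ->
  (forall j, (z < hi j)%E -> (t%:E < hi j)%E) ->
  nbars P alive s' t = born -oo%E z.
Proof.
move=> s't zt g2 g3; apply: nbarsE => //.
- move=> j /ends.1[l _]; apply: contraTT l => loj; rewrite -ltNge g2 //.
  by rewrite lt_neqAle eq_sym loj leNye.
- by move=> j /eqP ->; rewrite ltNyr.
- by move=> j /ends.1[_]; exact: lt_le_trans.
Qed.

End Born.

Section Two.
Variables (J K : finType) (PJ : pred J) (PK : pred K).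
Variables (aJ : J -> R -> bool) (loJ hiJ : J -> \bar R).
Variables (aK : K -> R -> bool) (loK hiK : K -> \bar R).
Hypotheses (endsJ : has_ends aJ loJ hiJ) (endsK : has_ends aK loK hiK).
Variable d : R.
Hypothesis d0 : 0 <= d.
Local Notation pJ := (nbars PJ aJ).
Local Notation pK := (nbars PK aK).
Hypothesis rank_le1 : forall s s' t, s <= s' -> s' <= t ->
  (pK s' t + pJ s t <= pK s t + pJ s' t)%N.
Hypothesis rank_le1' : forall s t, s <= t -> (pK s t <= pJ s t)%N.
Hypothesis rank_le2 : forall s s' t, s <= s' -> s' <= t ->
  (pJ s' (t + d)%R + pK s t <= pJ s (t + d)%R + pK s' t)%N.
Hypothesis rank_le2' : forall s t, s <= t -> (pJ s (t + d)%R <= pK s t)%N.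

Lemma born_le u z : (u <= z)%E -> (z < +oo)%E ->
  (born PK loK hiK u z <= born PJ loJ hiJ u z)%N /\
  (born PJ loJ hiJ u (z + d%:E)%E <= born PK loK hiK u z)%N.
Proof.
move=> uz zoo.
(* The shifted deaths [hiJ j - d] are included so that [t + d] lies in the gap just after
   [z + d]. *)
pose E := [seq loJ j | j <- enum J] ++ [seq hiJ j | j <- enum J] ++
  [seq (hiJ j - d%:E)%E | j <- enum J] ++ [seq loK j | j <- enum K] ++ [seq hiK j | j <- enum K].
have E1 j : loJ j \in E by rewrite !mem_cat map_f // mem_enum.
have E2 j : hiJ j \in E by rewrite !mem_cat (map_f hiJ) ?orbT // mem_enum.
have E3 j : (hiJ j - d%:E)%E \in E.
  by rewrite !mem_cat (map_f (fun j => hiJ j - d%:E)%E) ?orbT // mem_enum.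
have E4 k : loK k \in E by rewrite !mem_cat (map_f loK) ?orbT // mem_enum.
have E5 k : hiK k \in E by rewrite !mem_cat (map_f hiK) ?orbT // mem_enum.
have [t [zt tE]] := gap_right E zoo.
have [s' [us' s'E]] := gap_right (t%:E :: E) (le_lt_trans uz zoo).
have s't : s' <= t.
  by rewrite -lee_fin ltW // s'E ?mem_head // (le_lt_trans uz).
have inE' e : e \in E -> (u < e)%E -> (s'%:E < e)%E.
  by move=> eE; apply: s'E; rewrite in_cons eE orbT.
have s'td : s' <= t + d by rewrite (le_trans s't) // lerDl.
have zdtd : (z + d%:E < (t + d)%:E)%E by rewrite EFinD lteD2rE.
have tdhi j : (z + d%:E < hiJ j)%E -> ((t + d)%:E < hiJ j)%E.
  by rewrite EFinD -!lteBrDr // => H; exact: tE.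
(* No time precedes [-oo], so plain rank inequalities replace those between differences of ranks. *)
have [uoo|uoo] := eqVneq u -oo%E.
  subst u.
  have bK := nbars_born_ninfty PK endsK s't zt (fun j => inE' _ (E4 j)) (fun j => tE _ (E5 j)).
  have bJ := nbars_born_ninfty PJ endsJ s't zt (fun j => inE' _ (E1 j)) (fun j => tE _ (E2 j)).
  have bJ' := nbars_born_ninfty PJ endsJ s'td zdtd (fun j => inE' _ (E1 j)) tdhi.
  by rewrite -bK -bJ -bJ' rank_le1' // rank_le2'.
have [|s [su sE]] := @gap_left R u E; first by rewrite lt_neqAle eq_sym uoo leNye.
have ss' : s <= s' by rewrite -lee_fin ltW // (lt_trans su).
have bK := nbars_born PK endsK ss' s't su us' zt (fun j => sE _ (E4 j))
  (fun j => inE' _ (E4 j)) (fun j => tE _ (E5 j)).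
have bJ := nbars_born PJ endsJ ss' s't su us' zt (fun j => sE _ (E1 j))
  (fun j => inE' _ (E1 j)) (fun j => tE _ (E2 j)).
have bJ' := nbars_born PJ endsJ ss' s'td su us' zdtd (fun j => sE _ (E1 j))
  (fun j => inE' _ (E1 j)) tdhi.
split.
  have := rank_le1 ss' s't; rewrite bK bJ addnAC [leqRHS]addnA.
  by rewrite leq_add2l.
have := rank_le2 ss' s't; rewrite bK bJ' addnAC [leqRHS]addnA.
by rewrite leq_add2l.
Qed.

(** [K] stands for the bars of the image and [J] for those of the diagram with the same births. Each
    birth [u] gets its own sorted matching, and that of [k] is looked up at [u = loK k]. *)
Lemma half_matching : exists m : K -> J -> bool,
  [/\ forall k j, m k j -> [/\ PK k /\ (loK k < hiK k)%E, PJ j /\ (loJ j < hiJ j)%E,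
        loK k = loJ j, (hiK k <= hiJ j)%E & (hiJ j <= hiK k + d%:E)%E],
      forall k j j', m k j -> m k j' -> j = j',
      forall k k' j, m k j -> m k' j -> k = k',
      forall k, PK k -> (loK k < hiK k)%E -> exists j, m k j
    & forall j, PJ j -> (loJ j < hiJ j)%E -> (forall k, ~~ m k j) ->
        (hiJ j <= loJ j + d%:E)%E].
Proof.
pose A u j := [&& PJ j, loJ j == u & (u < hiJ j)%E].
pose B u k := [&& PK k, loK k == u & (u < hiK k)%E].
have zz (z : \bar R) : (z <= z + d%:E)%E by rewrite leeDl // lee_fin.
have bA u z : (u <= z)%E -> #|[pred j | A u j & (z < hiJ j)%E]| = born PJ loJ hiJ u z.
  move=> uz; apply: eq_card => j; rewrite !inE /A -!andbA; congr [&& _, _ & _].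
  by apply: andb_idl => /(le_lt_trans uz).
have bB u z : (u <= z)%E -> #|[pred j | B u j & (z < hiK j)%E]| = born PK loK hiK u z.
  move=> uz; apply: eq_card => j; rewrite !inE /A -!andbA; congr [&& _, _ & _].
  by apply: andb_idl => /(le_lt_trans uz).
have mP u : exists m : K -> J -> bool, (u < +oo)%E ->
  [/\ forall k j, m k j -> [/\ B u k, A u j, (hiK k <= hiJ j)%E & (hiJ j <= hiK k + d%:E)%E],
      forall k j j', m k j -> m k j' -> j = j',
      forall k k' j, m k j -> m k' j -> k = k',
      forall k, B u k -> exists j, m k j
    & forall j, A u j -> (forall k, ~~ m k j) -> (hiJ j <= u + d%:E)%E].
  (* No bar satisfies [u < hi] for [u = +oo]; the empty matching is a default. *)
  have [uoo|] := boolP (u < +oo)%E; last by exists (fun _ _ => false).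
  have [||||m mP] := @sorted_matching R J K (A u) (B u) hiJ hiK u d uoo.
  - by move=> k /and3P[].
  - by move=> j /and3P[].
  - by move=> z uz zoo; rewrite bA // bB //; case: (born_le uz zoo).
  - by move=> z uz zoo; rewrite bA ?(le_trans uz) // bB //; case: (born_le uz zoo).
  - by exists m.
have [m {}mP] := choice mP.
have Boo u k : B u k -> (u < +oo)%E by move=> /and3P[_ _ /lt_le_trans]; apply; exact: leey.
exists (fun k j => (loK k < +oo)%E && m (loK k) k j); split.
- move=> k j /andP[/mP[+ _ _ _ _]] => /[apply] -[/and3P[? _ ?] /and3P[? /eqP lj ?] ? ?].
  by split=> //; split=> //; rewrite lj.
- by move=> k j j' /andP[/mP[_ + _ _ _] kj] /andP[_ kj'] => /(_ _ _ _ kj kj').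
- move=> k k' j /andP[koo kj] /andP[koo' kj'].
  have [H1 _ H3 _ _] := mP _ koo; have [H1' _ _ _ _] := mP _ koo'.
  have [_ /and3P[_ /eqP l1 _] _ _] := H1 _ _ kj.
  have [_ /and3P[_ /eqP l2 _] _ _] := H1' _ _ kj'.
  by apply: (H3 _ _ j) => //; rewrite -l1 l2.
- move=> k Pk kp; have Bk : B (loK k) k by rewrite /B Pk eqxx.
  have [_ _ _ + _] := mP _ (Boo _ _ Bk) => /(_ _ Bk)[j kj].
  by exists j; rewrite kj (Boo _ _ Bk).
- move=> j Pj jp jN; have Aj : A (loJ j) j by rewrite /A Pj eqxx.
  have uoo : (loJ j < +oo)%E by exact: lt_le_trans jp (leey _).
  have [H1 _ _ _ +] := mP _ uoo => /(_ _ Aj); apply => k.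
  apply: contra (jN k) => kj; have [/and3P[_ /eqP -> _] _ _ _] := H1 _ _ kj.
  by rewrite uoo.
Qed.

End Two.
End HalfMatching.

(** * The image of a natural transformation *)

Section ImageFunctor.
Variables (D C : category) (pC : preadditive C) (Simp : C -> Prop).
Hypothesis sys : simple_system pC Simp.
Local Notation Hom := (hmor pC).
Local Notation Id := (hid pC).
Variables (F G : functor D C) (phi : nattrans F G).

(** By naturality of [phi], the maps of [G] send the image of [m X] into that of [m Y]; the
    retraction [r] merely recovers the restriction. Functoriality holds after composition with the
    monomorphisms [m], hence before. *)
Lemma image_functor : exists (I : functor D C)
    (m : forall X, Hom (I X) (G X)) (q : forall X, Hom (F X) (I X))
    (r : forall X, Hom (G X) (I X)) (s : forall X, Hom (I X) (F X)),
  [/\ forall X, r X \oh m X = Id _, forall X, q X \oh s X = Id _,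
      forall X, (phi X : Hom (F X) (G X)) = m X \oh q X,
      forall X Y (f : mor X Y), m Y \oh (fmor I f : Hom _ _) = (fmor G f : Hom _ _) \oh m X
    & forall X Y (f : mor X Y), (fmor I f : Hom _ _) \oh q X = q Y \oh (fmor F f : Hom _ _)].
Proof.
have fact X : exists z : {Z : C & (Hom Z (G X) * Hom (F X) Z * Hom (G X) Z * Hom Z (F X))%type},
    let: (m, q, r, s) := projT2 z in
    [/\ r \oh m = Id _, q \oh s = Id _ & (phi X : Hom (F X) (G X)) = m \oh q].
  have [Z [m [q [r [s H]]]]] := image_split sys (phi X : Hom (F X) (G X)).
  by exists (existT (fun Z =>
    (Hom Z (G X) * Hom (F X) Z * Hom (G X) Z * Hom Z (F X))%type) Z (m, q, r, s)).
have [z zP] := dep_choice fact.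
pose Z X := projT1 (z X).
pose m X : Hom (Z X) (G X) := (projT2 (z X)).1.1.1.
pose q X : Hom (F X) (Z X) := (projT2 (z X)).1.1.2.
pose r X : Hom (G X) (Z X) := (projT2 (z X)).1.2.
pose s X : Hom (Z X) (F X) := (projT2 (z X)).2.
have {}zP X : [/\ r X \oh m X = Id _, q X \oh s X = Id _ & (phi X : Hom (F X) (G X)) = m X \oh q X].
  by have := zP X; rewrite /m /q /r /s /Z; case: (projT2 (z X)) => -[[? ?] ?] ?.
have rm X : r X \oh m X = Id _ by have [] := zP X.
have qs X : q X \oh s X = Id _ by have [] := zP X.
have mq X : (phi X : Hom (F X) (G X)) = m X \oh q X by have [] := zP X.
pose Imor X Y (f : mor X Y) : Hom (Z X) (Z Y) := r Y \oh (fmor G f : Hom _ _) \oh m X.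
have phin X Y (f : mor X Y) : (phi Y : Hom (F Y) (G Y)) \oh (fmor F f : Hom _ _) =
   (fmor G f : Hom (G X) (G Y)) \oh (phi X : Hom (F X) (G X)) by exact: ntr_natural.
have GmE X Y (f : mor X Y) : (fmor G f : Hom _ _) \oh m X =
    m Y \oh (q Y \oh (fmor F f : Hom _ _) \oh s X).
  rewrite -[m X]hcompm1 -qs [m X \oh _]hcompA -mq hcompA -phin mq.
  by rewrite -!hcompA.
have Imn X Y (f : mor X Y) : m Y \oh Imor X Y f = (fmor G f : Hom _ _) \oh m X.
  rewrite /Imor -[r Y \oh _ \oh _]hcompA GmE [r Y \oh (m Y \oh _)]hcompA rm hcomp1m //.
have mI X Y (f g : Hom Y (Z X)) : m X \oh f = m X \oh g -> f = g.
  by move=> fg; rewrite -(hcomp1m f) -(hcomp1m g) -rm -!hcompA fg.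
have I1 X : Imor X X (idm X) = idm (Z X).
  apply: (mI X (Z X) _ (Id (Z X))); rewrite Imn hcompm1.
  by rewrite fmor1 -[idm _]/(Id _) hcomp1m.
have IM X Y W (g : mor Y W) (f : mor X Y) : Imor X W (g \oc f) = Imor Y W g \oc Imor X Y f.
  apply: (mI W (Z X) _ (Imor Y W g \oh Imor X Y f)).
  rewrite Imn hcompA Imn -hcompA Imn hcompA; congr (_ \oh _).
  by rewrite fmorM.
exists (@Functor D C Z Imor I1 IM), m, q, r, s; split=> // X Y f.
apply: (mI Y (F X)); rewrite -[LHS]/(m Y \oh (Imor X Y f \oh q X)) [LHS]hcompA Imn -[LHS]hcompA.
by rewrite -mq -phin mq -hcompA.
Qed.

End ImageFunctor.

Section RankOfBarcode.
Variables (R : realType) (C : category) (pC : preadditive C) (Simp : C -> Prop).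
Hypothesis sys : simple_system pC Simp.

(** In the bases given by the bars a transition map is diagonal, with identities at the bars alive
    at both times. *)
Lemma rk_barcode (c : C -> bool) (F : functor (real_line R) C) (b : barcode pC Simp F) s t :
  iso_invariant c -> s <= t ->
  rk Simp c (tr pC F s t) =
  nbars (fun j : b => c (bar_obj j)) (@bar_alive R C pC Simp F b) s t.
Proof.
move=> cP st; have [ds ss] := bar_basis b s; have [dt st'] := bar_basis b t.
pose P j := bar_alive (b := b) j s && bar_alive (b := b) j t.
rewrite (@rk_eq _ _ _ sys c _ _ (tr pC F s t) b P (@bar_obj R C pC Simp F b)) //.
- by apply: eq_card => j; rewrite !inE andbC.
- by move=> j _; exact: bar_simple.
- exists (fun j => bar_out j t), (fun j => bar_in j s) => i j /andP[i_s it] /andP[js jt].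
  by rewrite -hcompA bar_tr // jt dt.
- exists (fun j => bar_in j t), (fun j => bar_out j s).
  rewrite -[LHS]hcompm1 -ss hcomp_sumr big_mkcondr; apply: eq_bigr => j js.
  rewrite hcompA bar_tr //; case: ifP => // _; exact: hcomp0m.
Qed.

Lemma bar_has_ends (F : functor (real_line R) C) (b : barcode pC Simp F) :
  has_ends (@bar_alive R C pC Simp F b) (bar_lo (@bar_alive R C pC Simp F b))
    (bar_hi (@bar_alive R C pC Simp F b)).
Proof.
split=> j t; first by split; [exact: bar_lo_le|exact: bar_hi_ge].
by apply: bar_between; exact: bar_convex.
Qed.

End RankOfBarcode.

Section Flip.
Variable R : realType.
Local Open Scope ereal_scope.
Implicit Types (x y : \bar R) (a d t : R).

Lemma lee_flipl a t x : (a%:E - x <= t%:E) = ((a - t)%:E <= x).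
Proof.
case: x => [r| |]; rewrite ?leey ?leNye //.
by rewrite -EFinN -EFinD !lee_fin lerBlDl lerBlDr.
Qed.

Lemma lee_flipr a t x : (t%:E <= a%:E - x) = (x <= (a - t)%:E).
Proof.
case: x => [r| |]; rewrite ?leey ?leNye //.
by rewrite -EFinN -EFinD !lee_fin !lerBrDr addrC.
Qed.

(** For infinite arguments this forces equality, as finiteness of [coord_dist] does. *)
Definition eclose (e : R) x y : Prop := x <= y + e%:E /\ y <= x + e%:E.

(** Used for births: in reversed time [- x] and [e - y] are deaths, and the shift by [e] between the
    image and [G] centers the one-sided bound [e + e]. *)
Lemma close_flip (e : R) x y : - x <= e%:E - y -> e%:E - y <= - x + (e + e)%:E ->
  eclose e x y.
Proof.
case: x => [x||]; case: y => [y||] //; rewrite /eclose ?leey ?leNye //.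
by rewrite /= !lee_fin => ? ?; split; lra.
Qed.

Lemma close_shift (e : R) x y z : z = y - e%:E -> z <= x -> x <= z + (e + e)%:E ->
  eclose e x y.
Proof.
move=> ->; case: x => [x||]; case: y => [y||] //; rewrite /eclose ?leey ?leNye //.
by rewrite /= !lee_fin => ? ?; split; lra.
Qed.

Lemma flip_lt (e : R) x y : e%:E - x < e%:E - y -> y < x.
Proof. by rewrite !ltNge; apply: contra => yx; rewrite leeD2l // leeN2. Qed.

Lemma lt_flip (e : R) x y : y < x -> e%:E - x < e%:E - y.
Proof.
case: x => [x||]; case: y => [y||] //; rewrite ?ltry ?ltNyr //.
by rewrite /= !lte_fin => ?; lra.
Qed.

Lemma flip_eq (e : R) x y : - x = e%:E - y -> x = y - e%:E.
Proof.
case: x => [x||]; case: y => [y||] //= [] /eqP; rewrite eqr_oppLR => /eqP ->.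
by congr EFin; rewrite opprB.
Qed.

Lemma close_short (e d : R) x y : e%:E - x <= e%:E - y + d%:E -> y <= x + d%:E.
Proof.
case: x => [x||]; case: y => [y||] //; rewrite ?leey ?leNye //.
by rewrite /= !lee_fin => ?; lra.
Qed.

End Flip.

(** * The matching induced by an interleaving *)

Section Stability.
Variables (R : realType) (C : category) (pC : preadditive C) (Simp : C -> Prop).
Hypothesis sys : simple_system pC Simp.
Local Notation Hom := (hmor pC).
Local Notation Id := (hid pC).
Local Notation functorR := (functor (real_line R) C).
Variables (F G : functorR) (bF : barcode pC Simp F) (bG : barcode pC Simp G).
Variables (xsF xsG : seq R).
Hypotheses (isoF : iso_off pC F xsF) (isoG : iso_off pC G xsG).
Variable c : C -> bool.
Hypothesis c_inv : iso_invariant c.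

Local Notation loF := (bar_lo (@bar_alive R C pC Simp F bF)).
Local Notation hiF := (bar_hi (@bar_alive R C pC Simp F bF)).
Local Notation loG := (bar_lo (@bar_alive R C pC Simp G bG)).
Local Notation hiG := (bar_hi (@bar_alive R C pC Simp G bG)).

Lemma tr_shift (H : functorR) (e s t : R) : s <= t ->
  tr pC (functor_comp H (shift_functor e)) s t = tr pC H (s + e) (t + e).
Proof.
move=> st; rewrite (trE pC (functor_comp H (shift_functor e)) st).
by rewrite (trE pC H (lerD st (lexx e))).
Qed.

Lemma nattrans_tr (H H' : functorR) (phi : nattrans H H') s t : s <= t ->
  (phi t : Hom _ _) \oh tr pC H s t = tr pC H' s t \oh (phi s : Hom _ _).
Proof. by move=> st; rewrite (trE pC H st) (trE pC H' st); exact: (ntr_natural phi st). Qed.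

Lemma stability_matching (e : R) : 0 <= e -> interleaved e F G ->
  exists mt : bF -> bG -> bool,
  [/\ forall j k, mt j k -> [/\ c (bar_obj j) /\ (loF j < hiF j)%E,
         c (bar_obj k) /\ (loG k < hiG k)%E, eclose e (loF j) (loG k) & eclose e (hiF j) (hiG k)],
      forall j k k', mt j k -> mt j k' -> k = k',
      forall j j' k, mt j k -> mt j' k -> j = j',
      forall j, c (bar_obj j) -> (loF j < hiF j)%E -> (forall k, ~~ mt j k) ->
        (hiF j <= loF j + (e + e)%:E)%E
    & forall k, c (bar_obj k) -> (loG k < hiG k)%E -> (forall j, ~~ mt j k) ->
        (hiG k <= loG k + (e + e)%:E)%E].
Proof.
move=> e0 [phi [psi phipsi]].
have le_e t : t <= t + e + e by rewrite -addrA lerDl addr_ge0.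
have psiphi t : (psi (t + e) : Hom _ _) \oh (phi t : Hom _ _) = tr pC F t (t + e + e).
  by rewrite (trE pC F (le_e t)); exact: (phipsi t (le_e t)).1.
have phipsi' t : (phi (t + e) : Hom _ _) \oh (psi t : Hom _ _) = tr pC G t (t + e + e).
  by rewrite (trE pC G (le_e t)); exact: (phipsi t (le_e t)).2.
pose G' := functor_comp G (shift_functor e).
have [I [m [q [r [s [rm qs mq mnat qnat]]]]]] := image_functor sys phi.
have mI u v : u <= v -> m v \oh tr pC I u v = tr pC G (u + e) (v + e) \oh m u.
  by move=> uv; rewrite -tr_shift // (trE pC I uv) (trE pC _ uv) mnat.
have qI u v : u <= v -> tr pC I u v \oh q u = q v \oh tr pC F u v.
  by move=> uv; rewrite (trE pC I uv) (trE pC F uv) qnat.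
have psi_tr u v : u <= v -> (psi v : Hom _ _) \oh tr pC G u v =
    tr pC F (u + e) (v + e) \oh (psi u : Hom _ _).
  by move=> uv; rewrite (nattrans_tr psi uv) tr_shift.
(* The transition maps of [I] are quotients of those of [F] and restrictions of those of the shifted
   [G]: an inverse for [F] gives a right inverse, one for [G] a left inverse. *)
have isoI : iso_off pC I (xsF ++ [seq x - e | x <- xsG]).
  move=> u v uv nxs.
  have [f' [_ ff']] : is_iso (tr pC F u v).
    by apply: isoF => // x xF; apply: nxs; rewrite mem_cat xF.
  have [g' [gg' _]] : is_iso (tr pC G (u + e) (v + e)).
    apply: isoG => [|x xG]; first by rewrite lerD2r.
    have := nxs (x - e); rewrite mem_cat (map_f (fun x => x - e) xG) orbT => /(_ isT).
    by apply: contra; rewrite lerBrDr lerBlDr.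
  have rinv : tr pC I u v \oh (q u \oh (f' : Hom _ _) \oh s v) = Id _.
    rewrite !hcompA qI // -[q v \oh _ \oh _]hcompA.
    by rewrite -[tr pC F u v \oh _]/(tr pC F u v \oc f') ff' [q v \oh _]hcompm1.
  have linv : (r u \oh (g' : Hom _ _) \oh m v) \oh tr pC I u v = Id _.
    rewrite -!hcompA mI // [(g' : Hom _ _) \oh _]hcompA.
    by rewrite -[_ \oh tr pC G _ _]/(g' \oc tr pC G _ _) gg' [X in r u \oh X]hcomp1m.
  exists (q u \oh (f' : Hom _ _) \oh s v); split=> //.
  rewrite -[LHS]/(q u \oh (f' : Hom _ _) \oh s v \oh tr pC I u v).
  rewrite -[q u \oh _ \oh _](hcomp1m) -linv -[_ \oh tr pC I u v \oh _]hcompA rinv.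
  by rewrite hcompm1.
have [bI] := barcode_exists sys isoI.
pose rI := rk (pC := pC) Simp c.
have rkIm v w : v <= w -> rI _ _ (tr pC G (v + e) (w + e) \oh m v) = rI _ _ (tr pC I v w).
  by move=> vw; rewrite -mI // /rI (rk_comp_split_mono sys c_inv _ (rm w)).
have rkIq v w : v <= w -> rI _ _ (q w \oh tr pC F v w) = rI _ _ (tr pC I v w).
  by move=> vw; rewrite -qI // /rI (rk_comp_split_epi sys c_inv _ (qs v)).
(* [chi] and [om] appear when [phi] is factored as [m \oh q] in the interleaving identities: [chi]
   after [q] is the transition of [F] by [e + e], and [m] after [om] that of [G]. *)
pose chi t : Hom (I t) (F (t + e + e)) := (psi (t + e) : Hom _ _) \oh m t.
have chiq t : chi t \oh q t = tr pC F t (t + e + e).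
  by rewrite /chi -hcompA -mq psiphi.
have rkchi v w : v <= w -> rI _ _ (chi w \oh tr pC I v w) = rI _ _ (tr pC F v (w + e + e)).
  move=> vw; rewrite /rI -(rk_comp_split_epi sys c_inv _ (qs v)) -hcompA qI //.
  by rewrite hcompA chiq trM.
pose om t : Hom (G t) (I (t + e)) := q (t + e) \oh (psi t : Hom _ _).
have mom t : m (t + e) \oh om t = tr pC G t (t + e + e).
  by rewrite /om hcompA -mq phipsi'.
have rkom u t : u + e <= t -> rI _ _ (tr pC I (u + e) t \oh om u) = rI _ _ (tr pC G u (t + e)).
  move=> ut; rewrite /rI -(rk_comp_split_mono sys c_inv _ (rm t)) hcompA mI //.
  by rewrite -hcompA mom trM // lerD2r.
have nF := rk_barcode sys bF c_inv; have nG := rk_barcode sys bG c_inv.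
have nI := rk_barcode sys bI c_inv.
have endF := bar_has_ends bF; have endG := bar_has_ends bG; have endI := bar_has_ends bI.
have d0 : 0 <= e + e by rewrite addr_ge0.
have [||||m1 [m1P m1f m1g m1t m1u]] := half_matching (PJ := fun j : bF => c (bar_obj j))
    (PK := fun k : bI => c (bar_obj k)) endF endI d0.
- move=> u u' t uu' u't; have ut := le_trans uu' u't; rewrite -!nI // -!nF //.
  have := frobenius sys c_inv (q t) (tr pC F u' t) (tr pC F u u').
  by rewrite -hcompA !trM // -!/(rI _ _ _) !rkIq.
- move=> u t ut; rewrite -nI // -nF //.
  have := rk_comp_le_r sys c_inv (q t) (tr pC F u t).
  by rewrite -!/(rI _ _ _) !rkIq.
- move=> u u' t uu' u't; have ut := le_trans uu' u't.
  have tE : t <= t + e + e := le_e t.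
  rewrite !addrA -!nI // -!nF ?(le_trans _ tE) //.
  have := frobenius sys c_inv (chi t) (tr pC I u' t) (tr pC I u u').
  by rewrite -hcompA !trM // -!/(rI _ _ _) !rkchi.
- move=> u t ut; rewrite !addrA -nI // -nF ?(le_trans ut) //.
  have := rk_comp_le_r sys c_inv (chi t) (tr pC I u t).
  by rewrite -!/(rI _ _ _) !rkchi.
(* Reversing time exchanges births and deaths, so that the inclusion of [I] in
   the shift of [G] is handled by [half_matching] too. *)
pose aG (g : bG) t := bar_alive g (e - t); pose aI (k : bI) t := bar_alive k (- t).
have endG' : has_ends aG (fun g => e%:E - hiG g)%E (fun g => e%:E - loG g)%E.
  split=> g t; first by move=> /endG.1[? ?]; rewrite lee_flipl lee_flipr.
  by rewrite !ltNge lee_flipl lee_flipr -!ltNge => ? ?; exact: endG.2.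
have endI' : has_ends aI (fun k => - bar_hi (@bar_alive R C pC Simp I bI) k)%E
    (fun k => - bar_lo (@bar_alive R C pC Simp I bI) k)%E.
  split=> k t; first by move=> /endI.1[? ?]; rewrite leeNl leeNr -EFinN.
  by rewrite lteNl lteNr -EFinN => ? ?; exact: endI.2.
have nI' u t : u <= t -> nbars (fun k : bI => c (bar_obj k)) aI u t = rI _ _ (tr pC I (- t) (- u)).
  move=> ut; rewrite /rI nI ?lerN2 //; apply: eq_card => k; rewrite !inE.
  by rewrite /aI; congr (_ && _); exact: andbC.
have nG' u t : u <= t -> nbars (fun k : bG => c (bar_obj k)) aG u t =
    rI _ _ (tr pC G (e - t) (e - u)).
  move=> ut; rewrite /rI nG ?lerD2l ?lerN2 //; apply: eq_card => k; rewrite !inE.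
  by rewrite /aG; congr (_ && _); exact: andbC.
have [||||m2 [m2P m2f m2g m2t m2u]] := half_matching (PJ := fun j : bG => c (bar_obj j))
    (PK := fun k : bI => c (bar_obj k)) endG' endI' d0.
- move=> u u' t uu' u't; have ut := le_trans uu' u't.
  have NtN : - t <= - u' by rewrite lerN2.
  have NuN : - u' <= - u by rewrite lerN2.
  have NtuN := le_trans NtN NuN.
  rewrite !nI' // !nG' // ![e - _]addrC.
  have := frobenius sys c_inv (tr pC G (- u' + e) (- u + e))
    (tr pC G (- t + e) (- u' + e)) (m (- t)).
  rewrite !trM ?lerD2r // -!/(rI _ _ _) !rkIm //.
  by rewrite [X in (X <= _)%N]addnC.
- move=> u t ut; have NtN : - t <= - u by rewrite lerN2.
  rewrite nI' // nG' // ![e - _]addrC.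
  have := rk_comp_le_l sys c_inv (tr pC G (- t + e) (- u + e)) (m (- t)).
  by rewrite -!/(rI _ _ _) rkIm.
- move=> u u' t uu' u't; have ut := le_trans uu' u't.
  (* The time [t + (e + e)] of the reversed [G] is the time [v] of [G], and [om v] leads from there
     to [I] at [v + e = - t]. *)
  pose v := e - (t + (e + e)).
  have vE : - t = v + e by rewrite /v !opprD !addrA subrK addrAC subrr add0r.
  have NtN : - t <= - u' by rewrite lerN2.
  have NuN : - u' <= - u by rewrite lerN2.
  have NtuN := le_trans NtN NuN.
  have tt : t <= t + (e + e) by rewrite lerDl.
  rewrite !nI' // !nG' ?(le_trans _ tt) // -/v ![e - _]addrC.
  rewrite vE in NtN NtuN *.
  have := frobenius sys c_inv (tr pC I (- u') (- u)) (tr pC I (v + e) (- u')) (om v).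
  rewrite !trM // -!/(rI _ _ _) !rkom // [X in (X <= _)%N]addnC.
  by [].
- move=> u t ut; pose v := e - (t + (e + e)).
  have vE : - t = v + e by rewrite /v !opprD !addrA subrK addrAC subrr add0r.
  have NtN : - t <= - u by rewrite lerN2.
  have tt : t <= t + (e + e) by rewrite lerDl.
  rewrite nI' // nG' ?(le_trans _ tt) // -/v ![e - _]addrC; rewrite vE in NtN *.
  have := rk_comp_le_l sys c_inv (tr pC I (v + e) (- u)) (om v).
  by rewrite -!/(rI _ _ _) rkom.
(* The two matchings are composed through the bars of [I]. Those of color [c] with distinct
   endpoints are matched on both sides, so a bar left out by the composite is already left out by
   [m1] or [m2]. *)
exists (fun j g => `[< exists k, m1 k j /\ m2 k g >]); split.
- move=> j g /asboolP[k [/m1P[[ck kp] jp lE h1 h2] /m2P[_ [cg gp] hE l1 l2]]].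
  split; first exact: jp.
  - by split=> //; exact: flip_lt gp.
  - by rewrite -lE; exact: close_flip l1 l2.
  - by apply: close_shift h1 h2; exact: flip_eq hE.
- move=> j g g' /asboolP[k [kj kg]] /asboolP[k' [kj' kg']].
  by rewrite (m1g _ _ _ kj kj') in kg; exact: m2f kg kg'.
- move=> j j' g /asboolP[k [kj kg]] /asboolP[k' [kj' kg']].
  by rewrite (m2g _ _ _ kg kg') in kj; exact: m1f kj kj'.
- move=> j cj jp jN; apply: m1u => // k; apply/negP => kj.
  have [[ck kp] _ _ _ _] := m1P _ _ kj.
  have [|g kg] := m2t k ck; first by rewrite lteN2.
  by case/asboolP: (jN g); exists k.
- move=> g cg gp gN; apply: close_short; apply: m2u => //; first exact: lt_flip gp.
  move=> k; apply/negP => kg; have [[ck kp] _ _ _ _] := m2P _ _ kg.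
  have [|j kj] := m1t k ck; first by rewrite lteN2 in kp.
  by case/asboolP: (gN j); exists k.
Qed.
End Stability.

(** * Bijections of diagrams *)

Section Gluing.
Variables (T T' L : Type).

Lemma inj_surj_bijective (f : T -> T') :
  injective f -> (forall y, exists x, f x = y) -> bijective f.
Proof.
move=> fi fs; have [g gE] := choice fs.
by exists g => x; [apply: fi; rewrite gE|rewrite gE].
Qed.

Definition unmatched_left (M : T -> T' -> Prop) q := forall q', ~ M q q'.
Definition unmatched_right (M : T -> T' -> Prop) q' := forall q, ~ M q q'.

(** The partial matching is kept, and the leftovers are paired within each label. With color and
    midpoint as label, the extension preserves colors and moves the leftovers little. *)
Lemma glue_matching (M : T -> T' -> Prop) (lab : T -> L) (lab' : T' -> L) :
  (forall q q1 q2, M q q1 -> M q q2 -> q1 = q2) ->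
  (forall q1 q2 q, M q1 q -> M q2 q -> q1 = q2) ->
  (forall l, ([set q | unmatched_left M q /\ lab q = l] #=
             [set q | unmatched_right M q /\ lab' q = l])%card) ->
  exists beta : T -> T', bijective beta /\ forall q,
    M q (beta q) \/
    [/\ unmatched_left M q, unmatched_right M (beta q) & lab q = lab' (beta q)].
Proof.
move=> Mf Mi Mcard.
have fP l : exists f : T -> option T', [/\
    forall q, unmatched_left M q -> lab q = l ->
      exists q', [/\ f q = Some q', unmatched_right M q' & lab' q' = l],
    forall q1 q2, unmatched_left M q1 -> lab q1 = l -> unmatched_left M q2 -> lab q2 = l ->
      f q1 = f q2 -> q1 = q2
    & forall q', unmatched_right M q' -> lab' q' = l ->
      exists q, [/\ unmatched_left M q, lab q = l & f q = Some q']].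
  have /card_bijP[f [g fK gK]] := Mcard l.
  exists (fun q => if pselect (unmatched_left M q /\ lab q = l) is left h
    then Some (val (f (SigSub (mem_set h)))) else None); split.
  - move=> q qM ql; case: pselect => [h|[]//].
    by have [fM fl] := set_valP (f (SigSub (mem_set h))); exists (val (f (SigSub (mem_set h)))).
  - move=> q1 q2 q1M q1l q2M q2l; case: pselect => [h1|[]//]; case: pselect => [h2|[]//].
    move=> [] /val_inj /(can_inj fK) h12.
    by have := congr1 val h12.
  - move=> q' q'M q'l; pose q0 := g (SigSub (mem_set (conj q'M q'l))).
    have [qM ql] := set_valP q0; exists (val q0); split=> //; case: pselect => [h|[]//].
    have -> : SigSub (mem_set h) = q0 by apply: val_inj.
    by rewrite gK.
have [f {}fP] := choice fP.
have bP q : exists q', M q q' \/ unmatched_left M q /\ f (lab q) q = Some q'.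
  have [[q' qq']|qN] := pselect (exists q', M q q'); first by exists q'; left.
  have qM : unmatched_left M q by move=> q' qq'; apply: qN; exists q'.
  have [H1 _ _] := fP (lab q); have [q' [fq _ _]] := H1 q qM erefl.
  by exists q'; right.
have [beta betaP] := choice bP.
have betaU q : unmatched_left M q ->
    [/\ f (lab q) q = Some (beta q), unmatched_right M (beta q) & lab' (beta q) = lab q].
  move=> qM; case: (betaP q) => [/qM//|[_ fq]].
  have [H1 _ _] := fP (lab q); have [q' [fq' qM' lq']] := H1 q qM erefl.
  by move: fq'; rewrite fq => -[->].
exists beta; split; last first.
  move=> q; case: (betaP q) => [|[qM _]]; first by left.
  by right; have [_ ? ->] := betaU _ qM.
apply: inj_surj_bijective => [q1 q2 b12|q'].
  case: (betaP q1) => [M1|[U1 _]]; case: (betaP q2) => [M2|[U2 _]].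
  - by apply: (Mi _ _ _ M1); rewrite b12.
  - by have [_ /(_ q1) []] := betaU _ U2; rewrite -b12.
  - by have [_ /(_ q2) []] := betaU _ U1; rewrite b12.
  - have [f1 _ l1] := betaU _ U1; have [f2 _ l2] := betaU _ U2.
    have l12 : lab q2 = lab q1 by rewrite -l1 -l2 b12.
    have [_ H2 _] := fP (lab q1); apply: H2 => //.
    by rewrite f1 b12 -f2 l12.
have [[q qq']|qN] := pselect (exists q, M q q').
  exists q; case: (betaP q) => [qb|[/(_ q')//]]; exact: Mf qb qq'.
have q'M : unmatched_right M q' by move=> q qq'; apply: qN; exists q.
have [_ _ H3] := fP (lab' q'); have [q [qM ql fq]] := H3 q' q'M erefl.
exists q; have [fq' _ _] := betaU _ qM.
by move: fq'; rewrite ql fq => -[].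
Qed.

End Gluing.

Lemma countable_infinite_card (T T' : Type) (A : set T) (B : set T') :
  countable A -> infinite_set A -> countable B -> infinite_set B -> (A #= B)%card.
Proof.
move=> cA /infiniteP iA cB /infiniteP iB.
have AN : (A #= [set: nat])%card by rewrite card_eqPle; split.
have BN : (B #= [set: nat])%card by rewrite card_eqPle; split.
by apply: card_eq_trans AN _; rewrite card_eq_sym.
Qed.

Section CoordDist.
Variable R : realType.
Local Open Scope ereal_scope.

Lemma coord_dist_close (e : R) (x y : \bar R) : (0 <= e)%R ->
  coord_dist x y <= e%:E -> eclose e x y.
Proof.
move=> e0; rewrite /coord_dist; case: eqVneq => [-> _|_].
  by split; rewrite leeDl // lee_fin.
case: x => [x||]; case: y => [y||] //; rewrite /eclose ?leey ?leNye //.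
by rewrite /= !lee_fin ler_norml => /andP[? ?]; split; lra.
Qed.

Lemma close_coord_dist (e : R) (x y : \bar R) : (0 <= e)%R ->
  eclose e x y -> coord_dist x y <= e%:E.
Proof.
move=> e0; rewrite /coord_dist; case: eqVneq => [_ _|]; first by rewrite lee_fin.
case: x => [x||]; case: y => [y||] // _; rewrite /eclose //=; try by case.
by rewrite !lee_fin ler_norml => -[? ?]; apply/andP; split; lra.
Qed.

Lemma close_mid (e : R) (x y : \bar R) : x < y -> y <= x + (e + e)%:E ->
  exists m h, [/\ x = (m - h)%:E, y = (m + h)%:E, (0 <= h)%R & (h <= e)%R].
Proof.
case: x => [x||]; case: y => [y||] //; rewrite ?lte_fin /= => xy.
rewrite lee_fin => yx; exists ((x + y) / 2)%R, ((y - x) / 2)%R.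
by split; [congr EFin; lra|congr EFin; lra|lra|lra].
Qed.

Lemma close_lt (c e t : R) (x y : \bar R) : (c < e)%R ->
  y <= t%:E -> x <= y + c%:E -> x < (t + e)%:E.
Proof.
move=> ce yt /le_lt_trans; apply; apply: (@le_lt_trans _ _ (t + c)%:E).
  by rewrite EFinD leeD2r.
by rewrite lte_fin ltrD2l.
Qed.

Lemma close_gt (c e t : R) (x y : \bar R) : (c < e)%R ->
  (t + e)%:E <= y -> y <= x + c%:E -> t%:E < x.
Proof.
move=> ce te yx; have := le_trans te yx; case: x {yx} => [x||] //; last by rewrite ltry.
by rewrite !lee_fin lte_fin; lra.
Qed.

Lemma close_between (e : R) (x y z : \bar R) :
  eclose e x z -> eclose e y z -> y <= x + (e + e)%:E.
Proof.
by move=> [_ zx] [yz _]; rewrite EFinD addeA (le_trans yz) // leeD2r.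
Qed.

End CoordDist.

(** * Cornerpoints as bars, and the two inequalities between the distances *)

Section Tight.
Variables (R : realType) (C : category) (abC : abelian C) (ssC : semisimple C).
Variables (Gamma : set C) (maxGamma : maximal_simples Gamma).
Variable K : isotypic_decomposition Gamma.
Let pC : preadditive C := abC.
Let sys : simple_system pC (@is_simple C) := abelian_system abC ssC.
Local Notation Hom := (hmor pC).
Local Notation functorR := (functor (real_line R) C).
Local Notation bars F := (barcode pC (@is_simple C) F).
Local Notation alive b := (@bar_alive R C pC (@is_simple C) _ b).
Local Notation lo b := (bar_lo (alive b)).
Local Notation hi b := (bar_hi (alive b)).
Local Notation mu F := (fun S : Gamma =>
  multiplicity (@length (isotypic (set_val S))) (functor_comp (K S) F)).
Local Notation dgm F := {S : Gamma & diagram (mu F S)}.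

Lemma pers_component (F : functorR) (b : bars F) (S : Gamma) (s t : R) : s <= t ->
  pers (@length (isotypic (set_val S))) (functor_comp (K S) F) s t =
  bar_count (fun j => has_color S (bar_obj j)) (fun j => alive b j s && alive b j t).
Proof.
move=> st; have sysS := isotypic_system abC ssC (color_simple maxGamma S).
rewrite (pers_rk sysS (functor_comp (K S) F) st) bar_countE; congr Posz.
rewrite -[RHS](rk_barcode sys b (has_color_inv S) st).
rewrite -(rk_component ssC maxGamma K S (tr pC F s t)).
by rewrite (trE _ (functor_comp (K S) F) st) (trE pC F st).
Qed.

Lemma multiplicity_component (F : functorR) (b : bars F) (S : Gamma) u v : (u < v)%E ->
  mu F S u v =
  (#|[pred j | has_color S (bar_obj j) & (lo b j == u) && (hi b j == v)]|)%:Z.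
Proof.
move=> uv; apply: multiplicityE => //; first exact: bar_convex.
by move=> s t; exact: pers_component.
Qed.

Definition dgm_index (F : functorR) (q : dgm F) : nat :=
  match projT2 q with inl c => (sval c).2 | inr d => d.2 end.

Lemma dgm_bars (F : functorR) (b : bars F) : exists rep : b -> dgm F,
  [/\ forall j, (lo b j < hi b j)%E ->
        dgm_point (projT2 (rep j)) = (lo b j, hi b j) /\
        has_color (projT1 (rep j)) (bar_obj j),
      forall j j', (lo b j < hi b j)%E -> (lo b j' < hi b j')%E -> rep j = rep j' -> j = j'
    & forall q : dgm F, (exists2 j, (lo b j < hi b j)%E & rep j = q) \/
        exists S r k, q = existT _ S (inr (r, k))].
Proof.
have [col colE] := color_fun maxGamma (@bar_simple _ _ _ _ _ b).
have colP j : has_color (col j) (bar_obj j) by rewrite colE.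
pose same (S : Gamma) (p : \bar R * \bar R) :=
  [pred j : b | has_color S (bar_obj j) & (lo b j == p.1) && (hi b j == p.2)].
(* The position of [j] among the bars with its color and endpoints serves as the copy number of its
   cornerpoint. *)
pose idx j := index j (enum (same (col j) (lo b j, hi b j))).
have jsame j : j \in enum (same (col j) (lo b j, hi b j)).
  by rewrite mem_enum !inE colP !eqxx.
(* A bar without [lo < hi] has no cornerpoint; an arbitrary diagonal point is its default image. *)
have repP j : exists q : dgm F, (lo b j < hi b j)%E ->
    exists c, q = existT _ (col j) (inl c) /\ sval c = (lo b j, hi b j, idx j).
  have [jp|] := boolP (lo b j < hi b j)%E; last by exists (existT _ (col j) (inr (0, 0%N))).
  have H : ((lo b j, hi b j, idx j).1.1 < (lo b j, hi b j, idx j).1.2)%E &&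
      ((lo b j, hi b j, idx j).2%:Z <
       mu F (col j) (lo b j, hi b j, idx j).1.1 (lo b j, hi b j, idx j).1.2).
    by rewrite jp /= (multiplicity_component b) // ltz_nat cardE index_mem jsame.
  exists (existT (fun S => diagram (mu F S)) (col j)
    (inl (exist _ (lo b j, hi b j, idx j) H))) => _.
  by exists (exist _ (lo b j, hi b j, idx j) H).
have [rep {}repP] := choice repP; exists rep; split.
- by move=> j /repP[c [-> /= ->]].
- move=> j j' /repP[c [rE cE]] /repP[c' [rE' cE']] rr.
  have cc : col j = col j' by have := congr1 (@projT1 _ _) rr; rewrite rE rE'.
  have pp : (lo b j, hi b j) = (lo b j', hi b j').
    have := congr1 (fun q : dgm F => dgm_point (projT2 q)) rr.
    by rewrite rE rE' /= cE cE'.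
  have := congr1 (@dgm_index F) rr; rewrite rE rE' /dgm_index /= cE cE' /= /idx cc pp => ii.
  have jj := jsame j; rewrite cc pp in jj.
  by rewrite -(nth_index j jj) ii nth_index.
- case=> S [[[[u v] i] H]|[r k]]; last by right; exists S, r, k.
  left; have /andP[/= uv iN] := H.
  have {}iN : (i < size (enum (same S (u, v))))%N.
    by move: iN; rewrite (multiplicity_component b) // ltz_nat cardE.
  have [j0 _] : exists j0, j0 \in enum (same S (u, v)).
    by case: (enum _) iN => [|j0 l] // _; exists j0; exact: mem_head.
  pose j := nth j0 (enum (same S (u, v))) i.
  have : j \in enum (same S (u, v)) by exact: mem_nth.
  rewrite mem_enum !inE /= => /andP[jS /andP[/eqP ju /eqP jv]].
  have jp : (lo b j < hi b j)%E by rewrite ju jv.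
  exists j => //; have [c [-> cE]] := repP j jp.
  have colj : col j = S by move: jS; rewrite colE => /eqP ->.
  have ij : idx j = i by rewrite /idx colj ju jv index_uniq // enum_uniq.
  move: c cE; rewrite ju jv ij colj => c cE.
  by have -> : c = exist _ (u, v, i) H by exact: val_inj.
Qed.

(** For infinite coordinates [fine] returns a default, but labels are compared only on unmatched
    points, which are close to the diagonal and hence finite. *)
Definition dgm_label (F : functorR) (q : dgm F) : Gamma * R :=
  (projT1 q, (fine (dgm_point (projT2 q)).1 + fine (dgm_point (projT2 q)).2) / 2).

Lemma dgm_label_diag (F : functorR) S r k :
  dgm_label (F := F) (existT _ S (inr (r, k))) = (S, r).
Proof. by rewrite /dgm_label /=; congr pair; lra. Qed.

(* The points close to the diagonal are grouped in countably infinite fibers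
   over their color and their orthogonal projection to the diagonal. *)
Lemma short_dgm (F : functorR) (b : bars F) (rep : b -> dgm F) (e : R)
    (U : dgm F -> Prop) : 0 <= e ->
  (forall j, (lo b j < hi b j)%E -> dgm_point (projT2 (rep j)) = (lo b j, hi b j)) ->
  (forall q : dgm F, (exists2 j, (lo b j < hi b j)%E & rep j = q) \/
     exists S r k, q = existT _ S (inr (r, k))) ->
  (forall S r k, U (existT _ S (inr (r, k)))) ->
  (forall j, (lo b j < hi b j)%E -> U (rep j) -> (hi b j <= lo b j + (e + e)%:E)%E) ->
  (forall q, U q -> exists m h,
     [/\ dgm_point (projT2 q) = ((m - h)%:E, (m + h)%:E), 0 <= h, h <= e
       & (dgm_label q).2 = m]) /\
  (forall l, countable [set q | U q /\ dgm_label q = l] /\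
     infinite_set [set q | U q /\ dgm_label q = l]).
Proof.
move=> e0 repP repS Udiag Ushort; split.
  move=> q; case: (repS q) => [[j jp <-] Uj|[S [r [k ->]]] _]; last first.
    exists r, 0; split=> //; first by rewrite addr0 subr0.
    by rewrite dgm_label_diag.
  have [m [h [lE hE h0 he]]] := close_mid jp (Ushort j jp Uj).
  exists m, h; split=> //; first by rewrite repP // lE hE.
  by rewrite /dgm_label repP // lE hE /=; lra.
move=> [S r]; pose f (k : nat) : dgm F := existT (fun S => diagram (mu F S)) S (inr (r, k)).
split.
  (* Besides the copies of one diagonal point, a fiber contains only cornerpoints of the finitely
     many bars. *)
  pose g (x : nat + b) : dgm F := match x with inl k => f k | inr j => rep j end.
  have : countable (g @` [set: nat + b]).
    exact: card_le_trans (card_image_le _ _) (countableP _).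
  apply: sub_countable; apply: subset_card_le => q [Uq lq].
  case: (repS q) => [[j jp jq]|[S' [r' [k qE]]]]; first by exists (inr j).
  by exists (inl k) => //; move: lq; rewrite qE dgm_label_diag => -[-> ->].
apply/infiniteP; apply: card_le_trans (_ : (f @` [set: nat] #<= _)%card).
  have fi : {in [set: nat] &, injective f}.
    by move=> k k' _ _ /(congr1 (@dgm_index F)).
  by have := inj_card_eq fi; rewrite card_eqPle => -[].
by apply: subset_card_le => _ [k _ <-]; split; [exact: Udiag|rewrite dgm_label_diag].
Qed.

Section Distances.
Variables (F G : functorR) (bF : bars F) (bG : bars G).

Lemma bottleneck_le (xsF xsG : seq R) (e : R) :
  iso_off pC F xsF -> iso_off pC G xsG -> 0 <= e -> interleaved e F G ->
  (bottleneck_distance (mu F) (mu G) <= e%:E)%E.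
Proof.
move=> isoF isoG e0 FG.
have [mt mtP] := choice (fun S : Gamma =>
  stability_matching sys bF bG isoF isoG (has_color_inv S) e0 FG).
have [rF [rF1 rF2 rF3]] := dgm_bars bF; have [rG [rG1 rG2 rG3]] := dgm_bars bG.
pose M (q : dgm F) (q' : dgm G) := exists S j k, [/\ mt S j k, rF j = q & rG k = q'].
have mtF S j k : mt S j k -> [/\ has_color S (bar_obj j), (lo bF j < hi bF j)%E
    & projT1 (rF j) = S].
  have [H _ _ _ _] := mtP S => /H[[jS jp] _ _ _]; split=> //.
  exact: (color_uniq maxGamma (rF1 j jp).2 jS).
have mtG S j k : mt S j k -> [/\ has_color S (bar_obj k), (lo bG k < hi bG k)%E
    & projT1 (rG k) = S].
  have [H _ _ _ _] := mtP S => /H[_ [jS jp] _ _]; split=> //.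
  exact: (color_uniq maxGamma (rG1 k jp).2 jS).
have Mf q q1 q2 : M q q1 -> M q q2 -> q1 = q2.
  move=> [S [j [k [jk <- <-]]]] [S' [j' [k' [jk' jj <-]]]].
  have [jS jp _] := mtF _ _ _ jk; have [jS' jp' _] := mtF _ _ _ jk'.
  have jjE : j' = j by exact: rF2.
  subst j'; have SE := color_uniq maxGamma jS jS'; subst S'.
  by have [_ H _ _ _] := mtP S; rewrite (H _ _ _ jk jk').
have Mi q1 q2 q : M q1 q -> M q2 q -> q1 = q2.
  move=> [S [j [k [jk <- <-]]]] [S' [j' [k' [jk' <- kk]]]].
  have [jS jp _] := mtG _ _ _ jk; have [jS' jp' _] := mtG _ _ _ jk'.
  have kkE : k' = k by exact: rG2.
  subst k'; have SE := color_uniq maxGamma jS jS'; subst S'.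
  by have [_ _ H _ _] := mtP S; rewrite (H _ _ _ jk jk').
have [||UF1 UF2] := @short_dgm F bF rF e (unmatched_left M) e0 (fun j jp => (rF1 j jp).1) rF3.
- move=> S r k q' [S' [j [k' [jk jE _]]]]; have [_ jp _] := mtF _ _ _ jk.
  have := (rF1 j jp).1; rewrite jE /= => -[lE hE].
  by rewrite -lE -hE ltxx in jp.
- move=> j jp jM; have jS := (rF1 j jp).2; have [_ _ _ H _] := mtP (projT1 (rF j)).
  by apply: H => // k; apply/negP => jk; apply: (jM (rG k)); exists (projT1 (rF j)), j, k.
have [||UG1 UG2] := @short_dgm G bG rG e (unmatched_right M) e0 (fun j jp => (rG1 j jp).1) rG3.
- move=> S r k q' [S' [j [k' [jk _ kE]]]]; have [_ kp _] := mtG _ _ _ jk.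
  have := (rG1 k' kp).1; rewrite kE /= => -[lE hE].
  by rewrite -lE -hE ltxx in kp.
- move=> k kp kM; have kS := (rG1 k kp).2; have [_ _ _ _ H] := mtP (projT1 (rG k)).
  by apply: H => // j; apply/negP => jk; apply: (kM (rF j)); exists (projT1 (rG k)), j, k.
have [beta [betaB betaP]] := @glue_matching (dgm F) (dgm G) (Gamma * R)%type M
  (@dgm_label F) (@dgm_label G) Mf Mi
  (fun l => countable_infinite_card (UF2 l).1 (UF2 l).2 (UG2 l).1 (UG2 l).2).
apply: ge_ereal_inf; exists (ereal_sup (0%E |`
       [set dgm_point_dist (dgm_point (projT2 q)) (dgm_point (projT2 (beta q)))
          | q in [set: dgm F]])).
  exists beta => //; split=> // q; case: (betaP q) => [[S [j [k [jk <- <-]]]]|[_ _ lE]].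
    by have [_ _ ->] := mtF _ _ _ jk; have [_ _ ->] := mtG _ _ _ jk.
  by have := congr1 fst lE.
apply: ge_ereal_sup => _ [->|[q _ <-]]; first by rewrite lee_fin.
rewrite /dgm_point_dist ge_max; case: (betaP q) => [[S [j [k [jk <- <-]]]]|[qM qM' lE]].
  have [_ jp _] := mtF _ _ _ jk; have [_ kp _] := mtG _ _ _ jk.
  have [H _ _ _ _] := mtP S; have [_ _ c1 c2] := H _ _ jk.
  by rewrite (rF1 j jp).1 (rG1 k kp).1 !close_coord_dist.
(* Equal labels mean a common midpoint, so both coordinates differ by [h - h'] up to sign, at most
   [e] in absolute value. *)
have [m [h [-> h0 he mE]]] := UF1 _ qM; have [m' [h' [-> h0' he' mE']]] := UG1 _ qM'.
have {mE mE'} mm : m' = m by rewrite -mE -mE' lE.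
subst m'; apply/andP; split; apply: close_coord_dist => //;
  by split; rewrite /= lee_fin; lra.
Qed.

(** The hypothesis [c < e] turns weak bounds at the endpoints of bars into strict ones, and a time
    strictly between the endpoints of a bar is one at which it is alive. *)
Lemma interleaving_le (beta : dgm F -> dgm G) (c e : R) : 0 <= c -> c < e ->
  bijective beta -> (forall q : dgm F, projT1 (beta q) = projT1 q) ->
  (forall q : dgm F, (dgm_point_dist (dgm_point (projT2 q))
     (dgm_point (projT2 (beta q))) <= c%:E)%E) ->
  interleaved e F G.
Proof.
move=> c0 ce [beta' betaK betaK'] betaC betaD.
have [rF [rF1 rF2 rF3]] := dgm_bars bF; have [rG [rG1 rG2 rG3]] := dgm_bars bG.
have e0 : 0 <= e by lra.
pose mt j k := `[< [/\ (lo bF j < hi bF j)%E, (lo bG k < hi bG k)%E & beta (rF j) = rG k] >].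
have endF := bar_has_ends bF; have endG := bar_has_ends bG.
have mt_close j k : mt j k -> eclose c (lo bF j) (lo bG k) /\ eclose c (hi bF j) (hi bG k).
  move=> /asboolP[jp kp jk]; have := betaD (rF j).
  rewrite jk (rF1 j jp).1 (rG1 k kp).1 /dgm_point_dist ge_max /= => /andP[].
  by move=> /(coord_dist_close c0) ? /(coord_dist_close c0) ?.
have aux (F1 G1 : functorR) (b1 : bars F1) (b2 : bars G1) j k s t :
    (eclose c (lo b1 j) (lo b2 k)) -> (eclose c (hi b1 j) (hi b2 k)) ->
    alive b1 j s -> s <= t -> alive b2 k (t + e) -> alive b1 j t /\ alive b2 k (s + e).
  move=> [_ lc] [_ hc] js st kt; split.
    have /ereal_sup_gt[_ [u ju <-]] := close_gt ce (bar_hi_ge kt) hc.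
    by rewrite lte_fin => /ltW tu; apply: bar_convex st tu js ju.
  have /ereal_inf_lt[_ [u ku <-]] := close_lt ce (bar_lo_le js) lc.
  rewrite lte_fin => /ltW us; have ste : s + e <= t + e by rewrite lerD2r.
  exact: bar_convex us ste ku kt.
have aux2 (F1 G1 : functorR) (b1 : bars F1) (b2 : bars G1) j k t :
    (eclose c (lo b1 j) (lo b2 k)) -> (eclose c (hi b1 j) (hi b2 k)) ->
    alive b1 j t -> alive b1 j (t + e + e) -> alive b2 k (t + e).
  move=> [_ lc] [hc _] jt jt'; apply: bar_between.
  - by move=> *; apply: bar_convex; eassumption.
  - exact: close_lt ce (bar_lo_le jt) lc.
  - exact: close_gt ce (bar_hi_ge jt') hc.
have aux3 (F1 : functorR) (b1 : bars F1) j t : (hi b1 j <= lo b1 j + (c + c)%:E)%E ->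
    alive b1 j t -> ~~ alive b1 j (t + e + e).
  move=> hl jt; apply/negP => jt'.
  have := le_trans (bar_hi_ge jt') (le_trans hl (leeD2r (c + c)%:E (bar_lo_le jt))).
  by rewrite lee_fin; lra.
have sym x y : eclose c x y -> eclose c y x by case.
apply: (@match_interleaved R C pC (@is_simple C) F G bF bG e mt) => //.
- by move=> j k k' /asboolP[jp kp jk] /asboolP[_ kp' jk']; apply: rG2 => //; rewrite -jk.
- move=> j j' k /asboolP[jp kp jk] /asboolP[jp' _ jk']; apply: rF2 => //.
  by apply: (can_inj betaK); rewrite jk.
- move=> j k /asboolP[jp kp jk]; have jS := (rF1 j jp).2; have := (rG1 k kp).2.
  rewrite -jk betaC => /asboolP kS; move/asboolP: jS => jS.
  exact: isomorphic_trans jS (isomorphic_sym kS).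
- by move=> j k s t /mt_close[lc hc]; apply: aux.
- by move=> j k s t /mt_close[lc hc]; apply: aux; exact: sym.
- by move=> j k t /mt_close[lc hc]; apply: aux2.
- by move=> j k t /mt_close[lc hc]; apply: aux2; exact: sym.
(* A bar is unmatched either because [lo < hi] fails, or because [beta] sends its cornerpoint to the
   diagonal; in both cases its length is at most [c + c]. *)
- move=> j t jN jt; have [jp|/negP jp] := boolP (lo bF j < hi bF j)%E; last first.
    apply: (aux3 _ bF) => //.
    by rewrite (le_trans _ (leeDl _ _)) ?lee_fin ?addr_ge0 // leNgt; exact/negP.
  apply: (aux3 _ bF) => //.
  case: (rG3 (beta (rF j))) => [[k kp jk]|[S [r [k jk]]]].
    by case/asboolP: (jN k).
  have := betaD (rF j); rewrite jk (rF1 j jp).1 /dgm_point_dist ge_max /= => /andP[l h].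
  exact: close_between (coord_dist_close c0 l) (coord_dist_close c0 h).
- move=> k t kN kt; have [kp|/negP kp] := boolP (lo bG k < hi bG k)%E; last first.
    apply: (aux3 _ bG) => //.
    by rewrite (le_trans _ (leeDl _ _)) ?lee_fin ?addr_ge0 // leNgt; exact/negP.
  apply: (aux3 _ bG) => //; have qE := betaK' (rG k).
  case: (rF3 (beta' (rG k))) => [[j jp jk]|[S [r [i ji]]]].
    by case/asboolP: (kN j); split=> //; rewrite jk qE.
  have := betaD (beta' (rG k)); rewrite qE ji (rG1 k kp).1 /dgm_point_dist ge_max /= => /andP[l h].
  by apply: close_between (sym _ _ (coord_dist_close c0 l)) (sym _ _ (coord_dist_close c0 h)).
Qed.

End Distances.
End Tight.

Theorem theorem5 (R : realType) (C : category) (abC : abelian C)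
    (ssC : semisimple C) (Gamma : set C) (maxGamma : maximal_simples Gamma) :
  inhabited (isotypic_decomposition Gamma) /\
  forall K : isotypic_decomposition Gamma,
    tight_coloring R (@length C)
      (fun S : Gamma => @length (isotypic (set_val S))) K.
Proof.
split; first by exact: (decomposition_exists abC ssC maxGamma).
move=> K; split; first by exact: (components_coloring abC ssC maxGamma K).
move=> F G tF tG; have sys := abelian_system abC ssC.
have [xsF isoF] := tame_iso_off sys tF; have [xsG isoG] := tame_iso_off sys tG.
have [bF] := barcode_exists sys isoF; have [bG] := barcode_exists sys isoG.
apply/eqP; rewrite eq_le; apply/andP; split.
  apply: le_ereal_inf_tmp => _ [beta [betaB betaC] <-].
  set s := ereal_sup _.
  have s0 : (0 <= s)%E by apply: ereal_sup_ubound; left.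
  have sD (q : {S : Gamma & diagram
      (multiplicity (@length (isotypic (set_val S))) (functor_comp (K S) F))}) :
      (dgm_point_dist (dgm_point (projT2 q)) (dgm_point (projT2 (beta q))) <= s)%E.
    by apply: ereal_sup_ubound; right; exists q.
  case: s s0 sD => [c||] // c0 sD; last by rewrite leey.
  (* Every [c + d] with [d > 0] admits an interleaving, although [c] itself may not. *)
  apply/lee_addgt0Pr => d d0; apply: ereal_inf_lbound; exists (c + d) => //.
  rewrite lee_fin in c0; split; first by rewrite addr_ge0 // ltW.
  by apply: (interleaving_le ssC maxGamma bF bG c0 _ betaB betaC sD); rewrite ltrDl.
apply: le_ereal_inf_tmp => _ [e [e0 FG] <-].
exact: (bottleneck_le ssC maxGamma K bF bG isoF isoG).
Qed.
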